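(* Let $N\ge 1$ be an integer, $\xi\in\mathbb{C}$, and $\mu,a\in\mathbb{C}$ with $\Re(\mu)>-1$, $\Re(a)>-1$, $\Re(\mu+a)>-1$ and $\mu+a\notin\mathbb{Z}_{\ge 0}$. Then, as $s\to 0^+$, $$\tilde{E}_{2,N}((0,s);a,\mu;\xi)=1-\frac{\mu N}{\mu+a}s+O(s^2)$$ $$\quad+\frac{\Gamma(\mu+1)\Gamma(a+1)\Gamma(\mu+a+N+1)}{\Gamma(\mu+a+2)^2\,\Gamma(\mu+a+1)\Gamma(N)}\left((1-\xi)e^{\pi i\mu}-\frac{\sin\pi a}{\sin\pi(\mu+a)}\right)s^{\mu+a+1}\{1+O(s)\}+O(s^{2(\mu+a+1)}),$$ and consequently $$W_N(s;a,\mu;\xi)=-N\mu-\frac{\mu N}{\mu+a}s+O(s^2)$$ $$\quad+\frac{\Gamma(\mu+1)\Gamma(a+1)\Gamma(\mu+a+N+1)}{\Gamma(\mu+a+2)\,\Gamma(\mu+a+1)^2\,\Gamma(N)}\left((1-\xi)e^{\pi i\mu}-\frac{\sin\pi a}{\sin\pi(\mu+a)}\right)s^{\mu+a+1}\{1+O(s)\}+O(s^{2(\mu+a+1)}).$$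
   Context: For $s>0$, let $g_s(\lambda)=(\lambda-s)^{\mu}$ for $\lambda>s$ and $g_s(\lambda)=(1-\xi)e^{\pi i\mu}(s-\lambda)^{\mu}$ for $0<\lambda<s$ (powers of positive reals are principal). The Laguerre unitary ensemble average, normalised to tend to $1$ as $s\to0^+$, is $$\tilde{E}_{2,N}((0,s);a,\mu;\xi):=\frac{1}{N!\,C_{N,a+\mu}}\int_{[0,\infty)^N}\prod_{l=1}^N g_s(\lambda_l)\lambda_l^{a}e^{-\lambda_l}\prod_{1\le j<k\le N}(\lambda_k-\lambda_j)^2\,d\lambda_1\cdots d\lambda_N,\qquad C_{N,\alpha}:=\prod_{j=0}^{N-1}\Gamma(j+1)\Gamma(j+\alpha+1).$$ Equivalently, $\tilde{E}_{2,N}=\frac{1}{C_{N,a+\mu}}\det[w_{j+k}]_{j,k=0,\ldots,N-1}$ with $w_n=\int_0^\infty g_s(\lambda)\lambda^{n+a}e^{-\lambda}\,d\lambda$. For small $s>0$, $$W_N(s;a,\mu;\xi):=s\frac{d}{ds}\log\left(s^{-N\mu}\tilde{E}_{2,N}((0,s);a,\mu;\xi)\right)=-N\mu+s\,\frac{\frac{d}{ds}\tilde{E}_{2,N}}{\tilde{E}_{2,N}}.$$ $O(s^{\beta})$ with complex $\beta$ means $O(|s^{\beta}|)=O(s^{\Re\beta})$. *)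

(* Defs.v *)
From HB Require Import structures.
From mathcomp Require Import all_boot all_order all_algebra.
From mathcomp Require Import all_classical all_reals all_analysis.

Set Implicit Arguments.
Unset Strict Implicit.
Unset Printing Implicit Defensive.

Import Order.TTheory GRing.Theory Num.Theory.
Import numFieldNormedType.Exports.
From mathcomp Require Import complex.
Import ComplexField.Normc.

Local Open Scope classical_set_scope.
Local Open Scope ring_scope.

Section lebesgue_tuple.
Context (R : realType).
Local Notation RT := (measurableTypeR R).

Definition cons_pair n (p : RT * n.-tuple RT) : n.+1.-tuple RT :=
  [tuple of p.1 :: p.2].

Lemma measurable_cons_pair n :
  measurable_fun [set: RT * n.-tuple RT] (@cons_pair n).
Proof. exact: (measurable_cons measurable_fst measurable_snd). Qed.

Section lebesgue_cons.
Local Open Scope ereal_scope.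
Variables (n : nat) (m : {sigma_finite_measure set (n.-tuple RT) -> \bar R}).

Local Notation mu := (@lebesgue_measure R \x m).

Definition lebesgue_cons : set (n.+1.-tuple RT) -> \bar R :=
  pushforward mu (@cons_pair n).

Let preim A : measurable A -> measurable (@cons_pair n @^-1` A).
Proof.
by move=> mA; rewrite -[X in measurable X]setTI; exact: measurable_cons_pair.
Qed.

Let lebesgue_cons0 : lebesgue_cons set0 = 0.
Proof. by rewrite /lebesgue_cons /pushforward preimage_set0 measure0. Qed.

Let lebesgue_cons_ge0 A : 0 <= lebesgue_cons A.
Proof. by rewrite /lebesgue_cons /pushforward measure_ge0. Qed.

Let lebesgue_cons_sigma_additive : semi_sigma_additive lebesgue_cons.
Proof.
move=> F mF tF mUF; rewrite /lebesgue_cons /pushforward preimage_bigcup.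
apply: measure_semi_sigma_additive.
- by move=> k; exact: preim.
- apply/trivIsetP => /= i j _ _ ij; rewrite -preimage_setI.
  by move/trivIsetP : tF => /(_ _ _ _ _ ij) ->//; rewrite preimage_set0.
- by rewrite -preimage_bigcup; exact: preim.
Qed.

HB.instance Definition _ := isMeasure.Build _ _ _ lebesgue_cons
  lebesgue_cons0 lebesgue_cons_ge0 lebesgue_cons_sigma_additive.

Let lebesgue_cons_sigma_finite : sigma_finite setT lebesgue_cons.
Proof.
have /sigma_finiteP[F [FT ndF Foo]] := sigma_finiteT (@lebesgue_measure R).
have /sigma_finiteP[G [GT ndG Goo]] := sigma_finiteT m.
pose unc (t : n.+1.-tuple RT) : (RT * n.-tuple RT)%type :=
  (thead t, [tuple of behead t]).
have munc : measurable_fun setT unc.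
  apply/measurable_fun_pairP; split.
    exact: measurable_tnth.
  exact: measurable_behead.
have consK : cancel (@cons_pair n) unc.
  by move=> [x t]; congr pair; apply/val_inj.
exists (fun k => unc @^-1` (F k `*` G k)).
  apply/seteqP; split => t _ //.
  have : [set: RT] (unc t).1 by []; rewrite FT => -[i _ Fi].
  have : [set: n.-tuple RT] (unc t).2 by []; rewrite GT => -[j _ Gj].
  exists (maxn i j) => //; split.
    by move: Fi; exact/subsetPset/ndF/leq_maxl.
  by move: Gj; exact/subsetPset/ndG/leq_maxr.
move=> k; have [mF Fk] := Foo k; have [mG Gk] := Goo k; split.
  by rewrite -[X in measurable X]setTI; apply: munc => //; exact: measurableX.
rewrite /lebesgue_cons /pushforward -comp_preimage.
rewrite (_ : unc \o _ = id) ?preimage_id;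
  last by apply/funext => x; exact: consK.
by rewrite product_measure1E// lte_mul_pinfty// ge0_fin_numE.
Qed.

HB.instance Definition _ := Measure_isSigmaFinite.Build _ _ _ lebesgue_cons
  lebesgue_cons_sigma_finite.

End lebesgue_cons.

Fixpoint lebesgue_tuple n : {sigma_finite_measure set (n.-tuple RT) -> \bar R} :=
  if n is k.+1 then lebesgue_cons (lebesgue_tuple k) else \d_[tuple].

(* The measure of a box is the product of the measures of its sides, which
   characterizes n-dimensional Lebesgue measure. *)
Lemma lebesgue_tuple_box n (A : 'I_n -> set RT) :
  (forall i, measurable (A i)) ->
  lebesgue_tuple n [set t | forall i, A i (tnth t i)] =
  (\prod_(i < n) lebesgue_measure (A i))%E.
Proof.
elim: n A => [|n IH] A mA /=.
  by rewrite big_ord0 diracE mem_set// => -[].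
rewrite big_ord_recl -IH// /lebesgue_cons /pushforward.
rewrite -product_measure1E//.
  congr (_ _); apply/seteqP; split => -[x t] /=.
    by move=> h; split=> [|i]; [exact: (h ord0)|by have := h (lift ord0 i); rewrite tnthS].
  move=> [hx ht] i; case: (unliftP ord0 i) => [j ->|->//].
  by rewrite tnthS; exact: ht.
rewrite (_ : [set _ | _] = \bigcap_(i in setT) ((@tnth n RT)^~ i @^-1` A (lift ord0 i))).
  apply: fin_bigcap_measurable => // i _.
  by rewrite -[X in measurable X]setTI; exact: measurable_tnth.
by apply/seteqP; split => t /= h i; [move=> _; exact: h|exact: h].
Qed.

End lebesgue_tuple.

Section complex_functions.
Context (R : realType).
Implicit Types (z : R[i]) (s x : R) (f g : R -> R[i]).
Local Open Scope complex_scope.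

Definition cexp z : R[i] :=
  (expR (Re z) * cos (Im z)) +i* (expR (Re z) * sin (Im z)).

Definition csin z : R[i] := (cexp (z * 'i%C) - cexp (- (z * 'i%C))) / (2%:R * 'i%C).

(* Principal power; meaningful for 0 < x only (ln 0 = 0 in the library). *)
Definition cpow x z : R[i] := cexp (z * (ln x)%:C).

Definition cintegral d (T : measurableType d) (m : {measure set T -> \bar R})
    (D : set T) (F : T -> R[i]) : R[i] :=
  (\int[m]_(t in D) Re (F t)) +i* (\int[m]_(t in D) Im (F t)).

(* Euler's integral, which represents Gamma on the half-plane 0 < Re z. *)
Definition cGamma z : R[i] :=
  cintegral (@lebesgue_measure R) `]0, +oo[
    (fun t => cpow t (z - 1) * (expR (- t))%:C).

Definition cderivable f s :=
  derivable (fun x => Re (f x)) s 1 /\ derivable (fun x => Im (f x)) s 1.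

Definition cderive f s : R[i] :=
  (derive1 (fun x => Re (f x)) s) +i* (derive1 (fun x => Im (f x)) s).

Definition isO f (b : R[i]) : Prop :=
  (fun x => normc (f x)) =O_ (0^'+) (fun x => normc (cpow x b)).

End complex_functions.

Section laguerre.
Context (R : realType).
Local Open Scope complex_scope.

(* The value at l = s is immaterial. *)
Definition jump_weight (mu xi : R[i]) (s l : R) : R[i] :=
  if s < l then cpow (l - s) mu
  else if l < s then (1 - xi) * cexp ((pi : R)%:C * 'i%C * mu) * cpow (s - l) mu
  else 0.

Definition lue_const (N : nat) (alpha : R[i]) : R[i] :=
  \prod_(j < N) (cGamma (j.+1)%:R * cGamma (j%:R + alpha + 1)).

Definition lue_integrand (N : nat) (a mu xi : R[i]) (s : R) (l : N.-tuple R) :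
    R[i] :=
  (\prod_(i < N) (jump_weight mu xi s (tnth l i) * cpow (tnth l i) a *
                  (expR (- tnth l i))%:C)) *
  (\prod_(j < N) \prod_(k < N | (j < k)%N) (tnth l k - tnth l j) ^+ 2)%:C.

Definition lue_average (N : nat) (a mu xi : R[i]) (s : R) : R[i] :=
  (N`!%:R * lue_const N (a + mu))^-1 *
  cintegral (lebesgue_tuple R N) [set l | forall i, 0 <= tnth l i]
    (lue_integrand a mu xi s).

(* The logarithmic derivative is taken as f' / f, so that no branch of the
   logarithm of the complex-valued f has to be chosen. *)
Definition lue_W (N : nat) (a mu xi : R[i]) (s : R) : R[i] :=
  let f x := cpow x (- (N%:R * mu)) * lue_average N a mu xi x in
  s%:C * (cderive f s / f s).

End laguerre.

(* Main.v *)
Require Import Defs.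
From HB Require Import structures.
From mathcomp Require Import all_boot all_order all_algebra.
From mathcomp Require Import all_classical all_reals all_analysis.
From mathcomp Require Import perm measurable_realfun.
From mathcomp Require Import ring lra.

Set Implicit Arguments.
Unset Strict Implicit.
Unset Printing Implicit Defensive.

Import Order.TTheory GRing.Theory Num.Theory.
Import numFieldNormedType.Exports.
From mathcomp Require Import complex.
Import ComplexField.Normc.

Local Open Scope classical_set_scope.
Local Open Scope ring_scope.
Local Open Scope complex_scope.

(** Write [al = mu + a].  The weight has one algebraic singularity, at [s], next to
    the one at the origin; when [s] tends to [0] the two merge into a single power
    [mu + a], and the expansion measures how the moments feel the merging.

    Andreief's identity ([cintegral_lue_integrand]) turns the average into the
    determinant of the moments [w_(i+j)], up to the constant.  Cutting the moment of
    order [n] at [s] ([cintegral_weight]) gives [exp (- s) J] plus a constant times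
    [s^(al+n+1)] times an integral over the unit interval, where [J] is the integral
    of [u^mu (u + s)^(a+n) exp (- u)] over the half-line, [kint mu (a + n) s 1].

    Asymptotics of [J].  Let [J_(m,b)] be [kint m b s 1].  Its derivative in [s] is
    [b J_(m,b-1)], and comparing this with the derivative of the scaled form
    [s^(m+b+1) kint m b 1 s] gives the contiguous relation [kint_contiguous].
    Integrating bounds on the derivative up from the origin, twice, yields
    [Gamma (m+b+1) + b Gamma (m+b) s] with an error of order
    [s^2 + s^(Re (m+b) + 1)] ([kint_expansion1]).  This is enough for every moment
    except that of order [0] when [-1 < Re al < 1].  In that case the remainder
    divided by [s^(al+1)] has a small derivative and so tends to its limit at a
    known rate ([kint_expansion2]); two steps of the contiguous relation lower the
    exponent [b] until the scaled integral converges at [s = 0], so that the limit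
    is a Beta integral over the half-line ([kint_remainder_limit]), and Euler's
    reflection formula makes of it the quotient of sines ([kint_limit_constant]).

    The Gamma function enters only through its integral.  The two Beta integrals are
    instances of Fubini's theorem ([beta_half_line], [beta_unit_interval]).  The
    reflection formula ([cGamma_reflection]) and the absence of zeros
    ([cGamma_neq0]) come from Gauss's limit ([gauss_limit_bound]), obtained by
    concentration of [x^n exp (- x)] around [n], and from the product formula for
    the sine, obtained by concentration of [cos^n] around [0]
    ([cosint_concentration]).

    Algebra of expansions.  All errors are compared with the square of the scale
    [s + s^(Re al + 1)].  Expansions [c0 + c1 s + c2 s^(al+1)] up to that square,
    together with the termwise expansion of their Euler derivative [s d/ds], are
    stable under sums and products, hence under determinants ([two_scale],
    [two_scale_det]).  To this order the moment of order [k] is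
    [g (k+1) - mu g k s] with [g (k+1) = (al + k) g k], plus a multiple of
    [s^(al+1)] for [k = 0] only ([two_scale_moment]).  The coefficients [c0], [c1]
    and [c2] of the determinant are therefore a Hankel determinant of shifted
    factorials ([det_hankel]), its variation under a shift of the columns
    ([coef1_det_hankel_shift]), and the minor opposite to the corner
    ([coef_det_corner]).

    Finally, the logarithmic derivative of a function with constant term [1] has the
    expansion of the Euler derivative ([two_scale_log_derivative]), and since one of
    [s] and [s^(Re al + 1)] dominates the scale, one of the two error terms takes
    the whole remainder ([two_scale_remainder]). *)

(** * Complex numbers, exponentials and powers *)

Section complex_basics.
Context {R : realType}.
Implicit Types (z w : R[i]) (x y : R).

Lemma Re_add z w : Re (z + w) = Re z + Re w. Proof. by case: z; case: w. Qed.
Lemma Im_add z w : Im (z + w) = Im z + Im w. Proof. by case: z; case: w. Qed.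
Lemma Re_opp z : Re (- z) = - Re z. Proof. by case: z. Qed.
Lemma Im_opp z : Im (- z) = - Im z. Proof. by case: z. Qed.
Lemma Re_sub z w : Re (z - w) = Re z - Re w. Proof. by rewrite Re_add Re_opp. Qed.
Lemma Im_sub z w : Im (z - w) = Im z - Im w. Proof. by rewrite Im_add Im_opp. Qed.
Lemma Re_mul z w : Re (z * w) = Re z * Re w - Im z * Im w.
Proof. by case: z; case: w. Qed.
Lemma Im_mul z w : Im (z * w) = Re z * Im w + Im z * Re w.
Proof. by case: z; case: w => *; rewrite /= addrC. Qed.
Lemma ReZr z x : Re (z * x%:C) = Re z * x.
Proof. by rewrite Re_mul/= mulr0 subr0. Qed.
Lemma ImZr z x : Im (z * x%:C) = Im z * x.
Proof. by rewrite Im_mul/= mulr0 add0r. Qed.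
Lemma Re_nat n : Re (n%:R : R[i]) = n%:R.
Proof. by elim: n => // n IH; rewrite -natr1 Re_add IH -[RHS]natr1. Qed.
Lemma Im_nat n : Im (n%:R : R[i]) = 0.
Proof. by elim: n => // n IH; rewrite -natr1 Im_add IH addr0. Qed.

Lemma complex_eqP z w : Re z = Re w -> Im z = Im w -> z = w.
Proof. by case: z => a b; case: w => c d /= -> ->. Qed.

Lemma natC n : (n%:R : R[i]) = (n%:R : R)%:C.
Proof. by rewrite rmorph_nat. Qed.

Lemma normc_ge0 z : 0 <= normc z.
Proof. by case: z => a b; exact: sqrtr_ge0. Qed.

Lemma normc_real x : normc x%:C = `|x|.
Proof. by rewrite /= expr0n /= addr0 sqrtr_sqr. Qed.

Lemma normc_nat n : normc (n%:R : R[i]) = n%:R.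
Proof. by rewrite natC normc_real normr_nat. Qed.

Lemma Re_le_normc z : `|Re z| <= normc z.
Proof.
case: z => a b /=; rewrite -sqrtr_sqr ler_wsqrtr//.
by rewrite lerDl sqr_ge0.
Qed.

Lemma Im_le_normc z : `|Im z| <= normc z.
Proof.
case: z => a b /=; rewrite -sqrtr_sqr ler_wsqrtr//.
by rewrite lerDr sqr_ge0.
Qed.

Lemma normc_le_ReIm z : normc z <= `|Re z| + `|Im z|.
Proof.
have -> : z = (Re z)%:C + (Im z)%:C * 'i%C.
  by case: z => a b; apply: complex_eqP; rewrite ?(Re_add, Im_add, Re_mul, Im_mul)/=; ring.
rewrite (le_trans (le_normcD _ _))// normcM !normc_real.
rewrite ?(Re_add, Im_add, Re_mul, Im_mul)/= !(mulr0, mul0r, mulr1, addr0, subr0, add0r).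
by rewrite expr0n/= add0r expr1n sqrtr1 mulr1.
Qed.

Lemma normcB z w : normc (z - w) <= normc z + normc w.
Proof. by rewrite (le_trans (le_normcD _ _))// normcN. Qed.

Lemma normc_eq0 z : (normc z == 0) = (z == 0).
Proof.
apply/eqP/eqP => [|->]; first exact: eq0_normc.
by rewrite normc0.
Qed.

Lemma normc_gt0 z : (0 < normc z) = (z != 0).
Proof. by rewrite lt_def normc_eq0 normc_ge0 andbT. Qed.

Lemma cexpD z w : cexp (z + w) = cexp z * cexp w.
Proof.
apply: complex_eqP; rewrite ?(Re_mul, Im_mul)/= Re_add Im_add expRD ?cosD ?sinD; ring.
Qed.

Lemma cexp0 : cexp (0 : R[i]) = 1.
Proof. by rewrite /cexp/= expR0 cos0 sin0 mulr1 mulr0. Qed.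

Lemma normc_cexp z : normc (cexp z) = expR (Re z).
Proof.
rewrite /cexp/= !exprMn -mulrDr cos2Dsin2 mulr1 sqrtr_sqr.
by rewrite ger0_norm// expR_ge0.
Qed.

Lemma cexp_neq0 z : cexp z != 0.
Proof. by rewrite -normc_gt0 normc_cexp expR_gt0. Qed.

Lemma cexpN z : cexp (- z) = (cexp z)^-1.
Proof.
apply: (mulfI (cexp_neq0 z)); rewrite -cexpD subrr cexp0 divff//.
exact: cexp_neq0.
Qed.

Lemma cexp_real x : cexp x%:C = (expR x)%:C.
Proof. by rewrite /cexp/= cos0 sin0 mulr1 mulr0. Qed.

Lemma cpowD x z w : cpow x (z + w) = cpow x z * cpow x w.
Proof. by rewrite /cpow mulrDl cexpD. Qed.

Lemma cpow0 x : cpow x 0 = 1.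
Proof. by rewrite /cpow mul0r cexp0. Qed.

Lemma cpow_1 z : cpow (1 : R) z = 1.
Proof. by rewrite /cpow ln1 mulr0 cexp0. Qed.

Lemma cpow_neq0 x z : cpow x z != 0. Proof. exact: cexp_neq0. Qed.

Lemma cpowN x z : cpow x (- z) = (cpow x z)^-1.
Proof. by rewrite /cpow mulNr cexpN. Qed.

Lemma cpow1 x : 0 < x -> cpow x 1 = x%:C.
Proof. by move=> x0; rewrite /cpow mul1r cexp_real lnK. Qed.

Lemma cpow_real x p : 0 < x -> cpow x p%:C = (x `^ p)%:C.
Proof. by move=> x0; rewrite /cpow -rmorphM cexp_real /powR gt_eqF. Qed.

Lemma cpow_nat x n : 0 < x -> cpow x n%:R = (x ^+ n)%:C.
Proof.
move=> x0; elim: n => [|n IH]; first by rewrite cpow0.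
by rewrite -natr1 cpowD IH cpow1// exprSr rmorphM.
Qed.

Lemma cpowS x z : 0 < x -> cpow x (z + 1) = x%:C * cpow x z.
Proof. by move=> x0; rewrite cpowD cpow1// mulrC. Qed.

Lemma cpowM x y z : 0 < x -> 0 < y -> cpow (x * y) z = cpow x z * cpow y z.
Proof. by move=> x0 y0; rewrite /cpow lnM// rmorphD mulrDr cexpD. Qed.

Lemma cpow_inv x z : 0 < x -> cpow x^-1 z = cpow x (- z).
Proof. by move=> x0; rewrite /cpow lnV// rmorphN mulrN mulNr. Qed.

Lemma normc_cpow x z : 0 < x -> normc (cpow x z) = x `^ (Re z).
Proof.
move=> x0; rewrite normc_cexp /powR gt_eqF//.
by rewrite Re_mul/= mulr0 subr0.
Qed.

Lemma powRS x p : 0 < x -> x `^ (p + 1) = x * x `^ p.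
Proof.
move=> x0; rewrite powRD; last by rewrite (gt_eqF x0) implybT.
by rewrite powRr1 ?ltW// mulrC.
Qed.

Lemma powRDr x p q : 0 < x -> x `^ (p + q) = x `^ p * x `^ q.
Proof. by move=> x0; rewrite powRD// (gt_eqF x0) implybT. Qed.

End complex_basics.

HB.lock Definition cder (R : realType) (f : R -> R[i]) (s : R) (l : R[i]) : Prop :=
  is_derive s 1 (fun x => Re (f x)) (Re l) /\
  is_derive s 1 (fun x => Im (f x)) (Im l).

Section complex_derivative.
Context {R : realType}.
Implicit Types (f g : R -> R[i]) (s : R) (l z : R[i]).

Lemma cderP f s l : cder f s l <->
  is_derive s 1 (fun x => Re (f x)) (Re l) /\
  is_derive s 1 (fun x => Im (f x)) (Im l).
Proof. by rewrite cder.unlock. Qed.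

Lemma cder_eq f s l l' : cder f s l -> l = l' -> cder f s l'.
Proof. by move=> + <-. Qed.

Lemma cder_cderivable f s l : cder f s l -> cderivable f s.
Proof. by move=> /cderP[h1 h2]; split; [case: h1|case: h2]. Qed.

Lemma cder_cderive f s l : cder f s l -> cderive f s = l.
Proof.
by move=> /cderP[h1 h2]; apply: complex_eqP; rewrite /cderive/= derive1E derive_val.
Qed.

Lemma cder_unique f s l l' : cder f s l -> cder f s l' -> l = l'.
Proof. by move=> /cder_cderive <- /cder_cderive <-. Qed.

Lemma cderD f g s l l' : cder f s l -> cder g s l' ->
  cder (fun x => f x + g x) s (l + l').
Proof.
move=> /cderP[f1 f2] /cderP[g1 g2]; apply/cderP; split.
  under eq_fun do rewrite Re_add.
  by rewrite Re_add; exact: is_deriveD.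
under eq_fun do rewrite Im_add.
by rewrite Im_add; exact: is_deriveD.
Qed.

Lemma cder_cst z s : cder (fun=> z) s 0.
Proof. by apply/cderP; split => /=; exact: is_derive_cst. Qed.

Let is_deriveM' (f g : R -> R) s a b : is_derive s 1 f a -> is_derive s 1 g b ->
  is_derive s 1 (fun x => f x * g x) (f s * b + a * g s).
Proof.
move=> hf hg; have h := is_deriveM hf hg; apply: (is_derive_eq h).
by rewrite (mulrC a).
Qed.

Lemma cderM f g s l l' : cder f s l -> cder g s l' ->
  cder (fun x => f x * g x) s (f s * l' + l * g s).
Proof.
move=> /cderP[f1 f2] /cderP[g1 g2]; apply/cderP; split.
  under eq_fun do rewrite Re_mul.
  rewrite Re_add !Re_mul.
  have h1 := is_deriveM' f1 g1; have h2 := is_deriveM' f2 g2.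
  have h := is_deriveB h1 h2.
  by apply: (is_derive_eq h); ring.
under eq_fun do rewrite Im_mul.
rewrite Im_add !Im_mul.
have h1 := is_deriveM' f1 g2; have h2 := is_deriveM' f2 g1.
have h := is_deriveD h1 h2.
by apply: (is_derive_eq h); ring.
Qed.

Lemma cderZ z f s l : cder f s l -> cder (fun x => z * f x) s (z * l).
Proof.
move=> h; apply: cder_eq (cderM (cder_cst z s) h) _.
by rewrite mul0r addr0.
Qed.

Lemma cderN f s l : cder f s l -> cder (fun x => - f x) s (- l).
Proof.
move=> h; rewrite (_ : (fun x => _) = fun x => -1 * f x).
  by apply: cder_eq (cderZ (-1) h) _; rewrite mulN1r.
by apply/funext => x; rewrite mulN1r.
Qed.

Lemma cderB f g s l l' : cder f s l -> cder g s l' ->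
  cder (fun x => f x - g x) s (l - l').
Proof. by move=> hf /cderN; exact: cderD. Qed.

Lemma cder_real (f : R -> R) s (a : R) : is_derive s 1 f a ->
  cder (fun x => (f x)%:C) s a%:C.
Proof. by move=> h; apply/cderP; split => //=; exact: is_derive_cst. Qed.

Lemma cder_comp f (g : R -> R) s l (a : R) : is_derive s 1 g a ->
  cder f (g s) l -> cder (fun x => f (g x)) s (l * a%:C).
Proof.
move=> hg /cderP[h1 h2]; apply/cderP; split.
  have := is_derive1_comp h1 hg.
  by rewrite Re_mul /= mulr0 subr0.
have := is_derive1_comp h2 hg.
by rewrite Im_mul /= mulr0 add0r.
Qed.

Lemma cder_near_eq f g s l : (\forall x \near s, f x = g x) ->
  cder f s l -> cder g s l.
Proof.
move=> fg /cderP[h1 h2]; apply/cderP; split.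
  by apply: near_eq_is_derive h1; apply: filterS fg => x ->.
by apply: near_eq_is_derive h2; apply: filterS fg => x ->.
Qed.

Lemma cder_cexp z s :
  cder (fun x => cexp (z * x%:C)) s (z * cexp (z * s%:C)).
Proof.
pose er x := expR (Re z * x).
pose c x := cos (Im z * x); pose sn x := sin (Im z * x).
have -> : (fun x => cexp (z * x%:C)) =
    (fun x => (er x)%:C * ((c x)%:C + (sn x)%:C * 'i%C)).
  apply/funext => x; rewrite /cexp ReZr ImZr.
  by apply: complex_eqP; rewrite ?(Re_mul, Im_mul, Re_add, Im_add)/= /er /c /sn; ring.
have lin a : is_derive s 1 (fun x : R => a * x) a.
  have := is_deriveZ a (is_derive_id s (1 : R)).
  by move=> h; apply: (is_derive_eq h); exact: mulr1.
have her := cder_real (is_derive1_comp (is_derive_expR (Re z * s)) (lin (Re z))).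
have hc := cder_real (is_derive1_comp (is_derive_cos (Im z * s)) (lin (Im z))).
have hs := cder_real (is_derive1_comp (is_derive_sin (Im z * s)) (lin (Im z))).
have h := cderM her (cderD hc (cderM hs (cder_cst 'i%C s))).
apply: cder_eq h _.
have zsE : cexp (z * s%:C) = (er s)%:C * ((c s)%:C + (sn s)%:C * 'i%C).
  rewrite /cexp ReZr ImZr.
  by apply: complex_eqP; rewrite ?(Re_mul, Im_mul, Re_add, Im_add)/= /er /c /sn; ring.
rewrite zsE; rewrite -/(er s) -/(c s) -/(sn s).
apply: complex_eqP; rewrite ?(Re_mul, Im_mul, Re_add, Im_add)/=;
  rewrite -/(er s) -/(c s) -/(sn s); ring.
Qed.

Lemma cder_cpow z s : 0 < s ->
  cder (fun x => cpow x z) s (z * cpow s (z - 1)).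
Proof.
move=> s0; apply: cder_eq (cder_comp (is_derive1_ln s0) (cder_cexp z (ln s))) _.
rewrite cpowD cpowN cpow1// -mulrA; congr (_ * (_ * _)).
by rewrite -fmorphV.
Qed.

Lemma cder_cpow_shift z (u s : R) : 0 < u + s ->
  cder (fun x => cpow (u + x) z) s (z * cpow (u + s) (z - 1)).
Proof.
move=> us; have h : is_derive s 1 (fun x : R => u + x) 1.
  have := is_deriveD (is_derive_cst u s (1:R)) (is_derive_id s (1 : R)).
  by rewrite add0r.
apply: cder_eq (cder_comp h (cder_cpow z us)) _.
by rewrite mulr1.
Qed.

End complex_derivative.

(** * Integrals of complex functions *)

HB.lock Definition cmeas d (T : measurableType d) (R : realType)
    (D : set T) (F : T -> R[i]) : Prop :=
  measurable_fun D (fun x => Re (F x)) /\ measurable_fun D (fun x => Im (F x)).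

HB.lock Definition cintble d (T : measurableType d) (R : realType)
    (m : {measure set T -> \bar R}) (D : set T) (F : T -> R[i]) : Prop :=
  m.-integrable D (EFin \o (fun x => Re (F x))) /\
  m.-integrable D (EFin \o (fun x => Im (F x))).

Section complex_integral.
Context d (T : measurableType d) (R : realType).
Implicit Types (m : {measure set T -> \bar R}) (D : set T) (F G : T -> R[i]).

Lemma cmeasP D F : cmeas D F <->
  measurable_fun D (fun x => Re (F x)) /\ measurable_fun D (fun x => Im (F x)).
Proof. by rewrite cmeas.unlock. Qed.

Lemma cintbleP m D F : cintble m D F <->
  m.-integrable D (EFin \o (fun x => Re (F x))) /\
  m.-integrable D (EFin \o (fun x => Im (F x))).
Proof. by rewrite cintble.unlock. Qed.

Lemma cintble_cmeas m D F : cintble m D F -> cmeas D F.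
Proof. by move=> /cintbleP[h1 h2]; apply/cmeasP; split; apply/measurable_EFinP; [case/integrableP: h1|case/integrableP: h2].
Qed.

Lemma cmeas_eq D F G : (forall x, D x -> F x = G x) -> cmeas D F -> cmeas D G.
Proof.
move=> FG /cmeasP[h1 h2]; apply/cmeasP; split.
  by apply: eq_measurable_fun h1 => x /[!inE] Dx; rewrite FG.
by apply: eq_measurable_fun h2 => x /[!inE] Dx; rewrite FG.
Qed.

Lemma cmeas_cst D (z : R[i]) : cmeas D (fun=> z).
Proof. by apply/cmeasP; split; exact: measurable_cst. Qed.

Lemma cmeas_real D (f : T -> R) : measurable_fun D f -> cmeas D (fun x => (f x)%:C).
Proof. by move=> h; apply/cmeasP; split => //=. Qed.

Lemma cmeasM D F G : cmeas D F -> cmeas D G -> cmeas D (fun x => F x * G x).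
Proof.
move=> /cmeasP[f1 f2] /cmeasP[g1 g2]; apply/cmeasP; split.
  by under eq_fun do rewrite Re_mul; apply: measurable_funB; exact: measurable_funM.
by under eq_fun do rewrite Im_mul; apply: measurable_funD; exact: measurable_funM.
Qed.

Lemma cmeasB D F G : cmeas D F -> cmeas D G -> cmeas D (fun x => F x - G x).
Proof.
move=> /cmeasP[f1 f2] /cmeasP[g1 g2]; apply/cmeasP; split.
  by under eq_fun do rewrite Re_sub; exact: measurable_funB.
by under eq_fun do rewrite Im_sub; exact: measurable_funB.
Qed.

Lemma cmeas_cpow D (f : T -> R) z : measurable_fun D f ->
  cmeas D (fun x => cpow (f x) z).
Proof.
move=> mf.
have ml : measurable_fun D (fun x => ln (f x)).
  by apply: measurableT_comp mf; exact: measurable_ln.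
have h1 : measurable_fun D (fun x => expR (Re (z * (ln (f x))%:C))).
  apply: measurableT_comp; first exact: measurable_expR.
  by under eq_fun do rewrite ReZr; exact: measurable_funM.
have h2 : measurable_fun D (fun x => Im (z * (ln (f x))%:C)).
  by under eq_fun do rewrite ImZr; exact: measurable_funM.
apply/cmeasP; split => /=; apply: measurable_funM => //.
  by apply: measurableT_comp h2; apply: continuous_measurable_fun; exact: continuous_cos.
by apply: measurableT_comp h2; apply: continuous_measurable_fun; exact: continuous_sin.
Qed.

Lemma measurable_normc D F : cmeas D F -> measurable_fun D (fun x => normc (F x)).
Proof.
move=> /cmeasP[h1 h2].
have -> : (fun x => normc (F x)) = (fun x => Num.sqrt (Re (F x) ^+ 2 + Im (F x) ^+ 2)).
  by apply/funext => x; case: (F x).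
apply: (@measurableT_comp _ _ _ _ _ _ (@Num.sqrt R)).
  by apply: continuous_measurable_fun; exact: sqrt_continuous.
by apply: measurable_funD; exact: measurable_funX.
Qed.

Lemma cintble_le m D F (g : T -> R) : measurable D -> cmeas D F ->
  (forall x, D x -> normc (F x) <= g x) -> m.-integrable D (EFin \o g) ->
  cintble m D F.
Proof.
move=> mD /cmeasP[h1 h2] Fg ig; apply/cintbleP; split.
  apply: (le_integrable mD _ _ ig); first exact/measurable_EFinP.
  move=> x Dx /=; rewrite lee_fin (le_trans (Re_le_normc _))//.
  by rewrite (le_trans (Fg _ Dx))// ler_norm.
apply: (le_integrable mD _ _ ig); first exact/measurable_EFinP.
move=> x Dx /=; rewrite lee_fin (le_trans (Im_le_normc _))//.
by rewrite (le_trans (Fg _ Dx))// ler_norm.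
Qed.

Lemma cintble_normc m D F : measurable D -> cintble m D F ->
  m.-integrable D (EFin \o (fun x => normc (F x))).
Proof.
move=> mD iF; have mF := cintble_cmeas iF; case/cintbleP: iF => h1 h2.
have i1 := integrable_norm h1; have i2 := integrable_norm h2.
have := integrableD mD i1 i2.
apply: le_integrable => //.
  exact/measurable_EFinP/measurable_normc.
move=> x Dx /=; rewrite lee_fin ger0_norm ?normc_ge0//.
by rewrite (le_trans (normc_le_ReIm _))// ler_norm.
Qed.

Lemma cintble_eq m D F G : (forall x, D x -> F x = G x) -> cintble m D F ->
  measurable D -> cintble m D G.
Proof.
move=> FG /cintbleP[h1 h2] mD; apply/cintbleP; split.
  by move: h1; apply: eq_integrable => // x /[!inE] Dx /=; rewrite FG.
by move: h2; apply: eq_integrable => // x /[!inE] Dx /=; rewrite FG.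
Qed.

Lemma cintbleD m D F G : measurable D -> cintble m D F -> cintble m D G ->
  cintble m D (fun x => F x + G x).
Proof.
move=> mD /cintbleP[f1 f2] /cintbleP[g1 g2]; apply/cintbleP; split.
  have := integrableD mD f1 g1; apply: eq_integrable => // x _ /=.
  by rewrite Re_add.
have := integrableD mD f2 g2; apply: eq_integrable => // x _ /=.
by rewrite Im_add.
Qed.

Lemma cintbleZ m D F z : measurable D -> cintble m D F ->
  cintble m D (fun x => z * F x).
Proof.
move=> mD iF; have := cintble_normc mD iF.
move=> /(integrableZl mD (normc z)) h.
apply: (cintble_le mD _ _ h).
  by apply: cmeasM; [exact: cmeas_cst|exact: cintble_cmeas iF].
by move=> x _ /=; rewrite normcM.
Qed.

Lemma cintble0 m D : measurable D -> cintble m D (fun=> 0).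
Proof. by move=> mD; apply/cintbleP; split; exact: integrable0. Qed.

Lemma cintble_sum m D (I : Type) (r : seq I) (P : pred I) (F : I -> T -> R[i]) :
  measurable D -> (forall i, P i -> cintble m D (F i)) ->
  cintble m D (fun x => \sum_(i <- r | P i) F i x).
Proof.
move=> mD iF; elim: r => [|i r IH].
  by apply: cintble_eq (cintble0 m mD) mD => x _; rewrite big_nil.
case Pi : (P i).
  apply: cintble_eq (cintbleD mD (iF _ Pi) IH) mD => x _.
  by rewrite big_cons Pi.
by apply: cintble_eq IH mD => x _; rewrite big_cons Pi.
Qed.

Lemma cintegral_eq m D F G : (forall x, D x -> F x = G x) ->
  cintegral m D F = cintegral m D G.
Proof.
move=> FG; rewrite /cintegral; congr Complex.
  by apply: eq_Rintegral => x /[!inE] Dx; rewrite FG.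
by apply: eq_Rintegral => x /[!inE] Dx; rewrite FG.
Qed.

Lemma cintegralD m D F G : measurable D -> cintble m D F -> cintble m D G ->
  cintegral m D (fun x => F x + G x) = cintegral m D F + cintegral m D G.
Proof.
move=> mD /cintbleP[f1 f2] /cintbleP[g1 g2]; rewrite /cintegral; apply: complex_eqP => /=.
  by under eq_Rintegral do rewrite Re_add; rewrite RintegralD.
by under eq_Rintegral do rewrite Im_add; rewrite RintegralD.
Qed.

Lemma cintegralZ m D F z : measurable D -> cintble m D F ->
  cintegral m D (fun x => z * F x) = z * cintegral m D F.
Proof.
move=> mD /cintbleP[f1 f2]; rewrite /cintegral; apply: complex_eqP; rewrite ?(Re_mul, Im_mul) /=.
  under eq_Rintegral do rewrite Re_mul.
  rewrite RintegralB//; last 2 first.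
  - by have := integrableZl mD (Re z) f1; apply: eq_integrable.
  - by have := integrableZl mD (Im z) f2; apply: eq_integrable.
  by rewrite !RintegralZl.
under eq_Rintegral do rewrite Im_mul.
rewrite RintegralD//; last 2 first.
- by have := integrableZl mD (Re z) f2; apply: eq_integrable.
- by have := integrableZl mD (Im z) f1; apply: eq_integrable.
by rewrite !RintegralZl.
Qed.

Lemma cintbleB m D F G : measurable D -> cintble m D F -> cintble m D G ->
  cintble m D (fun x => F x - G x).
Proof.
move=> mD iF iG; have := cintbleD mD iF (cintbleZ (-1) mD iG).
by move=> h; apply: cintble_eq h mD => x _; rewrite mulN1r.
Qed.

Lemma cintegralB m D F G : measurable D -> cintble m D F -> cintble m D G ->
  cintegral m D (fun x => F x - G x) = cintegral m D F - cintegral m D G.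
Proof.
move=> mD iF iG; rewrite -[- cintegral m D G]mulN1r -cintegralZ//.
rewrite -cintegralD//; last exact: cintbleZ.
by apply: cintegral_eq => x _; rewrite mulN1r.
Qed.

Lemma cintegral_zero m D : cintegral m D (fun=> 0) = 0.
Proof.
by apply: complex_eqP => /=; rewrite /Rintegral integral0.
Qed.

Lemma cintegral_sum m D (I : Type) (r : seq I) (P : pred I) (F : I -> T -> R[i]) :
  measurable D -> (forall i, P i -> cintble m D (F i)) ->
  cintegral m D (fun x => \sum_(i <- r | P i) F i x) =
  \sum_(i <- r | P i) cintegral m D (F i).
Proof.
move=> mD iF; elim: r => [|i r IH].
  rewrite big_nil -[RHS](cintegral_zero m D).
  by apply: cintegral_eq => x _; rewrite big_nil.
rewrite big_cons; case: ifPn => Pi.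
  rewrite -IH -cintegralD//; [|exact: iF|exact: cintble_sum].
  by apply: cintegral_eq => x _; rewrite big_cons Pi.
rewrite -IH; apply: cintegral_eq => x _.
by rewrite big_cons (negbTE Pi).
Qed.

(** The factor [2] comes from bounding the real and imaginary parts separately;
    only orders of magnitude matter below. *)
Lemma normc_cintegral m D F (g : T -> R) : measurable D -> cmeas D F ->
  (forall x, D x -> normc (F x) <= g x) -> m.-integrable D (EFin \o g) ->
  normc (cintegral m D F) <= 2 * \int[m]_(x in D) g x.
Proof.
move=> mD mF Fg ig; have /cintbleP[h1 h2] := cintble_le mD mF Fg ig.
rewrite (le_trans (normc_le_ReIm _))//= mulrDl mul1r lerD//.
  rewrite (le_trans (le_normr_Rintegral mD h1))//.
  apply: le_Rintegral => //; first exact: integrable_norm.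
  by move=> x Dx; rewrite (le_trans (Re_le_normc _)) ?Fg.
rewrite (le_trans (le_normr_Rintegral mD h2))//.
apply: le_Rintegral => //; first exact: integrable_norm.
by move=> x Dx; rewrite (le_trans (Im_le_normc _)) ?Fg.
Qed.

Lemma cintegral_real m D (f : T -> R) :
  cintegral m D (fun x => (f x)%:C) = (\int[m]_(x in D) f x)%:C.
Proof. by apply: complex_eqP => //=; rewrite /Rintegral integral0. Qed.

Lemma cintegral_mkcond m D F :
  cintegral m D F = cintegral m setT (fun x => if x \in D then F x else 0).
Proof.
apply: complex_eqP => /=; rewrite Rintegral_mkcond; apply: eq_Rintegral => x _;
  by rewrite patchE; case: ifP.
Qed.

Lemma cintble_mkcond m D F : measurable D ->
  cintble m D F <-> cintble m setT (fun x => if x \in D then F x else 0).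
Proof.
move=> mD; split=> /cintbleP[h1 h2]; apply/cintbleP; split.
- move/(integrable_mkcond _ mD) : h1; apply: eq_integrable => // x _ /=.
  by rewrite patchE; case: ifP.
- move/(integrable_mkcond _ mD) : h2; apply: eq_integrable => // x _ /=.
  by rewrite patchE; case: ifP.
- apply/(integrable_mkcond _ mD); apply: eq_integrable h1 => // x _ /=.
  by rewrite patchE; case: ifP.
- apply/(integrable_mkcond _ mD); apply: eq_integrable h2 => // x _ /=.
  by rewrite patchE; case: ifP.
Qed.

Lemma cder_under_integral m D (F dF : R -> T -> R[i]) (a u v : R) (g : T -> R) :
  measurable D -> u < a < v ->
  (forall s, u < s < v -> cintble m D (F s)) ->
  (forall s x, u < s < v -> D x -> cder (F ^~ x) s (dF s x)) ->
  m.-integrable D (EFin \o g) ->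
  (forall s x, u < s < v -> D x -> normc (dF s x) <= g x) ->
  cder (fun s => cintegral m D (F s)) a (cintegral m D (dF a)).
Proof.
move=> mD uav iF dFE ig Fg.
have Ia : `]u, v[%classic a by rewrite /= in_itv.
have g0 x : 0 <= `|g x| by [].
have ig' := integrable_norm ig.
have aux (f df : R -> T -> R) :
    (forall s, u < s < v -> m.-integrable D (EFin \o f s)) ->
    (forall s x, u < s < v -> D x -> is_derive s 1 (f ^~ x) (df s x)) ->
    (forall s x, u < s < v -> D x -> `|df s x| <= g x) ->
    is_derive a 1 (fun s => \int[m]_(x in D) f s x) (\int[m]_(x in D) df a x).
  move=> If Df bf.
  have pE s x : u < s < v -> D x -> partial1of2 f s x = df s x.
    by move=> us Dx; rewrite partial1of2E; have [_ ->] := Df s x us Dx.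
  have If' s : `]u, v[%classic s -> m.-integrable D (EFin \o f s).
    by rewrite /= in_itv; exact: If.
  have Df' s x : `]u, v[%classic s -> D x -> derivable (f ^~ x) s 1.
    by rewrite /= in_itv /= => us Dx; have [] := Df s x us Dx.
  have bf' s x : `]u, v[%classic s -> D x -> `|partial1of2 f s x| <= `|g x|.
    rewrite /= in_itv /= => us Dx; rewrite pE//.
    by rewrite (le_trans (bf _ _ us Dx))// ler_norm.
  split; first exact: (derivable_under_integral mD Ia If' Df' g0 ig' bf').
  rewrite -derive1E (differentiation_under_integral mD Ia If' Df' g0 ig' bf').
  by apply: eq_Rintegral => x /[!inE] Dx; rewrite pE.
apply/cderP; split.
  apply: (aux (fun s x => Re (F s x)) (fun s x => Re (dF s x))).
  - by move=> s us; have /cintbleP[] := iF s us.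
  - by move=> s x us Dx; have /cderP[] := dFE s x us Dx.
  - by move=> s x us Dx; rewrite (le_trans (Re_le_normc _))// Fg.
apply: (aux (fun s x => Im (F s x)) (fun s x => Im (dF s x))).
- by move=> s us; have /cintbleP[] := iF s us.
- by move=> s x us Dx; have /cderP[] := dFE s x us Dx.
- by move=> s x us Dx; rewrite (le_trans (Im_le_normc _))// Fg.
Qed.

End complex_integral.

Section lebesgue_affine.
Context {R : realType}.
Local Notation mu := (@lebesgue_measure R).
Variables (s c : R) (s0 : s != 0).

Let phi (x : R) : R := s * x + c.

Let mphi : measurable_fun [set: measurableTypeR R]
  (phi : measurableTypeR R -> measurableTypeR R).
Proof. by apply: measurable_funD => //; exact: measurable_funM. Qed.

Local Open Scope ereal_scope.

Lemma lebesgue_measure_affine (A : set R) : measurable A ->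
  mu A = `|s|%:E * mu (phi @^-1` A).
Proof.
pose nu0 : {measure set (measurableTypeR R) -> \bar R} :=
  mscale (NngNum (normr_ge0 s))
    (pushforward mu (phi : measurableTypeR R -> measurableTypeR R)).
pose nu := nu0 mphi.
move=> mA; rewrite (@lebesgue_measure_unique _ nu)//.
move=> X [[a b] _ <-] /=.
rewrite /nu /mscale/= /pushforward.
have [sp|sn] := ltP 0%R s.
  have -> : phi @^-1` `]a, b]%classic = `]((a - c) / s)%R, ((b - c) / s)%R]%classic.
    apply/seteqP; split => x /=; rewrite !in_itv/= /phi.
      by rewrite ltr_pdivrMr// ler_pdivlMr// ltrBlDr lerBrDr mulrC.
    by rewrite ltr_pdivrMr// ler_pdivlMr// ltrBlDr lerBrDr mulrC.
  rewrite !lebesgue_measure_itv/= !lte_fin ltr_pM2r ?invr_gt0// ltrD2r.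
  case: ifPn => _; last by rewrite mule0.
  rewrite gtr0_norm// -!EFinB -EFinM; congr EFin.
  by field.
have {}sn : (s < 0)%R by rewrite lt_neqAle s0.
have -> : phi @^-1` `]a, b]%classic = `[((b - c) / s)%R, ((a - c) / s)%R[%classic.
  apply/seteqP; split => x /=; rewrite !in_itv/= /phi.
    by rewrite ltr_ndivlMr// ler_ndivrMr// ltrBlDr lerBrDr mulrC => /andP[-> ->].
  by rewrite ltr_ndivlMr// ler_ndivrMr// ltrBlDr lerBrDr mulrC => /andP[-> ->].
rewrite !lebesgue_measure_itv/= !lte_fin ltr_nM2r ?invr_lt0// ltrD2r.
case: ifPn => _; last by rewrite mule0.
rewrite ltr0_norm// -!EFinB -EFinM; congr EFin.
by field.
Qed.

Lemma ge0_integral_affine (D : set R) (f : R -> \bar R) :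
  measurable D -> measurable_fun D f -> {in D, forall y, 0 <= f y} ->
  \int[mu]_(y in D) f y = `|s|%:E * \int[mu]_(x in phi @^-1` D) f (phi x).
Proof.
pose nu0 : {measure set (measurableTypeR R) -> \bar R} :=
  mscale (NngNum (normr_ge0 s))
    (pushforward mu (phi : measurableTypeR R -> measurableTypeR R)).
pose nu := nu0 mphi.
move=> mD mf f0.
have h := @ge0_integral_pushforward _ _ _ _ _ _ mphi mu D f mD mf f0.
rewrite -[in RHS]h.
have -> : \int[mu]_(y in D) f y = \int[nu]_(y in D) f y.
  by apply: eq_measure_integral => A mA _; exact: lebesgue_measure_affine.
rewrite ge0_integral_mscale//.
by move=> x Dx; apply: f0; rewrite inE.
Qed.

Lemma integrable_affine (D : set R) (f : R -> R) : measurable D ->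
  measurable_fun D f ->
  mu.-integrable D (EFin \o f) <->
  mu.-integrable (phi @^-1` D) (EFin \o (fun x => f (phi x))).
Proof.
move=> mD mf.
have mphiD : measurable (phi @^-1` D).
  by rewrite -[X in measurable X]setTI; exact: mphi.
have mfphi : measurable_fun (phi @^-1` D) (fun x => f (phi x)).
  apply: (measurable_comp mD _ mf); first by move=> _ [x Dx <-].
  exact: measurable_funS mphi.
have h : \int[mu]_(y in D) `|(f y)%:E| =
    `|s|%:E * \int[mu]_(x in phi @^-1` D) `|(f (phi x))%:E|.
  apply: (@ge0_integral_affine D (fun y => `|(f y)%:E|)) => //.
  by apply: measurableT_comp => //; exact/measurable_EFinP.
split=> /integrableP[_ oo]; apply/integrableP; split; try exact/measurable_EFinP.
  move: oo; rewrite /= h /=.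
  have : 0 <= \int[mu]_(x in phi @^-1` D) `|(f (phi x))%:E|.
    by apply: integral_ge0 => x _; exact: abse_ge0.
  case: (\int[mu]_(x in phi @^-1` D) `|(f (phi x))%:E|) => [r| |]//= _.
    by move=> _; rewrite ltry.
  by rewrite gt0_muley ?lte_fin ?normr_gt0.
rewrite /= h /=; move: oo => /=.
have : 0 <= \int[mu]_(x in phi @^-1` D) `|(f (phi x))%:E|.
  by apply: integral_ge0 => x _; exact: abse_ge0.
case: (\int[mu]_(x in phi @^-1` D) `|(f (phi x))%:E|) => [r| |]//= _.
by move=> _; rewrite -EFinM ltry.
Qed.

Lemma Rintegral_affine (D : set R) (f : R -> R) : measurable D ->
  mu.-integrable D (EFin \o f) ->
  (\int[mu]_(y in D) f y = `|s| * \int[mu]_(x in phi @^-1` D) f (phi x))%R.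
Proof.
move=> mD fi; have /integrableP[/measurable_EFinP mf _] := fi.
have fi' := (integrable_affine mD mf).1 fi.
have mphiD : measurable (phi @^-1` D).
  by rewrite -[X in measurable X]setTI; exact: mphi.
pose r := (`|s|%R : R); rewrite -/r.
rewrite /Rintegral -[r in RHS]/(fine r%:E) -fineM//; last exact: integrable_fin_num.
congr fine.
rewrite integralE [in RHS]integralE muleBr//; last first.
  rewrite fin_num_adde_defl//.
  by rewrite fin_numN; exact: integrable_neg_fin_num fi'.
have mfE : measurable_fun D (EFin \o f) by exact/measurable_EFinP.
have hp := @ge0_integral_affine D _ mD (measurable_funepos mfE)
  (fun y _ => funepos_ge0 _ y).
have hn := @ge0_integral_affine D _ mD (measurable_funeneg mfE)
  (fun y _ => funeneg_ge0 _ y).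
congr (_ - _).
  transitivity (\int[mu]_(y in D) (EFin \o f)^\+ y) => //.
  by rewrite hp; congr (_ * _); apply: eq_integral => x _; rewrite !funeposE.
transitivity (\int[mu]_(y in D) (EFin \o f)^\- y) => //.
by rewrite hn; congr (_ * _); apply: eq_integral => x _; rewrite !funenegE.
Qed.

(** The one change of variables that is needed: it scales the confluent integrals
    and moves the two pieces of the weight to a fixed domain. *)
Lemma cintegral_affine (D : set R) (F : R -> R[i]) : measurable D ->
  cintble mu D F ->
  (cintegral mu D F = `|s|%:C%C * cintegral mu (phi @^-1` D) (fun x => F (phi x)))%R.
Proof.
move=> mD /cintbleP[h1 h2].
by apply: complex_eqP; rewrite ?(Re_mul, Im_mul)/= mul0r ?(subr0, addr0)
  Rintegral_affine.
Qed.

Lemma cintble_affine (D : set (measurableTypeR R)) (F : R -> R[i]) : measurable D ->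
  cmeas D F ->
  cintble mu D F <-> cintble mu (phi @^-1` D) (fun x => F (phi x)).
Proof.
move=> mD /cmeasP[h1 h2]; split=> /cintbleP[i1 i2]; apply/cintbleP; split.
- exact/(integrable_affine mD h1).
- exact/(integrable_affine mD h2).
- exact/(integrable_affine mD h1).
- exact/(integrable_affine mD h2).
Qed.

End lebesgue_affine.

Opaque cintegral cpow cexp mulc addc oppc invc.

(** * Powers against the exponential on the half-line *)

Section real_integrability.
Context {R : realType}.
Local Notation mu := (@lebesgue_measure R).
Implicit Types (p q r s t u : R).

Lemma integrable_cup (A B : set R) (f : R -> R) :
  measurable A -> measurable B ->
  mu.-integrable A (EFin \o f) -> mu.-integrable B (EFin \o f) ->
  mu.-integrable (A `|` B) (EFin \o f).
Proof.
move=> mA mB /integrableP[mfA fA] /integrableP[mfB fB].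
apply/integrableP; split; first by apply/measurable_funU.
apply: le_lt_trans (_ : _ <= _ + _)%E _; last exact: lte_add_pinfty fA fB.
have mfB' : measurable_fun (B `\` A) (EFin \o f).
  by apply: measurable_funS mfB => //; exact: subDsetl.
have -> : A `|` B = A `|` (B `\` A).
  apply/seteqP; split => x [Ax|Bx]; [by left| |by left|by case: Bx; right].
  by have [Ax|nAx] := pselect (A x); [left|right].
rewrite ge0_integral_setU//=; last 3 first.
- exact: measurableD.
- have mBA : measurable (B `\` A) by exact: measurableD.
  have mU : measurable_fun (A `|` B `\` A) (EFin \o f) by exact/measurable_funU.
  by apply/measurable_EFinP; apply: measurableT_comp => //; exact/measurable_EFinP.
- by apply/disj_setPS => x [Ax [_ +]].
rewrite leeD2l//; apply: ge0_subset_integral => //=.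
- exact: measurableD.
  by apply/measurable_EFinP; apply: measurableT_comp => //; exact/measurable_EFinP.
Qed.

Lemma is_derive_powR p t : 0 < t ->
  is_derive t 1 (fun x => x `^ p) (p * t `^ (p - 1)).
Proof.
move=> t0; have tt : t \in `]0, +oo[ by rewrite in_itv/= t0.
split; first exact: derivable_powR.
by rewrite -derive1E powR_derive1.
Qed.

Lemma integrable_powR01 p : -1 < p -> mu.-integrable `]0, 1] (fun t => (t `^ p)%:E).
Proof.
move=> p1; have p10 : 0 < p + 1 by rewrite -ltrBlDr sub0r.
have mp A : measurable_fun A (fun t => (t `^ p)%:E).
  by apply/measurable_EFinP/measurable_funTS; exact: measurable_powR.
apply/integrableP; split; first exact: mp.
under eq_integral do rewrite gee0_abs ?lee_fin ?powR_ge0//.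
(* The primitive is used on segments away from the singular end. *)
pose F k : set (measurableTypeR R) := `[k.+2%:R^-1 : R, 1]%classic.
have FE : `]0, 1]%classic = \bigcup_k F k.
  apply/seteqP; split => t /=; rewrite in_itv/=.
    move=> /andP[t0 t1]; exists (Num.truncn t^-1) => //=.
    rewrite /F /= in_itv/= t1 andbT -[leRHS]invrK lef_pV2 ?posrE ?invr_gt0//.
    rewrite (le_trans (ltW (truncnS_gt _)))// ler_nat//.
  move=> [k _]; rewrite /F/= in_itv/= => /andP[kt ->]; rewrite andbT.
  by rewrite (lt_le_trans _ kt)// invr_gt0.
have ndF : nondecreasing_seq F.
  apply/nondecreasing_seqP => n; apply/subsetPset => t; rewrite /F/= !in_itv/=.
  move=> /andP[h ->]; rewrite andbT (le_trans _ h)// lef_pV2 ?posrE//.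
  by rewrite ler_nat.
have cv := @ge0_nondecreasing_set_cvg_integral _ _ _ F
  (fun t : measurableTypeR R => ((t : R) `^ p)%:E) mu
  ndF (fun i => measurable_itv _) (fun i => mp _)
  (fun i x _ => powR_ge0 _ _).
rewrite FE -(cvg_lim _ cv)//.
apply: le_lt_trans (ltry ((p + 1)^-1)).
apply: lime_le; first by apply/cvg_ex; eexists; exact: cv.
apply: nearW => k.
have k1 : k.+2%:R^-1 < 1 :> R by rewrite invf_lt1 ?ltr1n// ltr0n.
have k0 : 0 < k.+2%:R^-1 :> R by rewrite invr_gt0.
have dF t : 0 < t ->
    is_derive t 1 (fun x => (p + 1)^-1 * x `^ (p + 1)) (t `^ p).
  move=> t0; have := is_deriveZ (p + 1)^-1 (is_derive_powR (p + 1) t0).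
  move=> h; apply: (is_derive_eq h); rewrite addrK /GRing.scale/= mulrA.
  by rewrite mulVf ?gt_eqF// mul1r.
rewrite (@continuous_FTC2 _ _ (fun x => (p + 1)^-1 * x `^ (p + 1)))//=.
- rewrite -EFinB lee_fin powR1 mulr1 lerBlDr lerDl mulr_ge0 ?powR_ge0//.
  by rewrite invr_ge0 ltW.
- apply: derivable_within_continuous => x; rewrite in_itv/= => /andP[kx _].
  apply: derivable_powR; rewrite in_itv/= andbT.
  exact: lt_le_trans kx.
- have c x : 0 < x -> {for x, continuous (fun x => (p + 1)^-1 * x `^ (p + 1))}.
    move=> x0; have [h _] := dF _ x0.
    by apply: differentiable_continuous; exact/derivable1_diffP.
  split => /=.
  + move=> x; rewrite in_itv/= => /andP[kx _].
    by have [] := dF x (lt_trans k0 kx).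
  + by apply: cvg_at_right_filter; exact: c.
  + by apply: cvg_at_left_filter; exact: c.
- move=> x; rewrite in_itv/= => /andP[kx _].
  by have [_ <-] := dF x (lt_trans k0 kx); rewrite derive1E.
Qed.

Lemma integrable_powR1y p : p < -1 -> mu.-integrable `[1, +oo[ (EFin \o (fun t => t `^ p)).
Proof.
move=> p1; have p10 : p + 1 < 0 by lra.
have mp A : measurable_fun A (EFin \o (fun t => t `^ p)).
  by apply/measurable_EFinP/measurable_funTS; exact: measurable_powR.
apply/integrableP; split; first exact: mp.
under eq_integral do rewrite /= ger0_norm ?powR_ge0//.
pose F (x : R) := (p + 1)^-1 * x `^ (p + 1).
have dF t : 0 < t -> is_derive t 1 F (t `^ p).
  move=> t0; have := is_deriveZ (p + 1)^-1 (is_derive_powR (p + 1) t0).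
  move=> h; apply: (is_derive_eq h); rewrite addrK /GRing.scale/= mulrA.
  by rewrite mulVf ?lt_eqF// mul1r.
have cF t : 0 < t -> {for t, continuous F}.
  move=> t0; have [h _] := dF _ t0.
  by apply: differentiable_continuous; exact/derivable1_diffP.
rewrite (@ge0_continuous_FTC2y _ _ F 1 0)//.
- by rewrite -EFinB ltry.
- by move=> *; exact: powR_ge0.
- apply: derivable_within_continuous => x; rewrite in_itv/= andbT => x1.
  by apply: derivable_powR; rewrite in_itv/= andbT; lra.
- rewrite /F -(mulr0 (p + 1)^-1); apply: cvgM; first exact: cvg_cst.
  apply/cvgrPdist_le => e e0.
  exists (e `^ (p + 1)^-1 + 1); split; first by rewrite num_real.
  move=> x xe; have x0 : 0 < x by rewrite (lt_trans _ xe)// ltr_wpDl ?powR_ge0.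
  rewrite sub0r normrN ger0_norm ?powR_ge0//.
  have -> : e = (e `^ (p + 1)^-1) `^ (p + 1).
    by rewrite -powRrM mulVf ?lt_eqF// powRr1// ltW.
  have q0 : 0 <= - (p + 1) by lra.
  rewrite -[p + 1]opprK (powRN x) (powRN _ (- (p + 1))) opprK.
  rewrite lef_pV2 ?posrE ?powR_gt0//; apply: ge0_ler_powR => //.
  - by rewrite nnegrE powR_ge0.
  - by rewrite nnegrE ltW.
  - by rewrite ltW// (lt_trans _ xe)// ltrDl.
- by move=> x x1; have [] := dF x (lt_trans ltr01 x1).
- by apply: cvg_at_right_filter; exact: cF.
- move=> x; rewrite in_itv/= andbT => x1; rewrite derive1E.
  by have [_ ->] := dF x (lt_trans ltr01 x1).
Qed.

Lemma integral_expR r : 0 < r ->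
  (\int[mu]_(t in `[(0 : R)%R, +oo[) (expR (- (r * t)))%:E = (r^-1)%:E)%E.
Proof.
move=> r0.
pose F (x : R) := - r^-1 * expR (- (r * x)).
have dF (t : R) : is_derive t 1 F (expR (- (r * t))).
  have lin : is_derive t (1 : R) (fun x : R => - (r * x) : R) (- r : R).
    have h := is_deriveN (is_deriveZ r (is_derive_id t (1 : R))).
    by apply: (is_derive_eq h); rewrite /GRing.scale/= mulr1.
  have h := is_deriveZ (- r^-1) (@is_derive1_comp _ expR (fun x : R => - (r * x)) t _ _ (is_derive_expR (- (r * t))) lin).
  apply: (is_derive_eq h); rewrite /GRing.scale/=.
  by field; rewrite gt_eqF.
have cF : continuous F.
  move=> x; apply: differentiable_continuous; apply/derivable1_diffP.
  by have [] := dF x.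
have ce : continuous (fun t : R => expR (- (r * t))).
  move=> x; apply: continuous_comp; last exact: continuous_expR.
  apply: continuousN; apply: continuousM; first exact: cst_continuous.
  exact: cvg_id.
rewrite (@ge0_continuous_FTC2y _ _ F 0 0)//.
- by rewrite /F mulr0 oppr0 expR0 mulr1 -EFinB sub0r opprK.
- exact: continuous_subspaceT.
- rewrite /F -(mulr0 (- r^-1)); apply: cvgM; first exact: cvg_cst.
  have h : r * x @[x --> +oo%R] --> +oo%R.
    apply/cvgryPge => A; exists (A / r); split; first by rewrite num_real.
    by move=> x Ax; rewrite mulrC -ler_pdivrMr// ltW.
  exact: (cvg_comp _ _ h (@cvgr_expR R)).
- by apply: cvg_at_right_filter; exact: cF.
- by move=> x _; rewrite derive1E; have [_ ->] := dF x.
Qed.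

Lemma integrable_expR r : 0 < r ->
  mu.-integrable `]0, +oo[ (EFin \o (fun t => expR (- (r * t)))).
Proof.
move=> r0; have m A : measurable_fun A (fun t : R => (expR (- (r * t)))%:E).
  apply/measurable_EFinP/measurable_funTS; apply: measurableT_comp => //.
  exact: measurableT_comp.
have h : mu.-integrable `[(0 : R), +oo[ (fun t : measurableTypeR R => (expR (- (r * t)))%:E).
  apply/integrableP; split; first exact: m.
  under eq_integral do rewrite gee0_abs ?lee_fin ?expR_ge0//.
  by rewrite integral_expR// ltry.
apply: integrableS h => //.
by move=> t /=; rewrite !in_itv/= !andbT; exact: ltW.
Qed.

Lemma powR_le_expR p r : 0 < r ->
  exists2 C, 0 < C & forall t, 1 <= t -> t `^ p <= C * expR (r * t).
Proof.
move=> r0; pose n := (Num.truncn `|p|).+1.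
exists (n`!%:R / r ^+ n).
  by rewrite divr_gt0 ?ltr0n ?fact_gt0 ?exprn_gt0.
move=> t t1; have t0 : 0 < t by exact: lt_le_trans t1.
have : t `^ p <= t ^+ n.
  rewrite -powR_mulrn ?(ltW t0)//; apply: ler_powR => //.
  by rewrite (le_trans (ler_norm _))// ltW// truncnS_gt.
move/le_trans; apply.
rewrite mulrAC ler_pdivlMr ?exprn_gt0// -exprMn [X in X ^+ _]mulrC.
have h := @expR_ge1Dxn R (r * t) n.-1 (ltW (mulr_gt0 r0 t0)).
have : (r * t) ^+ n / n`!%:R <= expR (r * t) by rewrite (le_trans _ h)// lerDr.
by rewrite ler_pdivrMr ?ltr0n ?fact_gt0// [X in _ -> _ <= X]mulrC.
Qed.

Lemma measurable_powR_expR A p r : measurable_fun A (fun t => t `^ p * expR (- (r * t))).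
Proof.
apply: measurable_funTS; apply: measurable_funM; first exact: measurable_powR.
apply: measurableT_comp => //; exact: measurableT_comp.
Qed.

(** Near [0] the power alone decides; beyond [1] half of the exponential absorbs
    the power. *)
Lemma integrable_powR_expR p r : -1 < p -> 0 < r ->
  mu.-integrable `]0, +oo[ (EFin \o (fun t => t `^ p * expR (- (r * t)))).
Proof.
move=> p1 r0.
have -> : `]0, +oo[%classic = `]0, 1]%classic `|` `[1, +oo[%classic :> set R.
  apply/seteqP; split => t /=; rewrite !in_itv/= !andbT.
    by move=> t0; rewrite t0/=; apply/orP; exact: le_total.
  by move=> [/andP[]//|]; apply: lt_le_trans.
apply: integrable_cup => //.
  apply: le_integrable (integrable_powR01 p1) => //.
    by apply/measurable_EFinP; exact: measurable_powR_expR.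
  move=> t /=; rewrite in_itv/= => /andP[t0 _].
  rewrite lee_fin !ger0_norm ?mulr_ge0 ?powR_ge0 ?expR_ge0//.
  rewrite ler_piMr ?powR_ge0// expR_le1 oppr_le0 mulr_ge0// ltW//.
have r20 : 0 < r / 2 by rewrite divr_gt0.
have [C C0 hC] := powR_le_expR p r20.
have : mu.-integrable `](0 : R), +oo[ (EFin \o (fun t => C * expR (- (r / 2 * t)))).
  by apply: (integrableZl _ C (integrable_expR r20)).
move=> h; have : mu.-integrable `[(1 : R), +oo[ (EFin \o (fun t => C * expR (- (r / 2 * t)))).
  apply: integrableS h => // t /=; rewrite !in_itv/= !andbT.
  exact: lt_le_trans.
apply: le_integrable => //.
- by apply/measurable_EFinP; exact: measurable_powR_expR.
- move=> t /=; rewrite in_itv/= andbT => t1.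
  rewrite lee_fin !ger0_norm ?mulr_ge0 ?powR_ge0 ?expR_ge0 ?(ltW C0)//.
  rewrite (le_trans (ler_wpM2r (expR_ge0 _) (hC _ t1)))//.
  have -> // : forall y : R, C * expR (r / 2 * y) * expR (- (r * y)) =
      C * expR (- (r / 2 * y)).
  by move=> y; rewrite -mulrA -expRD; congr (_ * expR _); field.
Qed.

Lemma powRD_le p u s : 0 < u -> 0 < s ->
  (u + s) `^ p <= 2 `^ `|p| * (u `^ p + s `^ p).
Proof.
move=> u0 s0; wlog us : u s u0 s0 / u <= s.
  move=> h; have [us|su] := leP u s; first exact: h.
  by rewrite addrC [X in _ * X]addrC; apply: h => //; exact: ltW.
have us0 : 0 < u + s by exact: addr_gt0.
have [p0|p0] := leP 0 p.
  rewrite ger0_norm// (@le_trans _ _ ((2 * s) `^ p))//.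
    by apply: ge0_ler_powR => //; rewrite ?nnegrE; lra.
  rewrite powRM ?(ltW s0)// ler_wpM2l ?powR_ge0// lerDr powR_ge0//.
have h : (u + s) `^ p <= s `^ p.
  have [q q0 ->] : exists2 q, 0 <= q & p = - q.
    by exists (- p); [rewrite oppr_ge0 ltW|rewrite opprK].
  rewrite !powRN lef_pV2 ?posrE ?powR_gt0//.
  by apply: ge0_ler_powR => //; rewrite ?nnegrE; lra.
rewrite (le_trans h)// -[leLHS]mul1r ler_pM ?powR_ge0// ?lerDr ?powR_ge0//.
by rewrite -[leLHS](powRr0 2); apply: ler_powR => //; lra.
Qed.

End real_integrability.

(** * The confluent integrals and the Gamma function *)

Section kummer_integral.
Context {R : realType}.
Local Notation mu := (@lebesgue_measure R).
Implicit Types (m b z : R[i]) (s r u p : R).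

Definition kfun m b s r u : R[i] :=
  cpow u m * cpow (u + s) b * (expR (- (r * u)))%:C.

(** Tricomi's confluent hypergeometric function:
    [kint m b 1 r = Gamma (m + 1) * U (m + 1, m + b + 2, r)].  Shift and rate are
    kept as separate arguments because the derivatives in the two of them are
    compared in [kint_contiguous]. *)
Definition kint m b s r : R[i] := cintegral mu `]0, +oo[ (kfun m b s r).

Lemma kintE m b s r : kint m b s r = cintegral mu `]0, +oo[
  (fun u => cpow u m * cpow (u + s) b * (expR (- (r * u)))%:C).
Proof. by []. Qed.

Lemma kint_def m b s r : kint m b s r = cintegral mu `]0, +oo[ (kfun m b s r).
Proof. by []. Qed.

Opaque kint.

Lemma normc_kfun m b s r u : 0 < u -> 0 < s ->
  normc (kfun m b s r u) =
  u `^ (Re m) * (u + s) `^ (Re b) * expR (- (r * u)).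
Proof.
move=> u0 s0; rewrite !normcM normc_real ger0_norm ?expR_ge0//.
by rewrite !normc_cpow// addr_gt0.
Qed.

Lemma measurable_expRM (D : set R) r :
  measurable_fun D (fun u => expR (- (r * u))).
Proof.
apply: measurable_funTS; apply: measurableT_comp => //; exact: measurableT_comp.
Qed.

Lemma cmeas_kfun (D : set (measurableTypeR R)) m b s r : cmeas D (kfun m b s r).
Proof.
apply: cmeasM; last by apply: cmeas_real; exact: measurable_expRM.
apply: cmeasM; apply: cmeas_cpow => //.
by apply: measurable_funTS; apply: measurable_funD.
Qed.

Lemma powR_shift_le p s1 s2 : 0 < s1 -> s1 <= s2 ->
  exists2 C, 0 <= C & forall s u, s1 <= s <= s2 -> 0 < u ->
    (u + s) `^ p <= C * (1 + u `^ (Num.max p 0)).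
Proof.
move=> s10 s12; have s20 : 0 < s2 by exact: lt_le_trans s12.
have [p0|p0] := leP p 0.
  exists (s1 `^ p); first exact: powR_ge0.
  move=> s u /andP[ss1 ss2] u0; have s0 : 0 < s by exact: lt_le_trans ss1.
  rewrite powRr0 (@le_trans _ _ (s1 `^ p))//.
    have [q q0 ->] : exists2 q, 0 <= q & p = - q.
      by exists (- p); [rewrite oppr_ge0|rewrite opprK].
    rewrite !powRN lef_pV2 ?posrE ?powR_gt0 ?addr_gt0//.
    by apply: ge0_ler_powR => //; rewrite ?nnegrE; lra.
  by rewrite ler_peMr ?powR_ge0//; lra.
exists (2 `^ `|p| * (1 + s2 `^ p)).
  by rewrite mulr_ge0 ?powR_ge0// addr_ge0 ?powR_ge0.
move=> s u /andP[ss1 ss2] u0; have s0 : 0 < s by exact: lt_le_trans ss1.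
rewrite (le_trans (powRD_le p u0 s0))// -mulrA ler_wpM2l ?powR_ge0//.
have h1 : s `^ p <= s2 `^ p.
  by apply: ge0_ler_powR => //; rewrite ?nnegrE; lra.
have h2 := powR_ge0 u p; have h3 := powR_ge0 s2 p.
rewrite mulrDl mulrDr mulr1 mul1r; nra.
Qed.

(** A single integrable bound serves all shifts in a segment of positive numbers
    and all rates bounded below, so that derivatives in either argument pass
    under the integral sign. *)
Lemma kfun_dominated (q p s1 s2 r : R) : -1 < q -> 0 < s1 -> s1 <= s2 -> 0 < r ->
  exists2 g : R -> R, mu.-integrable `]0, +oo[ (EFin \o g) &
  forall s u (r' : R), s1 <= s <= s2 -> r <= r' -> 0 < u ->
    u `^ q * (u + s) `^ p * expR (- (r' * u)) <= g u.
Proof.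
move=> q1 s10 s12 r0; have [C C0 hC] := powR_shift_le p s10 s12.
pose M := Num.max p 0; have M0 : 0 <= M by rewrite le_max lexx orbT.
exists (fun u => C * (u `^ q * expR (- (r * u)) + u `^ (q + M) * expR (- (r * u)))).
  have i1 := integrable_powR_expR q1 r0.
  have q2 : -1 < q + M by lra.
  have i2 := integrable_powR_expR q2 r0.
  by apply: (integrableZl _ C (integrableD _ i1 i2)).
move=> s u r' ss rr u0.
have -> : u `^ (q + M) = u `^ q * u `^ M by rewrite powRDr.
have -> : C * (u `^ q * expR (- (r * u)) + u `^ q * u `^ M * expR (- (r * u))) =
    u `^ q * (C * (1 + u `^ M)) * expR (- (r * u)) by ring.
rewrite ler_pM ?mulr_ge0 ?powR_ge0 ?expR_ge0//.
  by rewrite ler_wpM2l ?powR_ge0// hC.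
by rewrite ler_expR lerN2 ler_wpM2r// ltW.
Qed.

Lemma measurable_itvR (i : interval R) :
  measurable ([set` i] : set (measurableTypeR R)).
Proof. exact: measurable_itv. Qed.

Lemma measurable_itv0y : measurable (`]0, +oo[%classic : set (measurableTypeR R)).
Proof. exact: measurable_itv. Qed.

Lemma itv0yE u : (`]0, +oo[%classic : set R) u = (0 < u) :> Prop.
Proof. by rewrite /= in_itv/= andbT. Qed.

Lemma cintble_kfun m b s r : -1 < Re m -> 0 < s -> 0 < r ->
  cintble mu `]0, +oo[ (kfun m b s r).
Proof.
move=> m1 s0 r0; have [g ig hg] := @kfun_dominated (Re m) (Re b) s s r m1 s0 (lexx s) r0.
apply: (cintble_le _ _ _ ig) => //; first exact: cmeas_kfun.
move=> u; rewrite itv0yE => u0; rewrite normc_kfun//; apply: hg => //.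
by rewrite lexx.
Qed.

Lemma cder_kint_shift m b s r : -1 < Re m -> 0 < s -> 0 < r ->
  cder (fun x => kint m b x r) s (b * kint m (b - 1) s r).
Proof.
move=> m1 s0 r0.
have s20 : 0 < s / 2 by rewrite divr_gt0.
have s12 : s / 2 <= 2 * s by lra.
have [g ig hg] := @kfun_dominated (Re m) (Re (b - 1)) (s / 2) (2 * s) r m1 s20 s12 r0.
rewrite !kintE -cintegralZ; [|by []|]; last exact: cintble_kfun.
apply: (@cder_under_integral _ _ _ mu `]0, +oo[ (fun x => kfun m b x r)
  (fun x u => b * kfun m (b - 1) x r u) s (s / 2) (2 * s)
  (fun u => normc b * g u)) => //.
- by apply/andP; split; lra.
- by move=> x /andP[x1 x2]; apply: cintble_kfun => //; lra.
- move=> x u /andP[x1 x2]; rewrite itv0yE => u0.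
  have ux : 0 < u + x by lra.
  rewrite /kfun; apply: cder_eq.
    apply: cderM; last exact: cder_cst.
    by apply: cderM; [exact: cder_cst|exact: cder_cpow_shift].
  rewrite mul0r mulr0 add0r addr0; ring.
- by apply: (integrableZl _ (normc b) ig).
- move=> x u /andP[x1 x2]; rewrite itv0yE => u0.
  rewrite normcM ler_wpM2l ?normc_ge0// normc_kfun//; last lra.
  by apply: hg => //; apply/andP; split; lra.
Qed.

Lemma cder_kint_rate m b s r : -1 < Re m -> 0 < s -> 0 < r ->
  cder (fun x => kint m b s x) r (- kint (m + 1) b s r).
Proof.
move=> m1 s0 r0.
have r20 : 0 < r / 2 by rewrite divr_gt0.
have m2 : -1 < Re (m + 1) by rewrite Re_add/=; lra.
have [g ig hg] := @kfun_dominated (Re (m + 1)) (Re b) s s (r / 2) m2 s0 (lexx _) r20.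
rewrite !kintE -mulN1r -cintegralZ; [|by []|]; last exact: cintble_kfun.
apply: (@cder_under_integral _ _ _ mu `]0, +oo[ (fun x => kfun m b s x)
  (fun x u => -1 * kfun (m + 1) b s x u) r (r / 2) (2 * r) g) => //.
- by apply/andP; split; lra.
- by move=> x /andP[x1 x2]; apply: cintble_kfun => //; lra.
- move=> x u /andP[x1 x2]; rewrite itv0yE => u0.
  have lin : is_derive x (1 : R) (fun y : R => - (y * u) : R) (- u : R).
    have h := is_deriveN (is_deriveM (is_derive_id x (1 : R)) (is_derive_cst u x (1 : R))).
    by apply: (is_derive_eq h); rewrite /GRing.scale/= mulr0 mulr1 add0r.
  have h := cder_real (@is_derive1_comp _ expR (fun y : R => - (y * u)) x _ _
    (is_derive_expR (- (x * u))) lin).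
  rewrite /kfun; apply: cder_eq.
    by apply: cderM; [exact: cder_cst|exact: h].
  rewrite mul0r addr0 cpowS// mulrN rmorphN rmorphM/=; ring.
- move=> x u /andP[x1 x2]; rewrite itv0yE => u0.
  rewrite normcM normcN normc1 mul1r normc_kfun//.
  by apply: hg => //; lra.
Qed.

Lemma preimage_scale_itv0y s : 0 < s ->
  (fun x => s * x + 0) @^-1` `]0, +oo[%classic = `]0, +oo[%classic :> set R.
Proof.
move=> s0; apply/seteqP; split => x /=; rewrite !in_itv/= !andbT addr0.
  by rewrite pmulr_rgt0.
by move=> x0; rewrite mulr_gt0.
Qed.

Lemma kint_scale m b s r : -1 < Re m -> 0 < s -> 0 < r ->
  kint m b s r = cpow s (m + b + 1) * kint m b 1 (s * r).
Proof.
move=> m1 s0 r0; have sn0 : s != 0 by rewrite gt_eqF.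
rewrite !kintE (@cintegral_affine _ s 0); [|by []|by []|exact: cintble_kfun].
rewrite (gtr0_norm s0) (preimage_scale_itv0y s0) (cpowS _ s0) -mulrA; congr (_ * _).
rewrite -cintegralZ; [|by []|]; last by apply: cintble_kfun => //; rewrite mulr_gt0.
apply: cintegral_eq => u; rewrite itv0yE => u0; rewrite addr0 /kfun.
rewrite -[X in s * u + X]mulr1 -mulrDr !cpowM ?addr_gt0// cpowD.
have -> : r * (s * u) = s * r * u by ring.
ring.
Qed.

(** The derivative in [s] of [kint m b s 1 = s ^ (m + b + 1) * kint m b 1 s]
    can be taken on either side; equating the two results is the contiguous
    relation that integration by parts would give. *)
Lemma kint_contiguous m b s : -1 < Re m -> 0 < s ->
  b * s%:C * kint m (b - 1) s 1 = (m + b + 1) * kint m b s 1 - kint (m + 1) b s 1.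
Proof.
move=> m1 s0; have m2 : -1 < Re (m + 1) by rewrite Re_add/=; lra.
have h1 := @cder_kint_shift m b s 1 m1 s0 ltr01.
have h2 : cder (fun x => kint m b x 1) s
    (cpow s (m + b + 1) * (- kint (m + 1) b 1 s) +
      (m + b + 1) * cpow s (m + b + 1 - 1) * kint m b 1 s).
  apply: (@cder_near_eq _ (fun x => cpow x (m + b + 1) * kint m b 1 x)).
    near=> x; have x0 : 0 < x by near: x; exact: lt_nbhsr.
    have := @kint_scale m b x 1 m1 x0 ltr01; rewrite mulr1 => ->.
    exact: erefl.
  by apply: cderM; [exact: cder_cpow|exact: cder_kint_rate].
have E := cder_unique h1 h2.
transitivity (s%:C * (b * kint m (b - 1) s 1)); first by ring.
rewrite E.
have K0 := @kint_scale m b s 1 m1 s0 ltr01.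
have K1 := @kint_scale (m + 1) b s 1 m2 s0 ltr01.
rewrite mulr1 in K0; rewrite mulr1 in K1; rewrite K0 K1.
rewrite (_ : m + 1 + b + 1 = m + b + 1 + 1); last ring.
rewrite (cpowS (m + b + 1) s0) addrK (cpowS (m + b) s0); ring.
Unshelve. all: by end_near. Qed.

Lemma cGammaE z s : cGamma z = kint (z - 1) 0 s 1.
Proof.
apply: cintegral_eq => u _; rewrite /kfun cpow0 mulr1 mul1r//.
Qed.

Lemma cGammaD1 z s : cGamma (z + 1) = kint z 0 s 1.
Proof. by rewrite (cGammaE (z + 1) s) addrK. Qed.

Opaque cGamma.

(** The contiguous relation at [b = 0], where its left side vanishes. *)
Lemma cGammaS z : 0 < Re z -> cGamma (z + 1) = z * cGamma z.
Proof.
move=> z0; have h : -1 < Re (z - 1) by rewrite Re_sub/=; lra.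
have := @kint_contiguous (z - 1) 0 1 h ltr01.
rewrite !mul0r !addr0 subrK => /esym/subr0_eq E.
rewrite (cGammaE (z + 1) 1) addrK -E -(cGammaE z 1).
exact: erefl.
Qed.

Lemma cGamma1 : cGamma (1 : R[i]) = 1.
Proof.
transitivity (cintegral mu `]0, +oo[ (fun t : R => (expR (- (1 * t)))%:C)).
  by apply: cintegral_eq => t _; rewrite subrr cpow0 !mul1r.
rewrite cintegral_real Rintegral_itv_obnd_cbnd; last exact: integrable_expR.
by rewrite /Rintegral integral_expR//= invr1.
Qed.

Lemma cGamma_nat n : cGamma (n.+1%:R : R[i]) = n`!%:R.
Proof.
elim: n => [|n IH]; first by rewrite cGamma1.
rewrite -natr1 cGammaS; last by rewrite Re_nat ltr0n.
by rewrite IH factS natrM.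
Qed.

End kummer_integral.


(** * Fubini and the two Beta integrals *)

Section complex_fubini.
Context d1 d2 (T1 : measurableType d1) (T2 : measurableType d2) (R : realType).
Variables (m1 : {sigma_finite_measure set T1 -> \bar R}).
Variables (m2 : {sigma_finite_measure set T2 -> \bar R}).

Lemma Rintegral_fubini (f : T1 -> T2 -> R) :
  (forall x, m2.-integrable setT (EFin \o f x)) ->
  (forall y, m1.-integrable setT (EFin \o f^~ y)) ->
  (m1 \x m2)%E.-integrable setT (fun z : T1 * T2 => (f z.1 z.2)%:E) ->
  \int[m1]_x (\int[m2]_y f x y) = \int[m2]_y (\int[m1]_x f x y).
Proof.
move=> if2 if1 ig.
have L x : (\int[m2]_y (f x y)%:E = (\int[m2]_y f x y)%:E)%E.
  by rewrite /Rintegral fineK//; exact: (integrable_fin_num _ (if2 x)).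
have L' y : (\int[m1]_x (f x y)%:E = (\int[m1]_x f x y)%:E)%E.
  by rewrite /Rintegral fineK//; exact: (integrable_fin_num _ (if1 y)).
have := Fubini ig; rewrite /=.
under eq_integral do rewrite L.
under [X in _ = X -> _]eq_integral do rewrite L'.
exact: (congr1 fine).
Qed.

Lemma cintble_product (F : T1 -> T2 -> R[i]) :
  cmeas setT (fun z : T1 * T2 => F z.1 z.2) ->
  (forall x, cintble m2 setT (F x)) ->
  m1.-integrable setT (EFin \o (fun x => \int[m2]_y normc (F x y))) ->
  cintble (m1 \x m2)%E setT (fun z : T1 * T2 => F z.1 z.2).
Proof.
move=> mF iF2 iN.
have mN : measurable_fun setT (fun z : T1 * T2 => (normc (F z.1 z.2))%:E).
  by apply/measurable_EFinP; exact: measurable_normc mF.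
apply: (@cintble_le _ _ _ _ _ _ (fun z : T1 * T2 => normc (F z.1 z.2))) => //.
apply/(integrable12ltyP _ _ mN).
have h x : (\int[m2]_y `|(normc (F x y))%:E| = `|(\int[m2]_y normc (F x y))%:E|)%E.
  rewrite [RHS]gee0_abs; last first.
    by rewrite lee_fin; apply: Rintegral_ge0 => y _; exact: normc_ge0.
  rewrite /Rintegral fineK.
    by apply: eq_integral => y _; rewrite gee0_abs// lee_fin normc_ge0.
  exact: (integrable_fin_num _ (cintble_normc measurableT (iF2 x))).
under eq_integral do rewrite /= h.
by case/integrableP: iN.
Qed.

Lemma cintegral_fubiniT (F : T1 -> T2 -> R[i]) :
  cmeas setT (fun z : T1 * T2 => F z.1 z.2) ->
  (forall x, cintble m2 setT (F x)) ->
  (forall y, cintble m1 setT (F^~ y)) ->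
  m1.-integrable setT (EFin \o (fun x => \int[m2]_y normc (F x y))) ->
  cintegral m1 setT (fun x => cintegral m2 setT (F x)) =
  cintegral m2 setT (fun y => cintegral m1 setT (F^~ y)).
Proof.
move=> mF iF2 iF1 iN.
have /cintbleP[i1 i2] := cintble_product mF iF2 iN.
Transparent cintegral.
rewrite /cintegral; apply: complex_eqP => /=.
  apply: (Rintegral_fubini (f := fun x y => Re (F x y))) => //.
    by move=> x; have /cintbleP[] := iF2 x.
  by move=> y; have /cintbleP[] := iF1 y.
apply: (Rintegral_fubini (f := fun x y => Im (F x y))) => //.
  by move=> x; have /cintbleP[] := iF2 x.
by move=> y; have /cintbleP[] := iF1 y.
Qed.
Opaque cintegral.

Lemma cintegral_fubini (D1 : set T1) (D2 : set T2) (F : T1 -> T2 -> R[i]) :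
  measurable D1 -> measurable D2 ->
  cmeas setT (fun z : T1 * T2 => F z.1 z.2) ->
  (forall x, D1 x -> cintble m2 D2 (F x)) ->
  (forall y, D2 y -> cintble m1 D1 (F^~ y)) ->
  m1.-integrable D1 (EFin \o (fun x => \int[m2]_(y in D2) normc (F x y))) ->
  cintegral m1 D1 (fun x => cintegral m2 D2 (F x)) =
  cintegral m2 D2 (fun y => cintegral m1 D1 (F^~ y)).
Proof.
move=> mD1 mD2 mF iF2 iF1 iN.
pose G x y := if (x \in D1) && (y \in D2) then F x y else 0.
have G2 x y : G x y = if x \in D1 then if y \in D2 then F x y else 0 else 0.
  by rewrite /G; case: (x \in D1).
have G1 x y : G x y = if y \in D2 then if x \in D1 then F x y else 0 else 0.
  by rewrite /G; case: (x \in D1); case: (y \in D2).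
have H1 : cintegral m1 D1 (fun x => cintegral m2 D2 (F x)) =
    cintegral m1 setT (fun x => cintegral m2 setT (G x)).
  rewrite cintegral_mkcond; apply: cintegral_eq => x _.
  case: ifPn => xD.
    by rewrite cintegral_mkcond; apply: cintegral_eq => y _; rewrite G2 xD.
  by rewrite -(cintegral_zero m2 setT); apply: cintegral_eq => y _; rewrite G2 (negbTE xD).
have H2 : cintegral m2 D2 (fun y => cintegral m1 D1 (F^~ y)) =
    cintegral m2 setT (fun y => cintegral m1 setT (G^~ y)).
  rewrite cintegral_mkcond; apply: cintegral_eq => y _.
  case: ifPn => yD.
    by rewrite cintegral_mkcond; apply: cintegral_eq => x _; rewrite G1 yD.
  by rewrite -(cintegral_zero m1 setT); apply: cintegral_eq => x _; rewrite G1 (negbTE yD).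
rewrite H1 H2; apply: cintegral_fubiniT.
- have mD : measurable (D1 `*` D2) by exact: measurableX.
  have GE (z : T1 * T2) : G z.1 z.2 = if z \in D1 `*` D2 then F z.1 z.2 else 0.
    rewrite /G; congr (if _ then _ else _).
    by rewrite in_setX.
  case/cmeasP: mF => mF1 mF2; apply/cmeasP; split.
    rewrite (_ : (fun _ => _) = (fun z : T1 * T2 => Re (F z.1 z.2)) \_ (D1 `*` D2)).
      by apply/(measurable_restrictT _ mD); apply: measurable_funTS.
    by apply/funext => z; rewrite GE patchE; case: ifP.
  rewrite (_ : (fun _ => _) = (fun z : T1 * T2 => Im (F z.1 z.2)) \_ (D1 `*` D2)).
    by apply/(measurable_restrictT _ mD); apply: measurable_funTS.
  by apply/funext => z; rewrite GE patchE; case: ifP.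
- move=> x; have [xD|xD] := boolP (x \in D1).
    have := (cintble_mkcond m2 (F x) mD2).1 (iF2 _ (set_mem xD)).
    by move=> h; apply: (cintble_eq _ h) => [y _|//]; rewrite G2 xD.
  by apply: (cintble_eq _ (cintble0 m2 measurableT)) => [y _|//]; rewrite G2 (negbTE xD).
- move=> y; have [yD|yD] := boolP (y \in D2).
    have := (cintble_mkcond m1 (F^~ y) mD1).1 (iF1 _ (set_mem yD)).
    by move=> h; apply: (cintble_eq _ h) => [x _|//]; rewrite G1 yD.
  by apply: (cintble_eq _ (cintble0 m1 measurableT)) => [x _|//]; rewrite G1 (negbTE yD).
- move/(integrable_mkcond _ mD1) : iN; apply: eq_integrable; [by []|move=> x _ /=].
  rewrite patchE; case: ifPn => xD /=; last first.
    by rewrite /Rintegral; under [in RHS]eq_integral do rewrite G2 (negbTE xD) normc0;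
      rewrite integral0.
  congr EFin; rewrite [LHS]Rintegral_mkcond; apply: eq_Rintegral => y _.
  by rewrite patchE G2 xD; case: ifP; rewrite ?normc0.
Qed.

End complex_fubini.

Section beta_integrals.
Context {R : realType}.
Local Notation mu := (@lebesgue_measure R).
Implicit Types (p q m b z : R[i]) (s t x y r u v : R).

Lemma kint_gamma m s : -1 < Re m -> 0 < s ->
  kint m 0 1 s = cpow s (- (m + 1)) * cGamma (m + 1).
Proof.
move=> m1 s0; have := @kint_scale R m 0 s 1 m1 s0 ltr01.
rewrite mulr1 addr0 (cGammaE (m + 1) s) addrK => ->.
by rewrite mulrA -cpowD addNr cpow0 mul1r.
Qed.

(** The integral of the modulus of a Gamma integrand with rate [x]; it supplies
    the majorants required for exchanging the order of integration. *)
Definition rgamma (q x : R) : R := \int[mu]_(u in `]0, +oo[) (u `^ q * expR (- (x * u))).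

Lemma kint_powR (q x : R) : kint q%:C 0 1 x = (rgamma q x)%:C.
Proof.
rewrite kintE -cintegral_real; apply: cintegral_eq => u; rewrite itv0yE => u0.
by rewrite cpow0 mulr1 rmorphM /= cpow_real.
Qed.

Lemma rgamma_scale (q x : R) : -1 < q -> 0 < x ->
  rgamma q x = x `^ (- (q + 1)) * rgamma q 1.
Proof.
move=> q1 x0; apply: (@complexI R).
rewrite rmorphM/= -!kint_powR !kint_gamma// cpow_1 mul1r -cpow_real//.
by rewrite rmorphN rmorphD.
Qed.

(** Without the exponential, convergence at infinity rests on
    [Re m + Re b < -1]. *)
Lemma cintble_kfun0 m b : -1 < Re m -> Re m + Re b < -1 ->
  cintble mu `]0, +oo[ (kfun m b 1 0).
Proof.
move=> m1 mb.
have b0 : Re b < 0 by lra.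
have le1 u : 0 < u -> (u + 1) `^ Re b <= 1.
  by move=> u0; rewrite -[leRHS](powRr0 (u + 1)); apply: ler_powR; lra.
have leu u : 0 < u -> (u + 1) `^ Re b <= u `^ Re b.
  move=> u0; have [q q0 ->] : exists2 q, 0 <= q & Re b = - q.
    by exists (- Re b); [rewrite oppr_ge0 ltW|rewrite opprK].
  rewrite !powRN lef_pV2 ?posrE ?powR_gt0//; last lra.
  by apply: ge0_ler_powR => //; rewrite ?nnegrE; lra.
have nE u : 0 < u -> normc (kfun m b 1 0 u) = u `^ Re m * (u + 1) `^ Re b.
  by move=> u0; rewrite normc_kfun// mul0r oppr0 expR0 mulr1.
pose g u := normc (kfun m b 1 0 u).
apply: (@cintble_le _ (measurableTypeR R) R mu _ _ g) => //; first exact: cmeas_kfun.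
have mg (A : set (measurableTypeR R)) : measurable_fun A (EFin \o g).
  by apply/measurable_EFinP/measurable_normc; exact: cmeas_kfun.
have -> : `]0, +oo[%classic = `]0, 1]%classic `|` `[1, +oo[%classic :> set R.
  apply/seteqP; split => t /=; rewrite !in_itv/= !andbT.
    by move=> t0; rewrite t0/=; apply/orP; exact: le_total.
  by move=> [/andP[]//|]; apply: lt_le_trans.
apply: integrable_cup => //.
  apply: (le_integrable _ (mg _) _ (integrable_powR01 m1)) => //.
  move=> t /=; rewrite in_itv/= => /andP[t0 _].
  rewrite lee_fin ger0_norm ?normc_ge0// ger0_norm ?powR_ge0// /g nE//.
  by rewrite ler_piMr ?powR_ge0// le1.
apply: (le_integrable _ (mg _) _ (integrable_powR1y mb)) => //.
move=> t /=; rewrite in_itv/= andbT => t1; have t0 : 0 < t by lra.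
rewrite lee_fin ger0_norm ?normc_ge0// ger0_norm ?powR_ge0// /g nE//.
by rewrite powRDr// ler_wpM2l ?powR_ge0// leu.
Qed.

(** The integral of [x^(p+q-1) v^(q-1) exp (- x (1 + v))] over the quadrant: in
    either order the inner integral is a Gamma integral with a rate. *)
Lemma beta_half_line p q : 0 < Re p -> 0 < Re q ->
  kint (q - 1) (- (p + q)) 1 0 * cGamma (p + q) = cGamma p * cGamma q.
Proof.
move=> p0 q0.
pose F (x v : R) : R[i] :=
  cpow x (p + q - 1) * cpow v (q - 1) * (expR (- (x * (1 + v))))%:C.
have q1 : -1 < Re (q - 1) by rewrite Re_sub/=; lra.
have pq1 : -1 < Re (p + q - 1) by rewrite Re_sub Re_add/=; lra.
have F2 x v : F x v = cpow x (p + q - 1) * (expR (- x))%:C * kfun (q - 1) 0 1 x v.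
  rewrite /F /kfun cpow0 mulrDr mulr1 opprD expRD rmorphM/=; ring.
have F1 v x : F x v = cpow v (q - 1) * kfun (p + q - 1) 0 1 (1 + v) x.
  rewrite /F /kfun cpow0 (mulrC (1 + v)); ring.
have L x : 0 < x -> cintegral mu `]0, +oo[ (F x) =
    cGamma q * kfun (p - 1) 0 1 1 x.
  move=> x0; under cintegral_eq do rewrite F2.
  rewrite cintegralZ; [|by []|exact: cintble_kfun].
  rewrite -kint_def kint_gamma// subrK /kfun cpow0 mul1r mulr1.
  have -> : p + q - 1 = p - 1 + q by ring.
  rewrite cpowD cpowN; have := cpow_neq0 x q.
  move: (cpow x q) (cpow x (p - 1)) => c c' c0; field.
  exact: c0.
have M v : 0 < v -> cintegral mu `]0, +oo[ (F^~ v) =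
    cGamma (p + q) * kfun (q - 1) (- (p + q)) 1 0 v.
  move=> v0; under cintegral_eq do rewrite F1.
  have v10 : 0 < 1 + v by lra.
  rewrite cintegralZ; [|by []|exact: cintble_kfun].
  rewrite -kint_def kint_gamma// subrK /kfun mul0r oppr0 expR0 mulr1 (addrC v).
  ring.
transitivity (cintegral mu `]0, +oo[ (fun v => cintegral mu `]0, +oo[ (F^~ v))).
  transitivity (cintegral mu `]0, +oo[
      (fun v => cGamma (p + q) * kfun (q - 1) (- (p + q)) 1 0 v)).
    rewrite cintegralZ; [|by []|].
      by rewrite -kint_def; exact: mulrC.
    by apply: cintble_kfun0 => //; rewrite Re_sub Re_opp Re_add/=; lra.
  by apply: cintegral_eq => v; rewrite itv0yE => v0; rewrite M.
rewrite -(@cintegral_fubini _ _ _ _ _ mu mu `]0, +oo[ `]0, +oo[ F); first last.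
- have gE x : 0 < x -> \int[mu]_(v in `]0, +oo[) normc (F x v) =
      rgamma (Re (q - 1)) 1 * (x `^ (Re p - 1) * expR (- (1 * x))).
    move=> x0; have xc := powR_ge0 x (Re (p + q - 1)).
    transitivity (x `^ Re (p + q - 1) * expR (- x) * rgamma (Re (q - 1)) x).
      rewrite /rgamma -RintegralZl; [|by []|exact: integrable_powR_expR].
      apply: eq_Rintegral => v; rewrite inE itv0yE => v0.
      rewrite F2 !normcM !normc_real !ger0_norm ?expR_ge0// normc_cpow//.
      by rewrite normc_cpow// cpow0 normc1 mulr1.
    rewrite rgamma_scale//.
    have -> : Re p - 1 = Re (p + q - 1) + - (Re (q - 1) + 1).
      by rewrite !Re_sub Re_add/=; ring.
    rewrite powRDr// mul1r; ring.
  have h : -1 < Re p - 1 by lra.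
  have : mu.-integrable `]0, +oo[ (EFin \o (fun x =>
      rgamma (Re (q - 1)) 1 * (x `^ (Re p - 1) * expR (- (1 * x))))).
    by apply: (integrableZl _ _ (integrable_powR_expR h ltr01)).
  apply: eq_integrable; first by [].
  by move=> x; rewrite inE itv0yE => x0 /=; rewrite gE.
- move=> v; rewrite itv0yE => v0.
  have v10 : 0 < 1 + v by lra.
  have h := cintbleZ (cpow v (q - 1)) (@measurable_itv0y R) (cintble_kfun 0 pq1 ltr01 v10).
  by apply: (cintble_eq _ h) => [x _|//]; rewrite F1.
- move=> x; rewrite itv0yE => x0.
  have h := cintbleZ (cpow x (p + q - 1) * (expR (- x))%:C) (@measurable_itv0y R)
    (cintble_kfun 0 q1 ltr01 x0).
  by apply: (cintble_eq _ h) => [v _|//]; rewrite F2.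
- apply: cmeasM.
    by apply: cmeasM; apply: cmeas_cpow; [exact: measurable_fst|exact: measurable_snd].
  apply: cmeas_real; apply: measurableT_comp => //; apply: measurableT_comp => //.
  apply: measurable_funM; first exact: measurable_fst.
  by apply: measurable_funD => //; exact: measurable_snd.
- by [].
- by [].
transitivity (cintegral mu `]0, +oo[ (fun x => cGamma q * kfun (p - 1) 0 1 1 x)).
  by apply: cintegral_eq => x; rewrite itv0yE => x0; rewrite L.
rewrite cintegralZ; [|by []|]; last by apply: cintble_kfun => //; rewrite Re_sub/=; lra.
by rewrite -kint_def -cGammaE mulrC.
Qed.

Definition gfun m b r t : R[i] :=
  cpow (1 - t) m * cpow t b * (expR (- (r * t)))%:C.

(** Kummer's function: [gint m b r = B (b + 1, m + 1) * M (b + 1, m + b + 2, -r)]. *)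
Definition gint m b r : R[i] := cintegral mu `]0, 1[ (gfun m b r).

Lemma gintE m b r : gint m b r = cintegral mu `]0, 1[
  (fun t => cpow (1 - t) m * cpow t b * (expR (- (r * t)))%:C).
Proof. by []. Qed.

Opaque gint.

Lemma measurable_itv01 : measurable (`]0, 1[%classic : set (measurableTypeR R)).
Proof. exact: measurable_itv. Qed.

Lemma itv01E t : (`]0, 1[%classic : set R) t = (0 < t < 1) :> Prop.
Proof. by rewrite /= in_itv/=. Qed.

Lemma cmeas_gfun (D : set (measurableTypeR R)) m b r : cmeas D (gfun m b r).
Proof.
apply: cmeasM; last by apply: cmeas_real; exact: measurable_expRM.
apply: cmeasM; apply: cmeas_cpow => //.
by apply: measurable_funTS; apply: measurable_funB.
Qed.

Lemma normc_gfun m b r t : 0 < t < 1 ->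
  normc (gfun m b r t) = (1 - t) `^ (Re m) * t `^ (Re b) * expR (- (r * t)).
Proof.
move=> /andP[t0 t1]; rewrite !normcM normc_real ger0_norm ?expR_ge0//.
by rewrite !normc_cpow// subr_gt0.
Qed.

Lemma powR_half_le (q x : R) : 2^-1 <= x <= 1 -> x `^ q <= 2 `^ `|q|.
Proof.
move=> /andP[x2 x1]; have x0 : 0 < x by rewrite (lt_le_trans _ x2)// invr_gt0.
have [q0|q0] := leP 0 q.
  apply: (@le_trans _ _ 1); last first.
    by rewrite -[leLHS](powRr0 2); apply: ler_powR => //; lra.
  by have -> : 1 = 1 `^ q :> R; [rewrite powR1|apply: ge0_ler_powR => //; rewrite ?nnegrE; lra].
have -> : q = - `|q| by rewrite ltr0_norm// opprK.
rewrite normrN normr_id powRN -powR_inv1 ?powR_ge0// -powRrM mulrC powRrM.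
apply: ge0_ler_powR => //; rewrite ?nnegrE ?powR_ge0//.
by rewrite powR_inv1 ?(ltW x0)// -[leRHS]invrK lef_pV2 ?posrE// invr_gt0.
Qed.

Lemma integrable_beta01 (q p : R) : -1 < q -> -1 < p ->
  mu.-integrable `]0, 1[ (EFin \o (fun t => (1 - t) `^ q * t `^ p)).
Proof.
move=> q1 p1.
have mf (A : set (measurableTypeR R)) (r : R) : measurable_fun A (fun t => (1 - t) `^ r).
  apply: measurable_funTS; apply: (@measurableT_comp _ _ _ _ _ _ (fun x : R => x `^ r)).
    exact: measurable_powR.
  exact: measurable_funB.
have i1 : mu.-integrable `]0, 1[ (EFin \o (fun t => t `^ p)).
  apply: integrableS (integrable_powR01 p1) => //.
  by move=> t /=; rewrite !in_itv/= => /andP[-> /ltW].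
have i2 : mu.-integrable `]0, 1[ (EFin \o (fun t => (1 - t) `^ q)).
  have n1 : -1 != 0 :> R by rewrite oppr_eq0 oner_eq0.
  have i3 : mu.-integrable `]0, 1[ (EFin \o (fun t => t `^ q)).
    apply: integrableS (integrable_powR01 q1) => //.
    by move=> t /=; rewrite !in_itv/= => /andP[-> /ltW].
  have := (@integrable_affine R (-1) 1 n1 `]0, 1[ (fun t => t `^ q)
    measurable_itv01 (measurable_funTS (measurable_powR _))).1 i3.
  have -> : (fun x : R => -1 * x + 1) @^-1` `]0, 1[ = `]0, 1[%classic :> set R.
    by apply/seteqP; split => t /=; rewrite !in_itv/= => /andP[? ?];
      apply/andP; split; lra.
  by apply: eq_integrable => // x _ /=; rewrite mulN1r addrC.
have := integrableD measurable_itv01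
  (integrableZl measurable_itv01 (2 `^ `|q|) i1)
  (integrableZl measurable_itv01 (2 `^ `|p|) i2).
apply: le_integrable; first by [].
  apply/measurable_EFinP; apply: measurable_funM; first exact: mf.
  by apply: measurable_funTS; exact: measurable_powR.
move=> t; rewrite itv01E => /andP[t0 t1] /=.
rewrite lee_fin.
have a0 := powR_ge0 (1 - t) q; have b0 := powR_ge0 t p.
have hA := @powR_half_le q (1 - t); have hB := @powR_half_le p t.
move: hA hB (powR_ge0 2 `|q|) (powR_ge0 2 `|p|).
move: (2 `^ `|q|) (2 `^ `|p|) => A B hA hB A0 B0.
rewrite !ger0_norm ?mulr_ge0 ?addr_ge0 ?mulr_ge0//.
have [t2|t2] := leP (t : R) 2^-1.
  have h : (1 - t) `^ q <= A by apply: hA; apply/andP; split; lra.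
  by rewrite ler_wpDr ?mulr_ge0// ler_wpM2r.
have h : t `^ p <= B by apply: hB; apply/andP; split; lra.
by rewrite ler_wpDl ?mulr_ge0// mulrC ler_wpM2r.
Qed.

Lemma cintble_gfun m b r : -1 < Re m -> -1 < Re b -> 0 <= r ->
  cintble mu `]0, 1[ (gfun m b r).
Proof.
move=> m1 b1 r0; apply: (cintble_le _ _ _ (integrable_beta01 m1 b1)) => //.
  exact: cmeas_gfun.
move=> t; rewrite itv01E => t01; rewrite normc_gfun//.
rewrite ler_piMr ?mulr_ge0 ?powR_ge0// expR_le1 oppr_le0 mulr_ge0//.
by case/andP: t01 => /ltW.
Qed.

Lemma cder_gint m b r : -1 < Re m -> -1 < Re b -> 0 < r ->
  cder (fun x => gint m b x) r (- gint m (b + 1) r).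
Proof.
move=> m1 b1 r0; have b2 : -1 < Re (b + 1) by rewrite Re_add/=; lra.
rewrite !gintE -mulN1r -cintegralZ; [|by []|]; last first.
  by apply: cintble_gfun => //; exact: ltW.
apply: (@cder_under_integral _ _ _ mu `]0, 1[ (fun x => gfun m b x)
  (fun x t => -1 * gfun m (b + 1) x t) r (r / 2) (2 * r)
  (fun t => (1 - t) `^ (Re m) * t `^ (Re (b + 1)))) => //.
- by apply/andP; split; lra.
- by move=> x /andP[x1 x2]; apply: cintble_gfun => //; lra.
- move=> x t /andP[x1 x2]; rewrite itv01E => /andP[t0 t1].
  have lin : is_derive x (1 : R) (fun y : R => - (y * t) : R) (- t : R).
    have h := is_deriveN (is_deriveM (is_derive_id x (1 : R)) (is_derive_cst t x (1 : R))).
    by apply: (is_derive_eq h); rewrite /GRing.scale/= mulr0 mulr1 add0r.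
  have h := cder_real (@is_derive1_comp _ expR (fun y : R => - (y * t)) x _ _
    (is_derive_expR (- (x * t))) lin).
  rewrite /gfun; apply: cder_eq.
    by apply: cderM; [exact: cder_cst|exact: h].
  rewrite mul0r addr0 (cpowS _ t0) mulrN rmorphN rmorphM/=; ring.
- exact: integrable_beta01.
- move=> x t /andP[x1 x2]; rewrite itv01E => t01.
  rewrite normcM normcN normc1 mul1r normc_gfun//.
  rewrite ler_piMr ?mulr_ge0 ?powR_ge0// expR_le1 oppr_le0 mulr_ge0//; first lra.
  by case/andP: t01 => /ltW.
Qed.

(** [gint] extends analytically across [r = 0]; its value there is all that is
    visible at the order considered, so a Lipschitz bound is enough. *)
Lemma gint_near0 m b : -1 < Re m -> -1 < Re b ->
  exists2 K, 0 <= K & forall r, 0 < r -> normc (gint m b r - gint m b 0) <= K * r.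
Proof.
move=> m1 b1; pose B t := (1 - t) `^ (Re m) * t `^ (Re b).
have iB : mu.-integrable `]0, 1[ (EFin \o B) by exact: integrable_beta01.
exists (2 * \int[mu]_(t in `]0, 1[) B t).
  by rewrite mulr_ge0// Rintegral_ge0// => t _; rewrite mulr_ge0 ?powR_ge0.
move=> r r0; rewrite !gintE -cintegralB; [|by []|..]; last 2 first.
- by apply: cintble_gfun => //; exact: ltW.
- exact: cintble_gfun.
rewrite mulrAC -mulrA -RintegralZl; [|by []|by []].
apply: normc_cintegral => //.
- by apply: (@cmeasB _ (measurableTypeR R)); exact: cmeas_gfun.
- move=> t; rewrite itv01E => /andP[t0 t1].
  rewrite -mulrBr normcM mul0r oppr0 expR0 -rmorphB normc_real.
  rewrite normcM !normc_cpow ?subr_gt0// -/(B t) mulrC.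
  apply: ler_wpM2r; first by rewrite mulr_ge0 ?powR_ge0.
  have rt : 0 <= r * t by rewrite mulr_ge0// ltW.
  rewrite distrC ger0_norm ?subr_ge0 ?expR_le1 ?oppr_le0//.
  have := expR_ge1Dx (- (r * t)); have : r * t <= r by rewrite ler_piMr// ltW.
  lra.
- by apply: (integrableZl _ r iB).
Qed.

(** The part of a weight with singular point [s] that lies below [s], scaled to
    the unit interval. *)
Lemma cintegral_incomplete_beta m b (c s : R) : -1 < Re m -> -1 < Re b -> 0 <= c -> 0 < s ->
  cintble mu `]0, s[ (fun x => cpow (s - x) m * cpow x b * (expR (- (c * x)))%:C) /\
  cintegral mu `]0, s[ (fun x => cpow (s - x) m * cpow x b * (expR (- (c * x)))%:C) =
  cpow s (m + b + 1) * gint m b (c * s).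
Proof.
move=> m1 b1 c0 s0; have sn0 : s != 0 by rewrite gt_eqF.
have pre : (fun x : R => s * x + 0) @^-1` `]0, s[ = `]0, 1[%classic :> set R.
  apply/seteqP; split => x /=; rewrite !in_itv/= addr0.
    by rewrite pmulr_rgt0// gtr_pMr.
  by rewrite pmulr_rgt0// gtr_pMr.
have E t : 0 < t < 1 -> cpow (s - (s * t + 0)) m * cpow (s * t + 0) b *
    (expR (- (c * (s * t + 0))))%:C = cpow s (m + b) * gfun m b (c * s) t.
  move=> /andP[t0 t1]; rewrite addr0 -[X in X - s * t]mulr1 -mulrBr.
  by rewrite !cpowM ?subr_gt0// cpowD /gfun -[c * s * t]mulrA; ring.
have cs0 : 0 <= c * s by rewrite mulr_ge0// ltW.
have iG := cintbleZ (cpow s (m + b)) measurable_itv01 (cintble_gfun m1 b1 cs0).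
have i0 : cintble mu `]0, s[ (fun x => cpow (s - x) m * cpow x b * (expR (- (c * x)))%:C).
  apply/(@cintble_affine R s 0 sn0).
  - exact: (measurable_itvR `]0, s[).
  - apply: (@cmeasM _ (measurableTypeR R)).
      apply: (@cmeasM _ (measurableTypeR R)); apply: cmeas_cpow => //.
      by apply: measurable_funTS; apply: measurable_funB.
    by apply: cmeas_real; exact: measurable_expRM.
  - rewrite pre; apply: (cintble_eq _ iG) => [t|//].
    by rewrite itv01E => t01; rewrite E.
split => //.
rewrite (@cintegral_affine R s 0 sn0 `]0, s[ _ (measurable_itvR _) i0) pre (gtr0_norm s0).
rewrite (cpowS _ s0) -mulrA; congr (_ * _).
rewrite gintE -cintegralZ; [|by []|]; last exact: cintble_gfun.
by apply: cintegral_eq => t; rewrite itv01E => t01; rewrite E.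
Qed.

(** The part above [s], translated to the half-line; the factor [exp (- s)] comes
    from the translation. *)
Lemma cintegral_tail m b (s : R) : -1 < Re m -> 0 < s ->
  cintble mu `]s, +oo[ (fun x => cpow (x - s) m * cpow x b * (expR (- x))%:C) /\
  cintegral mu `]s, +oo[ (fun x => cpow (x - s) m * cpow x b * (expR (- x))%:C) =
  (expR (- s))%:C * kint m b s 1.
Proof.
move=> m1 s0; have n1 : (1 : R) != 0 by exact: oner_neq0.
have pre : (fun x : R => 1 * x + s) @^-1` `]s, +oo[ = `]0, +oo[%classic :> set R.
  by apply/seteqP; split => x /=; rewrite !in_itv/= !andbT; lra.
have E u : cpow (1 * u + s - s) m * cpow (1 * u + s) b *
    (expR (- (1 * u + s)))%:C = (expR (- s))%:C * kfun m b s 1 u.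
  rewrite mul1r addrK /kfun mul1r opprD expRD rmorphM/=; ring.
have iK := cintbleZ (expR (- s))%:C (@measurable_itv0y R) (cintble_kfun b m1 s0 ltr01).
have i0 : cintble mu `]s, +oo[ (fun x => cpow (x - s) m * cpow x b * (expR (- x))%:C).
  apply/(@cintble_affine R 1 s n1).
  - exact: (measurable_itvR `]s, +oo[).
  - apply: (@cmeasM _ (measurableTypeR R)).
      apply: (@cmeasM _ (measurableTypeR R)); apply: cmeas_cpow => //.
      by apply: measurable_funTS; apply: measurable_funB.
    by apply: cmeas_real; apply: measurable_funTS; apply: measurableT_comp.
  - by rewrite pre; apply: (cintble_eq _ iK) => [t _|//]; rewrite E.
split => //.
rewrite (@cintegral_affine R 1 s n1 `]s, +oo[ _ (measurable_itvR _) i0) pre normr1 mul1r.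
rewrite kintE -cintegralZ; [|by []|exact: cintble_kfun].
by apply: cintegral_eq => u _; rewrite E.
Qed.

Lemma rintegral_tail (q x : R) : -1 < q -> 0 < x ->
  \int[mu]_(r in `]x, +oo[) ((r - x) `^ q * expR (- r)) = expR (- x) * rgamma q 1.
Proof.
move=> q1 x0; apply: (@complexI R); rewrite rmorphM/= -kint_powR -cintegral_real.
have [_] := @cintegral_tail q%:C 0 x q1 x0.
rewrite kintE [kint _ _ _ _]kintE => E.
transitivity (cintegral mu `]x, +oo[
    (fun x0 => cpow (x0 - x) q%:C * cpow x0 0 * (expR (- x0))%:C)).
  apply: cintegral_eq => r /=; rewrite in_itv/= andbT => xr.
  by rewrite cpow0 mulr1 rmorphM/= cpow_real// subr_gt0.
by rewrite E; congr (_ * _); apply: cintegral_eq => u _; rewrite !cpow0.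
Qed.

(** The integral of [(r - x)^m x^b exp (- r)] over [0 < x < r]: integrating in [r]
    first separates into two Gamma integrals, integrating in [x] first gives the
    Beta integral times a power of [r]. *)
Lemma beta_unit_interval m b : -1 < Re m -> -1 < Re b ->
  gint m b 0 * cGamma (m + b + 2%:R) = cGamma (m + 1) * cGamma (b + 1).
Proof.
move=> m1 b1.
pose F (x r : R) : R[i] :=
  if x < r then cpow (r - x) m * cpow x b * (expR (- r))%:C else 0.
have m0y := @measurable_itv0y R.
have onD (A B : set R) (f g : R -> R[i]) :
    (forall x, (if x \in A then f x else 0) = (if x \in B then g x else 0)) ->
    cintegral mu A f = cintegral mu B g.
  move=> fg; rewrite cintegral_mkcond [RHS]cintegral_mkcond.
  by apply: cintegral_eq => x _.
have onDi (A B : set (measurableTypeR R)) (f g : R -> R[i]) :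
    measurable A -> measurable B ->
    (forall x, (if x \in A then f x else 0) = (if x \in B then g x else 0)) ->
    cintble mu B g -> cintble mu A f.
  move=> mA mB fg /(cintble_mkcond _ _ mB) h; apply/(cintble_mkcond _ _ mA).
  by apply: (cintble_eq _ h) => [x _|//]; rewrite fg.
have inE0 (x : R) : (x \in (`]0, +oo[%classic : set R)) = (0 < x).
  by rewrite mem_setE in_itv/= andbT.
have S1 x : 0 < x -> forall r,
    (if r \in (`]0, +oo[%classic : set R) then F x r else 0) =
    (if r \in (`]x, +oo[%classic : set R)
      then cpow x b * (cpow (r - x) m * cpow r 0 * (expR (- r))%:C) else 0).
  move=> x0 r; rewrite inE0 /F mem_setE in_itv/= andbT.
  have [r0|r0] := ltP 0 r; have [xr|xr] := ltP x r; [|by []|by exfalso; lra|by []].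
  by rewrite cpow0 mulr1; ring.
have S2 r : 0 < r -> forall x,
    (if x \in (`]0, +oo[%classic : set R) then F x r else 0) =
    (if x \in (`]0, r[%classic : set R)
      then (expR (- r))%:C * (cpow (r - x) m * cpow x b * (expR (- (0 * x)))%:C) else 0).
  move=> r0 x; rewrite inE0 /F mem_setE in_itv/=.
  have [x0|x0] := ltP 0 x; have [xr|xr] := ltP x r; [|by []|by []|by []].
  by rewrite /= mul0r oppr0 expR0 mulr1 mulrC.
have I1 x : 0 < x -> cintble mu `]0, +oo[ (F x).
  move=> x0; have [h _] := @cintegral_tail m 0 x m1 x0.
  apply: (onDi _ _ _ _ m0y (measurable_itvR _) (S1 _ x0)).
  exact: (cintbleZ (cpow x b) (measurable_itvR _) h).
have I2 r : 0 < r -> cintble mu `]0, +oo[ (F^~ r).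
  move=> r0; have [h _] := @cintegral_incomplete_beta m b 0 r m1 b1 (lexx 0) r0.
  apply: (onDi _ _ _ _ m0y (measurable_itvR _) (S2 _ r0)).
  exact: (cintbleZ (expR (- r))%:C (measurable_itvR _) h).
have L x : 0 < x -> cintegral mu `]0, +oo[ (F x) = cGamma (m + 1) * kfun b 0 1 1 x.
  move=> x0; have [h E] := @cintegral_tail m 0 x m1 x0.
  rewrite (onD _ _ _ _ (S1 _ x0)) cintegralZ; [|by exact: measurable_itvR|exact: h].
  rewrite E (cGammaE (m + 1) x) addrK /kfun cpow0 mulr1 mul1r; ring.
have M r : 0 < r -> cintegral mu `]0, +oo[ (F^~ r) = gint m b 0 * kfun (m + b + 1) 0 1 1 r.
  move=> r0; have [h E] := @cintegral_incomplete_beta m b 0 r m1 b1 (lexx 0) r0.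
  rewrite (onD _ _ _ _ (S2 _ r0)) cintegralZ; [|by exact: measurable_itvR|exact: h].
  by rewrite E mul0r /kfun cpow0 mulr1 mul1r; ring.
have mb1 : -1 < Re (m + b + 1) by rewrite !Re_add/=; lra.
transitivity (cintegral mu `]0, +oo[ (fun r => cintegral mu `]0, +oo[ (F^~ r))).
  transitivity (cintegral mu `]0, +oo[ (fun r => gint m b 0 * kfun (m + b + 1) 0 1 1 r)).
    rewrite cintegralZ; [|by []|exact: cintble_kfun].
    rewrite -kint_def (cGammaE (m + b + 2%:R) 1).
    have -> : m + b + 2%:R - 1 = m + b + 1 by ring.
    exact: erefl.
  by apply: cintegral_eq => r; rewrite itv0yE => r0; rewrite M.
rewrite -(@cintegral_fubini _ _ _ _ _ mu mu `]0, +oo[ `]0, +oo[ F); first last.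
- have gE x : 0 < x -> \int[mu]_(r in `]0, +oo[) normc (F x r) =
      rgamma (Re m) 1 * (x `^ (Re b) * expR (- (1 * x))).
    move=> x0; transitivity (x `^ Re b *
        \int[mu]_(r in `]x, +oo[) ((r - x) `^ (Re m) * expR (- r))).
      rewrite -RintegralZl; [|by exact: measurable_itvR|]; last first.
        have [/(cintble_normc (measurable_itvR _)) h _] :=
          @cintegral_tail (Re m)%:C 0 x m1 x0.
        move: h; apply: eq_integrable; first exact: measurable_itvR.
        move=> r /[!inE]/=.
        rewrite in_itv/= andbT => xr.
        rewrite cpow0 mulr1 normcM normc_real ger0_norm ?expR_ge0//.
        by rewrite normc_cpow// subr_gt0.
      rewrite Rintegral_mkcond [RHS]Rintegral_mkcond; apply: eq_Rintegral => r _.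
      rewrite !patchE inE0 mem_setE in_itv/= andbT /F.
      have [r0|r0] := ltP 0 r; have [xr|xr] := ltP x r;
        [|by rewrite normc0|by exfalso; lra|by []].
      rewrite !normcM normc_real ger0_norm ?expR_ge0// !normc_cpow ?subr_gt0//; ring.
    by rewrite rintegral_tail// mul1r; ring.
  have : mu.-integrable `]0, +oo[ (EFin \o (fun x =>
      rgamma (Re m) 1 * (x `^ (Re b) * expR (- (1 * x))))).
    by apply: (integrableZl m0y _ (integrable_powR_expR b1 ltr01)).
  apply: eq_integrable; first by [].
  by move=> x; rewrite inE itv0yE => x0 /=; rewrite gE.
- by move=> r; rewrite itv0yE; exact: I2.
- by move=> x; rewrite itv0yE; exact: I1.
- have mfst := @measurable_fst _ _ (measurableTypeR R) (measurableTypeR R).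
  have msnd := @measurable_snd _ _ (measurableTypeR R) (measurableTypeR R).
  have mW : cmeas setT (fun z : measurableTypeR R * measurableTypeR R =>
      cpow ((z.2 : R) - z.1) m * cpow z.1 b * (expR (- (z.2 : R)))%:C).
    apply: cmeasM.
      by apply: cmeasM; apply: cmeas_cpow => //; exact: measurable_funB.
    by apply: cmeas_real; apply: measurableT_comp => //; apply: measurableT_comp.
  have mlt : measurable_fun setT (fun z : measurableTypeR R * measurableTypeR R =>
      ((z.1 : R) < z.2)) by exact: measurable_fun_ltr.
  case/cmeasP: mW => mW1 mW2; apply/cmeasP; split; rewrite /F.
    rewrite (_ : (fun _ => _) = (fun z : measurableTypeR R * measurableTypeR R =>
      if (z.1 : R) < z.2 then Re (cpow ((z.2 : R) - z.1) m * cpow z.1 b *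
        (expR (- (z.2 : R)))%:C) else 0)).
      by apply: measurable_fun_ifT.
    by apply/funext => z; case: ifP.
  rewrite (_ : (fun _ => _) = (fun z : measurableTypeR R * measurableTypeR R =>
    if (z.1 : R) < z.2 then Im (cpow ((z.2 : R) - z.1) m * cpow z.1 b *
      (expR (- (z.2 : R)))%:C) else 0)).
    by apply: measurable_fun_ifT.
  by apply/funext => z; case: ifP.
- by [].
- by [].
transitivity (cintegral mu `]0, +oo[ (fun x => cGamma (m + 1) * kfun b 0 1 1 x)).
  by apply: cintegral_eq => x; rewrite itv0yE => x0; rewrite L.
rewrite cintegralZ; [|by []|exact: cintble_kfun].
by rewrite -kint_def (cGammaE (b + 1) 1) addrK.
Qed.

End beta_integrals.

(** * Limits at the origin and comparison of derivatives *)

Section limits.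
Context {R : realType}.
Implicit Types (f : R -> R[i]) (l z : R[i]) (s t x d : R).

Definition ctends0 f l := normc (f s - l) @[s --> 0^'+] --> (0 : R).

Lemma ctends0P f l : ctends0 f l <->
  (Re (f s) @[s --> 0^'+] --> Re l) /\ (Im (f s) @[s --> 0^'+] --> Im l).
Proof.
split=> [h|[h1 h2]].
  split; apply/subr_cvg0; apply: norm_cvg0.
    apply: (@squeeze_cvgr _ _ _ _ (cst 0) _ _ _ _ _ h); last exact: cvg_cst.
    by apply: nearW => s; rewrite normr_ge0/= -Re_sub Re_le_normc.
  apply: (@squeeze_cvgr _ _ _ _ (cst 0) _ _ _ _ _ h); last exact: cvg_cst.
  by apply: nearW => s; rewrite normr_ge0/= -Im_sub Im_le_normc.
have h : `|Re (f s) - Re l| + `|Im (f s) - Im l| @[s --> 0^'+] --> (0 : R).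
  rewrite -[X in _ --> X]addr0 -[in X in _ --> X + _](normr0 R) -[in X in _ --> _ + X](normr0 R).
  by apply: cvgD; apply: cvg_norm; apply/subr_cvg0.
apply: (@squeeze_cvgr _ _ _ _ (cst 0) _ _ _ _ _ h); last exact: cvg_cst.
by apply: nearW => s; rewrite normc_ge0/= -Re_sub -Im_sub normc_le_ReIm.
Qed.

Lemma ctends0_cst z : ctends0 (fun=> z) z.
Proof. by apply/ctends0P; split; exact: cvg_cst. Qed.

Lemma ctends0D f g l l' : ctends0 f l -> ctends0 g l' ->
  ctends0 (fun x => f x + g x) (l + l').
Proof.
move=> /ctends0P[f1 f2] /ctends0P[g1 g2]; apply/ctends0P; split.
  by under eq_fun do rewrite Re_add; rewrite Re_add; exact: cvgD.
by under eq_fun do rewrite Im_add; rewrite Im_add; exact: cvgD.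
Qed.

Lemma ctends0M f g l l' : ctends0 f l -> ctends0 g l' ->
  ctends0 (fun x => f x * g x) (l * l').
Proof.
move=> /ctends0P[f1 f2] /ctends0P[g1 g2]; apply/ctends0P; split.
  by under eq_fun do rewrite Re_mul; rewrite Re_mul; apply: cvgB; exact: cvgM.
by under eq_fun do rewrite Im_mul; rewrite Im_mul; apply: cvgD; exact: cvgM.
Qed.

Lemma ctends0B f g l l' : ctends0 f l -> ctends0 g l' ->
  ctends0 (fun x => f x - g x) (l - l').
Proof.
move=> hf /(ctends0M (ctends0_cst (-1))); rewrite mulN1r => /(ctends0D hf).
by congr ctends0; apply/funext => x; rewrite mulN1r.
Qed.

Lemma ctends0_near f g l : (\forall s \near 0^'+, f s = g s) ->
  ctends0 f l -> ctends0 g l.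
Proof.
move=> fg; apply: cvg_trans; apply: near_eq_cvg.
by apply: filterS fg => s ->.
Qed.

Lemma cder_cvg f s l : cder f s l ->
  (Re (f x) @[x --> s] --> Re (f s)) /\ (Im (f x) @[x --> s] --> Im (f s)).
Proof.
move=> /cderP[[h1 _] [h2 _]].
by split; apply: differentiable_continuous; exact/derivable1_diffP.
Qed.

Lemma cder_ctends0 f l : cder f 0 l -> ctends0 f (f 0).
Proof.
move=> /cder_cvg[h1 h2]; apply/ctends0P.
by split; apply: cvg_at_right_filter.
Qed.

Lemma near0_itv d : 0 < d -> \forall s \near 0^'+, 0 < s < d.
Proof.
move=> d0; near=> s; apply/andP; split; near: s.
  exact: nbhs_right_gt.
exact: nbhs_right_lt.
Unshelve. all: by end_near. Qed.

Lemma Rintegral_cvg0 dd (T : measurableType dd) (m : {measure set T -> \bar R})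
    (D : set T) (F : R -> T -> R) (f g : T -> R) d :
  measurable D -> 0 < d ->
  (forall s, 0 < s < d -> measurable_fun D (F s)) -> measurable_fun D f ->
  (forall x : T, D x -> F s x @[s --> 0^'+] --> f x) ->
  m.-integrable D (EFin \o g) ->
  (forall s (x : T), 0 < s < d -> D x -> `|F s x| <= g x) ->
  \int[m]_(x in D) F s x @[s --> 0^'+] --> \int[m]_(x in D) f x.
Proof.
move=> mD d0 mF mf Ff ig Fg; apply/cvg_at_rightP => u [u0 ucv].
have [N _ uN] : \forall n \near \oo, u n < d.
  by apply: (cvgr_lt _ ucv).
have u0d n : 0 < u (n + N)%N < d by rewrite u0/= uN//= leq_addl.
rewrite -(cvg_shiftn N).
have [] := @dominated_convergence _ _ _ m D mD
  (fun n (x : T) => (F (u (n + N)%N) x)%:E) (EFin \o f) (EFin \o g).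
- by move=> n; apply/measurable_EFinP; exact: mF.
- exact/measurable_EFinP.
- apply/aeW => x Dx; apply: cvg_EFin; first exact: nearW.
  have /cvg_at_rightP h := Ff x Dx.
  have := h (fun n => u (n + N)%N); apply; split=> [n|].
    by case/andP: (u0d n).
  by rewrite (cvg_shiftn N u).
- exact: ig.
- by apply/aeW => x n Dx; rewrite lee_fin Fg.
move=> fi _ cv; apply: fine_cvg.
rewrite /Rintegral fineK; first exact: cv.
exact: (integrable_fin_num mD fi).
Qed.

Lemma cintegral_ctends0 dd (T : measurableType dd) (m : {measure set T -> \bar R})
    (D : set T) (F : R -> T -> R[i]) (f : T -> R[i]) (g : T -> R) d :
  measurable D -> 0 < d ->
  (forall s, 0 < s < d -> cmeas D (F s)) -> cmeas D f ->
  (forall x : T, D x -> ctends0 (F ^~ x) (f x)) ->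
  m.-integrable D (EFin \o g) ->
  (forall s (x : T), 0 < s < d -> D x -> normc (F s x) <= g x) ->
  ctends0 (fun s => cintegral m D (F s)) (cintegral m D f).
Proof.
move=> mD d0 mF /cmeasP[mf1 mf2] Ff ig Fg; apply/ctends0P.
Transparent cintegral.
rewrite /cintegral/=; split.
  apply: (@Rintegral_cvg0 _ _ _ _ (fun s (x : T) => Re (F s x)) _ g d) => //.
  - by move=> s s0; have /cmeasP[] := mF s s0.
  - by move=> x Dx; have /ctends0P[] := Ff x Dx.
  - by move=> s x sd Dx; rewrite (le_trans (Re_le_normc _))// Fg.
apply: (@Rintegral_cvg0 _ _ _ _ (fun s (x : T) => Im (F s x)) _ g d) => //.
- by move=> s s0; have /cmeasP[] := mF s s0.
- by move=> x Dx; have /ctends0P[] := Ff x Dx.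
- by move=> s x sd Dx; rewrite (le_trans (Im_le_normc _))// Fg.
Qed.
Opaque cintegral.

Lemma derive_compare (f g f' g' : R -> R) (a b : R) : a < b ->
  (forall x, a <= x <= b -> is_derive x 1 f (f' x)) ->
  (forall x, a <= x <= b -> is_derive x 1 g (g' x)) ->
  (forall x, a <= x <= b -> `|f' x| <= g' x) ->
  `|f b - f a| <= g b - g a.
Proof.
move=> ab df dg fg.
have aux (h h' : R -> R) : (forall x, a <= x <= b -> is_derive x 1 h (h' x)) ->
    (forall x, a <= x <= b -> 0 <= h' x) -> h a <= h b.
  move=> dh h0; apply: (@ger0_derive1_le_cc _ h a b) => //.
  - by move=> x; rewrite in_itv/= => /andP[ax xb]; have [] := dh x; rewrite ?ltW ?(ltW ax) ?(ltW xb).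
  - move=> x; rewrite in_itv/= => /andP[ax xb]; rewrite derive1E.
    have axb : a <= x <= b by rewrite (ltW ax) (ltW xb).
    by have [_ ->] := dh x axb; exact: h0.
  - apply: derivable_within_continuous => x; rewrite in_itv/= => axb.
    by have [] := dh x axb.
  - by rewrite in_itv/= lexx ltW.
  - by rewrite in_itv/= lexx ltW.
  - exact: ltW.
have h1 : g a - f a <= g b - f b.
  apply: (aux (fun x => g x - f x) (fun x => g' x - f' x)) => x xab.
    by apply: is_deriveB; [exact: dg|exact: df].
  by rewrite subr_ge0 (le_trans (ler_norm _))// fg.
have h2 : g a + f a <= g b + f b.
  apply: (aux (fun x => g x + f x) (fun x => g' x + f' x)) => x xab.
    by apply: is_deriveD; [exact: dg|exact: df].
  by rewrite -lerBlDr sub0r (le_trans _ (fg _ xab))// -normrN ler_norm.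
by rewrite ler_norml; apply/andP; split; lra.
Qed.

(** A mean value inequality for complex values; the factor [2] again comes from
    treating the real and imaginary parts separately. *)
Lemma cder_compare (f f' : R -> R[i]) (g g' : R -> R) (a b : R) : a < b ->
  (forall x, a <= x <= b -> cder f x (f' x)) ->
  (forall x, a <= x <= b -> is_derive x 1 g (g' x)) ->
  (forall x, a <= x <= b -> normc (f' x) <= g' x) ->
  normc (f b - f a) <= 2 * (g b - g a).
Proof.
move=> ab df dg fg; rewrite (le_trans (normc_le_ReIm _))// mulrDl mul1r.
rewrite Re_sub Im_sub lerD//.
  apply: (@derive_compare (fun x => Re (f x)) g (fun x => Re (f' x)) g') => // x xab.
    by have /cderP[] := df x xab.
  by rewrite (le_trans (Re_le_normc _)) ?fg.
apply: (@derive_compare (fun x => Im (f x)) g (fun x => Im (f' x)) g') => // x xab.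
  by have /cderP[] := df x xab.
by rewrite (le_trans (Im_le_normc _)) ?fg.
Qed.

(** Comparison from the origin itself, where [f] need only have a limit. *)
Lemma cder_compare0 (f f' : R -> R[i]) (g g' : R -> R) d :
  (forall x, 0 < x < d -> cder f x (f' x)) ->
  (forall x, 0 < x < d -> is_derive x 1 g (g' x)) ->
  (forall x, 0 < x < d -> normc (f' x) <= g' x) ->
  ctends0 f 0 -> g x @[x --> 0^'+] --> (0 : R) ->
  forall s, 0 < s < d -> normc (f s) <= 2 * g s.
Proof.
move=> df dg fg f0 g0 s /andP[s0 sd].
have h : normc (f t) + 2 * (g s - g t) @[t --> 0^'+] --> 0 + 2 * (g s - 0).
  apply: cvgD.
    rewrite (_ : (fun x => normc (f x)) = (fun x => normc (f x - 0))); first exact: f0.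
    by apply/funext => x; rewrite subr0.
  by apply: cvgM; [exact: cvg_cst|apply: cvgB => //; exact: cvg_cst].
rewrite subr0 add0r in h.
rewrite -(cvg_lim _ h)//; apply: limr_ge; first by apply/cvg_ex; eexists; exact: h.
near=> t.
have t0 : 0 < t by near: t; exact: nbhs_right_gt.
have ts : t < s by near: t; exact: nbhs_right_lt.
have xd x : t <= x <= s -> 0 < x < d.
  by move=> /andP[tx xs]; rewrite (lt_le_trans t0 tx) (le_lt_trans xs sd).
have := @cder_compare f f' g g' t s ts (fun x h => df x (xd x h))
  (fun x h => dg x (xd x h)) (fun x h => fg x (xd x h)).
have := le_normcD (f s - f t) (f t); rewrite subrK; lra.
Unshelve. all: by end_near. Qed.

End limits.

(** * Gauss's limit for the Gamma function *)

Section reflection.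
Context {R : realType}.
Local Notation mu := (@lebesgue_measure R).
Implicit Types (z w l : R[i]) (s t x e : R) (n k : nat).

(** On the positive reals the derivative [z v^(z-1)] of [v^z] is dominated by
    that of [v - 1/v] as soon as [|Re z| <= 1]. *)
Lemma normc_cpow_sub1 z v : `|Re z| <= 1 -> 0 < v ->
  normc (cpow v z - 1) <= 2 * (normc z * `|v - v^-1|).
Proof.
rewrite ler_norml => /andP[z1 z2] v0.
pose g (x : R) := normc z * (x - x^-1).
pose g' (x : R) := normc z * (1 + x ^- 2).
have dg x : 0 < x -> is_derive x 1 g (g' x).
  move=> x0; have xn0 : x != 0 by rewrite gt_eqF.
  have h := is_deriveZ (normc z) (is_deriveB (is_derive_id x (1 : R))
    (is_deriveV (f := id) xn0 (is_derive_id x (1 : R)))).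
  apply: (is_derive_eq h); rewrite /GRing.scale/= /g' mulr1.
  by rewrite opprK.
have fg x : 0 < x -> normc (z * cpow x (z - 1)) <= g' x.
  move=> x0; rewrite normcM normc_cpow// ler_wpM2l ?normc_ge0// Re_sub /=.
  have [x1|x1] := leP x 1.
    have : x `^ (Re z - 1) <= x `^ (- 2).
      by apply: ger_powR; [rewrite x0|lra].
    rewrite powR_invn ?(ltW x0)//; lra.
  have : x `^ (Re z - 1) <= x `^ 0 by apply: ler_powR; [exact: ltW|lra].
  rewrite powRr0; have : 0 <= x ^- 2 by rewrite invr_ge0 exprn_ge0// ltW.
  lra.
have g1 : g 1 = 0 by rewrite /g invr1 subrr mulr0.
have [v1|v1|->] := ltgtP v 1; last first.
- by rewrite cpow_1 subrr normc0 mulr_ge0// mulr_ge0 ?normc_ge0.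
- have := @cder_compare R (fun x => cpow x z) (fun x => z * cpow x (z - 1)) g g' 1 v v1.
  rewrite cpow_1 g1 subr0 /g ger0_norm; last first.
    by rewrite subr_ge0 (le_trans _ (ltW v1))// invf_le1// ltW.
  by apply=> x /andP[x1 _]; [apply: cder_cpow; lra|apply: dg; lra|apply: fg; lra].
- have := @cder_compare R (fun x => cpow x z) (fun x => z * cpow x (z - 1)) g g' v 1 v1.
  rewrite cpow_1 g1 sub0r /g -mulrN ler0_norm; last first.
    by rewrite subr_le0 (le_trans (ltW v1))// -[leLHS]invr1 lef_pV2 ?posrE// ltW.
  rewrite -(normcN (1 - _)) opprB.
  by apply=> x /andP[x1 _]; [apply: cder_cpow; lra|apply: dg; lra|apply: fg; lra].
Qed.

Lemma rgamma_nat k : rgamma k%:R 1 = k`!%:R :> R.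
Proof.
apply: (@complexI R); rewrite -kint_powR !rmorph_nat -cGammaD1 natr1.
exact: cGamma_nat.
Qed.

(** [Gamma (n+1+z) ~ n! n^z] because [x^n exp (- x)] concentrates around [x = n]:
    the deviation of [v = x / n] from [1] is measured by [(v - 1/v)^2], whose
    average is of order [1/n].  The parameter [e] is to be fixed before [n] is
    taken large. *)
Lemma gauss_limit_bound z n e : `|Re z| < 1 -> (2 <= n)%N -> 0 < e ->
  normc (cGamma (n.+1%:R + z) * cpow n%:R (- z) / n`!%:R - 1) <=
    2 * normc z * (e + 6 / (n%:R * e)).
Proof.
move=> z1 n2 e0; have n0 : 0 < n%:R :> R by rewrite ltr0n (leq_trans _ n2).
have nn0 : n%:R != 0 :> R by rewrite gt_eqF.
have fn0 : n`!%:R != 0 :> R[i] by rewrite pnatr_eq0 -lt0n fact_gt0.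
have f0 : 0 < n`!%:R :> R by rewrite ltr0n fact_gt0.
have z1' : -1 < Re z by move: z1; rewrite ltr_norml => /andP[].
have nz1 : -1 < Re (n%:R + z) by rewrite Re_add Re_nat; have := ler0n R n; lra.
have n1 : -1 < Re (n%:R : R[i]) by rewrite Re_nat; have := ler0n R n; lra.
pose W (x : R) := x `^ n%:R * expR (- (1 * x)).
pose W2 (x : R) := x `^ n.+2%:R * expR (- (1 * x)).
pose W0 (x : R) := x `^ (n - 2)%:R * expR (- (1 * x)).
have iW k : mu.-integrable `]0, +oo[ (EFin \o (fun x => x `^ k%:R * expR (- (1 * x)))).
  by apply: integrable_powR_expR => //; have := ler0n R k; lra.
have E : cGamma (n.+1%:R + z) * cpow n%:R (- z) - n`!%:R =
    cintegral mu `]0, +oo[ (fun x => cpow n%:R (- z) * kfun (n%:R + z) 0 1 1 x - kfun n%:R 0 1 1 x).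
  rewrite cintegralB; [|by []|apply: cintbleZ => //|]; try exact: cintble_kfun.
  rewrite cintegralZ; [|by []|exact: cintble_kfun].
  rewrite -(kint_def (n%:R + z)) -(kint_def n%:R) -cGamma_nat.
  rewrite (_ : n.+1%:R + z = n%:R + z + 1); last by rewrite -natr1; ring.
  rewrite -[n.+1%:R]natr1 (cGammaD1 _ 1) (cGammaD1 n%:R 1).
  by congr (_ - _); exact: mulrC.
pose g x := normc z * (e * W x + e^-1 * (n%:R ^- 2 * W2 x + n%:R ^+ 2 * W0 x - 2 * W x)).
have gb x : 0 < x -> normc (cpow n%:R (- z) * kfun (n%:R + z) 0 1 1 x - kfun n%:R 0 1 1 x) <= g x.
  move=> x0; set v := x / n%:R; have v0 : 0 < v by rewrite divr_gt0.
  have -> : cpow n%:R (- z) * kfun (n%:R + z) 0 1 1 x - kfun n%:R 0 1 1 x =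
      (cpow v z - 1) * (W x)%:C.
    rewrite /kfun /v cpowM ?invr_gt0// cpow_inv// !cpow0 cpowD cpow_nat//.
    rewrite /W powR_mulrn ?(ltW x0)// rmorphM/=; ring.
  have Wx0 : 0 <= W x by rewrite mulr_ge0 ?powR_ge0 ?expR_ge0.
  rewrite normcM normc_real (ger0_norm Wx0).
  have h := normc_cpow_sub1 (ltW z1) v0.
  (* [2 y <= e + y^2 / e] trades the modulus for the square, whose average against
     [x^n exp (- x)] is a combination of three factorials. *)
  have k : 2 * `|v - v^-1| <= e + e^-1 * (v ^+ 2 + v ^- 2 - 2).
    have -> : v ^+ 2 + v ^- 2 - 2 = `|v - v^-1| ^+ 2.
      by rewrite real_normK ?num_real//; field; rewrite gt_eqF.
    have ei : e * e^-1 = 1 by rewrite divff ?gt_eqF.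
    have e1 : 0 < e^-1 by rewrite invr_gt0.
    rewrite -subr_ge0 (_ : _ - _ = e^-1 * (`|v - v^-1| - e) ^+ 2); last first.
      by field; rewrite gt_eqF.
    by rewrite mulr_ge0 ?sqr_ge0 ?ltW.
  have W2E : n%:R ^- 2 * W2 x = v ^+ 2 * W x.
    rewrite /W2 /W !powR_mulrn ?(ltW x0)// /v -[n.+2]addn2 exprD.
    move: nn0; move: (n%:R : R) (x ^+ n) (expR _) => c y E' c0.
    by field.
  have W0E : n%:R ^+ 2 * W0 x = v ^- 2 * W x.
    rewrite /W0 /W !powR_mulrn ?(ltW x0)// /v.
    rewrite -[in X in _ = _ * (X * _)](subnK n2) exprD.
    have : x != 0 by rewrite gt_eqF.
    move: nn0; move: (n%:R : R) (x ^+ (n - 2)) (expR _) => c y E' c0 xn0.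
    by field; rewrite c0 xn0.
  rewrite /g W2E W0E.
  have -> : normc z * (e * W x + e^-1 * (v ^+ 2 * W x + v ^- 2 * W x - 2 * W x)) =
      normc z * (e + e^-1 * (v ^+ 2 + v ^- 2 - 2)) * W x by ring.
  rewrite ler_wpM2r// (le_trans h)// mulrCA ler_wpM2l ?normc_ge0//.
have ig : mu.-integrable `]0, +oo[ (EFin \o g).
  have m0y := @measurable_itv0y R.
  apply: (integrableZl m0y (normc z)
   (integrableD m0y (integrableZl m0y e (iW n))
     (integrableZl m0y e^-1 (integrableB m0y (integrableD m0y
       (integrableZl m0y (n%:R ^- 2) (iW n.+2)) (integrableZl m0y (n%:R ^+ 2) (iW (n - 2)%N)))
       (integrableZl m0y 2 (iW n)))))).
have IG : \int[mu]_(x in `]0, +oo[) g x = normc z * (e * n`!%:R +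
    e^-1 * (n%:R ^- 2 * n.+2`!%:R + n%:R ^+ 2 * (n - 2)`!%:R - 2 * n`!%:R)).
  have m0y := @measurable_itv0y R.
  have i1 := integrableZl m0y e (iW n).
  have i2 := integrableZl m0y (n%:R ^- 2) (iW n.+2).
  have i3 := integrableZl m0y (n%:R ^+ 2) (iW (n - 2)%N).
  have i4 := integrableZl m0y 2 (iW n).
  have i23 := integrableD m0y i2 i3.
  have i234 := integrableB m0y i23 i4.
  have i5 := integrableZl m0y e^-1 i234.
  have i15 := integrableD m0y i1 i5.
  rewrite /g RintegralZl; [|by []|exact: i15].
  rewrite RintegralD; [|by []|exact: i1|exact: i5].
  rewrite RintegralZl; [|by []|exact: iW].
  rewrite RintegralZl; [|by []|exact: i234].
  rewrite RintegralB; [|by []|exact: i23|exact: i4].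
  rewrite RintegralD; [|by []|exact: i2|exact: i3].
  rewrite !RintegralZl; [|by []|exact: iW|by []|exact: iW|by []|exact: iW].
  by rewrite -!rgamma_nat.
have -> : cGamma (n.+1%:R + z) * cpow n%:R (- z) / n`!%:R - 1 =
   (cGamma (n.+1%:R + z) * cpow n%:R (- z) - n`!%:R) / n`!%:R by field.
rewrite E normcM normcV normc_nat ler_pdivrMr//.
have B := normc_cintegral (m := mu) (D := `]0, +oo[) (g := g) (@measurable_itv0y R)
  (F := fun x => cpow n%:R (- z) * kfun (n%:R + z) 0 1 1 x - kfun n%:R 0 1 1 x).
rewrite (le_trans (B _ _ ig))//.
- apply: (@cmeasB _ (measurableTypeR R)); last exact: cmeas_kfun.
  by apply: (@cmeasM _ (measurableTypeR R)); [exact: cmeas_cst|exact: cmeas_kfun].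
- by move=> x; rewrite itv0yE; exact: gb.
have H : n%:R ^- 2 * n.+2`!%:R + n%:R ^+ 2 * (n - 2)`!%:R - 2 * n`!%:R <= 6 / n%:R * n`!%:R :> R.
  clear -n2; case: n n2 => [//|[//|m]] _.
  rewrite subn2 /= !factS !natrM; set f := m`!%:R; set c : R := m%:R.
  have f0 : 0 <= f :> R by exact: ler0n.
  have c0 : 0 <= c by exact: ler0n.
  have -> : m.+1%:R = c + 1 :> R by rewrite -natr1.
  have -> : m.+2%:R = c + 1 + 1 :> R by rewrite -!natr1.
  have -> : m.+3%:R = c + 1 + 1 + 1 :> R by rewrite -!natr1.
  have -> : m.+4%:R = c + 1 + 1 + 1 + 1 :> R by rewrite -!natr1.
  have c2 : (c + 1 + 1) != 0 by rewrite gt_eqF//; lra.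
  rewrite -subr_ge0 (_ : _ - _ = (c + 1 + 1)^-1 * f * (2 * c ^+ 2 + 3 * c)); last by field.
  have -> : 2 * c ^+ 2 + 3 * c = c * (2 * c + 3) by ring.
  have i2 : 0 <= (c + 1 + 1)^-1 by rewrite invr_ge0; lra.
  by rewrite !mulr_ge0//; lra.
rewrite IG -subr_ge0; set X := _ - _ in H *.
rewrite (_ : _ - _ = 2 * normc z * (e^-1 * (6 / n%:R * n`!%:R - X))).
  by rewrite mulr_ge0// mulr_ge0 ?normc_ge0// ?invr_ge0 ?(ltW e0)// subr_ge0.
by field; rewrite nn0 gt_eqF.
Qed.

End reflection.

(** * The sine product and Euler's reflection formula *)

Section sine_product.
Context {R : realType}.
Local Notation mu := (@lebesgue_measure R).
Implicit Types (z w l : R[i]) (s t x e : R) (n k : nat).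

Lemma cderXn (f : R -> R[i]) x l n : cder f x l ->
  cder (fun y => f y ^+ n.+1) x (n.+1%:R * f x ^+ n * l).
Proof.
move=> fl; elim: n => [|n IH].
  by rewrite expr0 !mul1r; congr (cder _ x l) : fl; apply/funext => y; rewrite expr1.
rewrite (_ : (fun y => _) = fun y => f y * f y ^+ n.+1); last first.
  by apply/funext => y; rewrite exprS.
apply: cder_eq (cderM fl IH) _.
by rewrite -[n.+2%:R]natr1 exprS; ring.
Qed.

Lemma cder_continuous_within (a b : R) (f : R -> R[i]) :
  (forall x, exists l, cder f x l) ->
  {within `[a, b], continuous (fun x => Re (f x))} /\
  {within `[a, b], continuous (fun x => Im (f x))}.
Proof.
move=> df; split; apply: derivable_within_continuous => x _;
  by have [l /cderP[[h1 _] [h2 _]]] := df x.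
Qed.

Lemma cintble_segment (a b : R) (f : R -> R[i]) :
  (forall x, exists l, cder f x l) -> cintble mu `[a, b] f.
Proof.
move=> /(@cder_continuous_within a b)[h1 h2]; apply/cintbleP.
by split; apply: continuous_compact_integrable => //; exact: segment_compact.
Qed.

Lemma cintegral_FTC (a b : R) (F f : R -> R[i]) : a < b ->
  (forall x, cder F x (f x)) -> (forall x, exists l, cder f x l) ->
  cintegral mu `[a, b] f = F b - F a.
Proof.
move=> ab dF df; have [c1 c2] := @cder_continuous_within a b f df.
have aux (G g : R -> R) : (forall x, is_derive x 1 G (g x)) ->
    {within `[a, b], continuous g} -> \int[mu]_(x in `[a, b]) g x = G b - G a.
  move=> dG cg; rewrite /Rintegral (@continuous_FTC2 _ g G a b ab cg)//.
    have cG : continuous G.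
      move=> x; apply: differentiable_continuous; apply/derivable1_diffP.
      by have [] := dG x.
    split => /=.
    - by move=> x _; have [] := dG x.
    - by apply: cvg_at_right_filter; exact: cG.
    - by apply: cvg_at_left_filter; exact: cG.
  by move=> x _; rewrite derive1E; have [_ ->] := dG x.
Transparent cintegral.
apply: complex_eqP; rewrite /cintegral /= ?Re_sub ?Im_sub.
  by apply: (aux (fun x => Re (F x))) c1 => x; have /cderP[] := dF x.
by apply: (aux (fun x => Im (F x))) c2 => x; have /cderP[] := dF x.
Qed.
Opaque cintegral.

(** Cauchy's cosine integral.  The recurrence [cosintSS] links [cosint n.*2 (2 z)],
    through the factors [1 - z^2 / k^2] for [k] up to [n], to
    [cosint 0 (2 z) = sin (pi z) / z]; that its quotient by [cosint n.*2 0] tends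
    to [1] is then the product formula for the sine. *)
Definition cosint n z : R[i] := cintegral mu `[- (pi / 2), pi / 2]
  (fun x => cexp (z * 'i%C * x%:C) * (cos x)%:C ^+ n).

Let cder_cos x : cder (fun y => (cos y)%:C) x (- (sin x)%:C).
Proof. by rewrite -rmorphN; apply: cder_real; exact: is_derive_cos. Qed.

Let cder_sin x : cder (fun y => (sin y)%:C) x (cos x)%:C.
Proof. by apply: cder_real; exact: is_derive_sin. Qed.

Let cder_cosint_fun n z x : exists l,
  cder (fun x => cexp (z * 'i%C * x%:C) * (cos x)%:C ^+ n) x l.
Proof.
case: n => [|n].
  exists (z * 'i%C * cexp (z * 'i%C * x%:C)).
  rewrite (_ : (fun x => _) = fun x => cexp (z * 'i%C * x%:C)); first exact: cder_cexp.
  by apply/funext => y; rewrite expr0 mulr1.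
have h := cderM (cder_cexp (z * 'i%C) x) (cderXn n (cder_cos x)).
by eexists; exact: h.
Qed.

Let pi20 : - (pi / 2) < pi / 2 :> R.
Proof. by have := pi_gt0 R; lra. Qed.

Lemma cintble_cosint n z : cintble mu `[- (pi / 2), pi / 2]
  (fun x => cexp (z * 'i%C * x%:C) * (cos x)%:C ^+ n).
Proof. by apply: cintble_segment => x; exact: cder_cosint_fun. Qed.

(** Two integrations by parts; equivalently, the difference of the two integrands
    is the derivative of [cos^(n+1) ((n+2) sin + i z cos) exp (i z x)], which
    vanishes at both ends. *)
Lemma cosintSS n z :
  (n.+2%:R ^+ 2 - z ^+ 2) * cosint n.+2 z = n.+2%:R * n.+1%:R * cosint n z.
Proof.
pose E x : R[i] := cexp (z * 'i%C * x%:C).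
pose Q x := (cos x)%:C ^+ n.+1 * (n.+2%:R * (sin x)%:C + 'i%C * z * (cos x)%:C) * E x.
pose q x := (n.+2%:R ^+ 2 - z ^+ 2) * (E x * (cos x)%:C ^+ n.+2) -
   n.+2%:R * n.+1%:R * (E x * (cos x)%:C ^+ n).
have m : measurable (`[- (pi / 2), pi / 2] : set (measurableTypeR R)).
  exact: measurable_itvR.
have ii : 'i%C * 'i%C = -1 :> R[i] by rewrite -expr2 sqr_i.
have dQ x : cder Q x (q x).
  have h := cderM (cderM (cderXn n (cder_cos x)) (cderD
    (cderZ n.+2%:R (cder_sin x)) (cderZ ('i%C * z) (cder_cos x))))
    (cder_cexp (z * 'i%C) x).
  apply: cder_eq h _.
  have sc : (sin x)%:C ^+ 2 + (cos x)%:C ^+ 2 - 1 = 0 :> R[i].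
    by rewrite -!rmorphXn -rmorphD [sin x ^+ 2 + _]addrC cos2Dsin2 rmorph1 subrr.
  rewrite /q /E; move: sc; move: (cexp _) (sin x)%:C (cos x)%:C => e s c sc.
  rewrite !exprS -[n.+2%:R]natr1 -[n.+1%:R]natr1.
  rewrite -[RHS]addr0 -(mulr0 (- e * c ^+ n * (n%:R + 1) * (n%:R + 1 + 1))) -sc.
  rewrite -[RHS]addr0 -[0 in RHS](mulr0 (e * c ^+ n * z ^+ 2 * c ^+ 2)).
  rewrite -[0 in RHS](subrr (-1)) -[in X in _ = _ + _ * (X - _)]ii.
  ring.
have dq x : exists l, cder q x l.
  have [l1 h1] := cder_cosint_fun n.+2 z x; have [l2 h2] := cder_cosint_fun n z x.
  by eexists; apply: cderB; apply: cderZ; [exact: h1|exact: h2].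
have := cintegral_FTC pi20 dQ dq.
rewrite /Q cosN cos_pihalf expr0n /= !mul0r subrr.
rewrite cintegralB; [|by []|exact: cintbleZ (cintble_cosint _ _)|exact: cintbleZ (cintble_cosint _ _)].
rewrite cintegralZ; [|by []|exact: cintble_cosint].
rewrite cintegralZ; [|by []|exact: cintble_cosint].
by move=> /subr0_eq.
Qed.

Lemma cosint0 z : z != 0 -> cosint 0 (2%:R * z) = csin (pi%:C * z) / z.
Proof.
move=> z0; have i0 : 'i%C != 0 :> R[i] by rewrite -sqrf_eq0 sqr_i oppr_eq0 oner_eq0.
have n2 : 2%:R != 0 :> R[i] by rewrite pnatr_eq0.
pose F x : R[i] := (2%:R * z * 'i%C)^-1 * cexp (2%:R * z * 'i%C * x%:C).
have dF x : cder F x (cexp (2%:R * z * 'i%C * x%:C) * (cos x)%:C ^+ 0).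
  apply: cder_eq (cderZ _ (cder_cexp _ x)) _.
  by rewrite expr0 mulr1 mulKf// !mulf_neq0.
rewrite /cosint (cintegral_FTC pi20 dF); last by move=> x; exact: cder_cosint_fun.
rewrite /F rmorphN mulrN.
have -> : 2%:R * z * 'i%C * (pi / 2)%:C = pi%:C * z * 'i%C :> R[i].
  by rewrite rmorphM fmorphV rmorph_nat; field.
rewrite /csin; field.
by rewrite i0 z0.
Qed.

Definition rcosint n : R := \int[mu]_(x in `[- (pi / 2), pi / 2]) cos x ^+ n.

Lemma cosint_z0 n : cosint n 0 = (rcosint n)%:C.
Proof.
rewrite -cintegral_real; apply: cintegral_eq => x _.
by rewrite !mul0r cexp0 mul1r rmorphXn.
Qed.

Lemma rcosint0 : rcosint 0 = pi.
Proof.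
rewrite /rcosint /Rintegral; under eq_integral do rewrite expr0.
rewrite integral_cst//= mul1e.
rewrite lebesgue_measure_itv/= lte_fin pi20/= opprK.
by field.
Qed.

Lemma rcosintSS n : n.+2%:R * rcosint n.+2 = n.+1%:R * rcosint n.
Proof.
apply: (@complexI R); rewrite !rmorphM/= -!cosint_z0 !rmorph_nat.
have := cosintSS n 0; rewrite expr0n subr0 expr2 -!mulrA.
by move/(mulfI _); apply; rewrite pnatr_eq0.
Qed.

Lemma rcosint_gt0 n : 0 < rcosint n.*2.
Proof.
elim: n => [|n IH]; first by rewrite rcosint0 pi_gt0.
have := rcosintSS n.*2; rewrite -doubleS => E.
have : 0 < n.+1.*2%:R * rcosint n.+1.*2 by rewrite E mulr_gt0// ltr0n.
by rewrite pmulr_rgt0// ltr0n double_gt0.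
Qed.

Lemma xcos_le_sin x : 0 <= x <= pi / 2 -> x * cos x <= sin x.
Proof.
move=> /andP[x0 xp]; have [->|xn0] := eqVneq x 0; first by rewrite mul0r sin0.
have xp0 : 0 < x by rewrite lt_neqAle eq_sym xn0.
pose g (y : R) := sin y - y * cos y.
have dg (y : R) : is_derive y (1 : R) g (y * sin y : R).
  have h := is_deriveB (is_derive_sin y) (is_deriveM (is_derive_id y (1 : R)) (is_derive_cos y)).
  by apply: (is_derive_eq h); rewrite /GRing.scale/=; ring.
have := @derive_compare R (fun=> 0) g (fun=> 0) (fun y => y * sin y) 0 x xp0
  (fun y _ => is_derive_cst 0 y 1) (fun y _ => dg y).
rewrite subrr normr0 /g sin0 mul0r !subr0 subr_ge0; apply.
move=> y /andP[y0 yx]; rewrite mulr_ge0// sin_ge0_pi// y0/=.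
by have := pi_gt0 R; lra.
Qed.

Lemma sqr_xcos_le x : - (pi / 2) <= x <= pi / 2 -> x ^+ 2 * cos x ^+ 2 <= sin x ^+ 2.
Proof.
wlog x0 : x / 0 <= x => [h /andP[x1 x2]|/andP[_ x2]].
  have [x0|x0] := leP 0 x; first by apply: h => //; rewrite x1.
  rewrite -[x]opprK sqrrN cosN sinN [leRHS]sqrrN; apply: h; first by lra.
  by apply/andP; split; lra.
have c0 : 0 <= cos x by apply: cos_ge0_pihalf; apply/andP; split; have := pi_gt0 R; lra.
rewrite -exprMn ler_sqr ?nnegrE ?mulr_ge0//; first by apply: xcos_le_sin; rewrite x0.
by rewrite (le_trans _ (xcos_le_sin _)) ?mulr_ge0// x0.
Qed.

(** The mass of [cos^N] concentrates at [0], where [exp (i z x)] is close to [1]: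
    since [x^2 cos^2 x <= sin^2 x = 1 - cos^2 x], the second moment of [cos^N] is
    at most the difference of two consecutive integrals, which [rcosintSS] shows
    to be a fraction [1 / (N - 1)] of the second. *)
Lemma cosint_concentration z : exists2 K, 0 <= K & forall n e, 0 < e ->
  normc (cosint n.+1.*2 z / cosint n.+1.*2 0 - 1) <= K * (e + e^-1 / n.*2.+1%:R).
Proof.
pose M := normc z * expR (`|Im z| * (pi / 2) + `|Re z| * (pi / 2)).
have M0 : 0 <= M by rewrite mulr_ge0 ?normc_ge0 ?expR_ge0.
exists (2 * M) => [|n e e0]; first by rewrite mulr_ge0.
have p0 := pi_gt0 R.
pose D : set (measurableTypeR R) := `[- (pi / 2), pi / 2]%classic.
have mD : measurable D by exact: measurable_itvR.
have inD x : D x -> - (pi / 2) <= x <= pi / 2 by rewrite /D/= in_itv.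
have expb x : - (pi / 2) <= x <= pi / 2 ->
    normc (z * 'i%C * cexp (z * 'i%C * x%:C)) <= M.
  move=> /andP[x1 x2]; rewrite !normcM normc_cexp ReZr.
  have -> : normc 'i%C = 1 :> R by rewrite /= expr0n/= expr1n add0r sqrtr1.
  rewrite mulr1 ler_wpM2l ?normc_ge0// ler_expR Re_mul /= mulr0 mulr1 sub0r.
  rewrite mulNr (le_trans (ler_norm _))// normrN normrM.
  have : `|x| <= pi / 2 by rewrite ler_norml x1 x2.
  move/(ler_wpM2l (normr_ge0 (Im z))) => h.
  have : 0 <= `|Re z| * (pi / 2) by rewrite mulr_ge0// divr_ge0// ltW.
  lra.
have expx x : - (pi / 2) <= x <= pi / 2 ->
    normc (cexp (z * 'i%C * x%:C) - 1) <= 2 * (M * `|x|).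
  have dl (y : R) : is_derive y (1 : R) (fun x : R => M * x : R) (M : R).
    by have h := is_deriveZ M (is_derive_id y (1 : R)); apply: (is_derive_eq h); exact: mulr1.
  move=> /andP[x1 x2]; have [x0|x0|->] := ltgtP x 0; last first.
  - by rewrite mulr0 cexp0 subrr normc0 normr0 !mulr0.
  - have := @cder_compare R (fun y => cexp (z * 'i%C * y%:C))
      (fun y => z * 'i%C * cexp (z * 'i%C * y%:C)) (fun y => M * y) (fun=> M) 0 x x0.
    rewrite mulr0 cexp0 mulr0 subr0 gtr0_norm//.
    apply; first by move=> y _; exact: cder_cexp.
    by move=> y /andP[y0 yx]; apply: expb; apply/andP; split; lra.
  - have := @cder_compare R (fun y => cexp (z * 'i%C * y%:C))
      (fun y => z * 'i%C * cexp (z * 'i%C * y%:C)) (fun y => M * y) (fun=> M) x 0 x0.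
    rewrite mulr0 cexp0 mulr0 sub0r ltr0_norm// -mulrN -(normcN (1 - _)) opprB.
    apply; first by move=> y _; exact: cder_cexp.
    by move=> y /andP[y0 yx]; apply: expb; apply/andP; split; lra.
clearbody M; set N := n.+1.*2; have NE : N = n.*2.+2 by rewrite /N doubleS.
have a0 := rcosint_gt0 n.+1; rewrite -/N in a0.
pose g x := M * (e * cos x ^+ N + e^-1 * (cos x ^+ n.*2 - cos x ^+ N)).
have icos k : mu.-integrable D (EFin \o (fun x => cos x ^+ k)).
  apply: continuous_compact_integrable; first exact: segment_compact.
  have [h _] := @cder_continuous_within (- (pi / 2)) (pi / 2)
    _ (fun x => cder_cosint_fun k 0 x).
  move: h; congr {within _, continuous _}; apply/funext => x; apply/funext => y.
  by rewrite !mul0r cexp0 mul1r -rmorphXn.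
have i1 := integrableZl mD e (icos N).
have i2 := integrableB mD (icos n.*2) (icos N).
have i3 := integrableZl mD e^-1 i2.
have i4 := integrableD mD i1 i3.
have ig := integrableZl mD M i4.
have E : cosint N z - cosint N 0 = cintegral mu D
   (fun x => (cexp (z * 'i%C * x%:C) - 1) * (cos x)%:C ^+ N).
  rewrite /cosint -cintegralB; [|exact: mD|exact: cintble_cosint|exact: cintble_cosint].
  by apply: cintegral_eq => x _; rewrite !mul0r cexp0 mulrBl.
have bd : normc (cosint N z - cosint N 0) <= 2 * \int[mu]_(x in D) g x.
  have ig' : mu.-integrable D (EFin \o g) := ig.
  rewrite E; have B := normc_cintegral (m := mu) (D := D) (g := g) mD
    (F := fun x => (cexp (z * 'i%C * x%:C) - 1) * (cos x)%:C ^+ N).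
  rewrite (le_trans (B _ _ ig'))//.
    have := cintbleB mD (cintble_cosint N z) (cintble_cosint N 0).
    move=> /cintble_cmeas; apply: cmeas_eq => x _.
    by rewrite !mul0r cexp0 mulrBl.
  move=> x /inD xD; rewrite normcM -rmorphXn normc_real.
  have c0 : 0 <= cos x by exact: cos_ge0_pihalf.
  rewrite ger0_norm ?exprn_ge0//.
  apply: (@le_trans _ _ (2 * (M * `|x|) * cos x ^+ N)).
    by rewrite ler_wpM2r ?exprn_ge0// expx.
  rewrite /g -!mulrA mulrCA ler_wpM2l//.
  (* As in Gauss's limit, the first moment is traded for the second. *)
  have k : 2 * `|x| <= e + e^-1 * x ^+ 2.
    have -> : x ^+ 2 = `|x| ^+ 2 by rewrite real_normK ?num_real.
    rewrite -subr_ge0 (_ : _ - _ = e^-1 * (`|x| - e) ^+ 2); last first.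
      by field; rewrite gt_eqF.
    by rewrite mulr_ge0 ?sqr_ge0 ?invr_ge0 ?ltW.
  rewrite mulrA (le_trans (ler_wpM2r (exprn_ge0 N c0) k))// mulrDl lerD2l.
  rewrite -mulrA ler_wpM2l ?invr_ge0 ?(ltW e0)//.
  have -> : cos x ^+ n.*2 - cos x ^+ N = sin x ^+ 2 * cos x ^+ n.*2.
    by rewrite NE 2!exprS; have := cos2Dsin2 x; move/(canRL (addKr _)) => ->; ring.
  have -> : x ^+ 2 * cos x ^+ N = (x ^+ 2 * cos x ^+ 2) * cos x ^+ n.*2.
    by rewrite NE -[n.*2.+2]addn2 exprD -mulrA [cos x ^+ 2 * _]mulrC.
  by rewrite ler_wpM2r ?exprn_ge0// sqr_xcos_le.
have IG : \int[mu]_(x in D) g x = M * (e * rcosint N + e^-1 * (rcosint n.*2 - rcosint N)).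
  rewrite /g RintegralZl; [|by []|exact: i4].
  rewrite RintegralD; [|by []|exact: i1|exact: i3].
  rewrite RintegralZl; [|by []|exact: icos].
  rewrite RintegralZl; [|by []|exact: i2].
  by rewrite RintegralB; [|by []|exact: icos|exact: icos].
have rec : rcosint n.*2 - rcosint N = rcosint N / n.*2.+1%:R.
  have := rcosintSS n.*2; rewrite -NE => h.
  have n0 : n.*2.+1%:R != 0 :> R by rewrite pnatr_eq0.
  apply: (mulfI n0); rewrite mulrBr -h NE -natr1; field.
  by rewrite -natr1 in n0.
have C0 : cosint N 0 != 0 by rewrite cosint_z0 -normc_gt0 normc_real normr_gt0 gt_eqF.
have -> : cosint N z / cosint N 0 - 1 = (cosint N z - cosint N 0) / cosint N 0.
  by field.
rewrite normcM normcV [X in _ / normc X]cosint_z0 normc_real gtr0_norm// ler_pdivrMr//.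
rewrite (le_trans bd)// IG rec.
rewrite le_eqVlt; apply/orP; left; apply/eqP.
by ring.
Qed.


Let near1 (u : nat -> R[i]) :=
  forall e, 0 < e -> exists N, forall n, (N <= n)%N -> normc (u n - 1) <= e.

Let near1M (u v : nat -> R[i]) : near1 u -> near1 v -> near1 (fun n => u n * v n).
Proof.
move=> hu hv e e0; pose d := Num.min 1 (e / 3).
have d0 : 0 < d by rewrite /d lt_min ltr01 divr_gt0.
have d1 : d <= 1 by rewrite /d ge_min lexx.
have d2 : d <= e / 3 by rewrite /d ge_min lexx orbT.
have [N1 h1] := hu d d0; have [N2 h2] := hv d d0.
exists (maxn N1 N2) => n; rewrite geq_max => /andP[/h1 u1 /h2 v1].
have -> : u n * v n - 1 = (u n - 1) * (v n - 1) + ((u n - 1) + (v n - 1)) by ring.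
rewrite (le_trans (le_normcD _ _))// normcM.
have t := le_normcD (u n - 1) (v n - 1).
have p : normc (u n - 1) * normc (v n - 1) <= 1 * d.
  by rewrite ler_pM ?normc_ge0// (le_trans u1).
by lra.
Qed.

Let near1_bound (u : nat -> R[i]) K c m : 0 <= K -> 0 <= c ->
  (forall n e, (m <= n)%N -> 0 < e -> normc (u n - 1) <= K * (e + c / (n%:R * e))) ->
  near1 u.
Proof.
move=> K0 c0 h e e0; pose d := e / (2 * K + 1).
have k1 : 0 < 2 * K + 1 by lra.
have d0 : 0 < d by rewrite divr_gt0.
exists (maxn m (Num.truncn (c / d ^+ 2)).+1) => n; rewrite geq_max => /andP[mn tn].
apply: (le_trans (h n d mn d0)).
have n0 : 0 < n%:R :> R by rewrite ltr0n (leq_trans _ tn).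
have : c / (n%:R * d) <= d.
  have : c / d ^+ 2 <= n%:R by rewrite (le_trans (ltW (truncnS_gt _)))// ler_nat.
  rewrite ler_pdivrMr; last by rewrite exprn_gt0.
  move=> cd; rewrite (ler_pdivrMr _ _ (mulr_gt0 n0 d0)).
  by rewrite (le_trans cd)// le_eqVlt; apply/orP; left; apply/eqP; ring.
move=> /(lerD (lexx d))/(ler_wpM2l K0)/le_trans; apply.
have de : d * (2 * K + 1) = e by rewrite /d mulfVK ?gt_eqF.
by rewrite -de; move: (ltW d0) => d00; clear -K0 d00; nra.
Qed.

Let cGamma_rising z n : -1 < Re z ->
  cGamma (n.+1%:R + z) = \prod_(k < n) (k.+1%:R + z) * cGamma (1 + z).
Proof.
move=> z1; elim: n => [|n IH]; first by rewrite big_ord0 mul1r.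
rewrite big_ord_recr/= mulrAC -IH -natr1 addrAC cGammaS 1?mulrC//.
by rewrite Re_add Re_nat -natr1; have := ler0n R n; lra.
Qed.

Let gauss_near1 z : `|Re z| < 1 ->
  near1 (fun n => cGamma (n.+1%:R + z) * cpow n%:R (- z) / n`!%:R).
Proof.
move=> z1; apply: (@near1_bound _ (2 * normc z) 6 2); rewrite ?mulr_ge0 ?normc_ge0//.
by move=> n e n2 e0; exact: gauss_limit_bound.
Qed.

Let near1_neq0 u : near1 u -> exists n, u n != 0.
Proof.
move=> h; have h0 : 0 < 2^-1 :> R by rewrite invr_gt0.
have [N /(_ N (leqnn N)) hN] := h _ h0.
exists N; apply/negP => /eqP uN; move: hN.
by rewrite uN sub0r normcN normc1; lra.
Qed.

(** For [|Re w| < 1], Gauss's limit is nonzero, so [Gamma (n + 1 + w)] is nonzero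
    for some [n]; the functional equation divides it by [Gamma (1 + w)].  The same
    equation then carries the result to the whole half-plane. *)
Lemma cGamma_neq0 z : 0 < Re z -> cGamma z != 0.
Proof.
have base w : `|Re w| < 1 -> cGamma (1 + w) != 0.
  move=> w1; have [n] := near1_neq0 (gauss_near1 w1).
  rewrite cGamma_rising; last by move: w1; rewrite ltr_norml => /andP[].
  by apply: contraNneq => ->; rewrite mulr0 !mul0r.
have [m] : exists m, Re z < m.+1%:R by exists (Num.truncn (Re z)); exact: truncnS_gt.
elim: m z => [|m IH] z zm z0.
  rewrite -(subrKC 1 z) base// Re_sub ltr_norml/=; move: zm; lra.
have [z2|z2] := ltP (Re z) 2.
  rewrite -(subrKC 1 z) base// Re_sub ltr_norml/=; move: zm; lra.
have r : Re (z - 1) = Re z - 1 by rewrite Re_sub.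
rewrite -[z](subrK 1) cGammaS; last by rewrite r; lra.
rewrite mulf_neq0//; last by apply: IH; rewrite r -?natr1 in zm *; lra.
by apply/negP => /eqP h; move: r; rewrite h/=; lra.
Qed.

(** Up to factors that tend to [1], the product of the two Gamma values is the
    inverse of the partial product of the [1 - z^2 / k^2], by Gauss's limit at [z]
    and [- z], while [sin (pi z) / (pi z)] is that partial product.  Hence the
    left side, which does not depend on [n], tends to [1]. *)
Lemma cGamma_reflection z : z != 0 -> `|Re z| < 1 ->
  cGamma (1 + z) * cGamma (1 - z) * (csin (pi%:C * z) / (pi%:C * z)) = 1.
Proof.
move=> z0 z1; have Nz1 : `|Re (- z)| < 1 by rewrite Re_opp normrN.
have [z2 z3] : -1 < Re z /\ -1 < Re (- z).
  by move: z1; rewrite ltr_norml Re_opp => /andP[]; split; lra.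
pose w n := cosint n.*2 (2%:R * z) / cosint n.*2 0.
have cn n : cosint n.*2 0 != 0.
  by rewrite cosint_z0 -normc_gt0 normc_real normr_gt0 gt_eqF ?rcosint_gt0.
have wS n : (n.+1%:R ^+ 2 - z ^+ 2) * w n.+1 = n.+1%:R ^+ 2 * w n.
  have h1 := cosintSS n.*2 (2%:R * z); have h2 := cosintSS n.*2 0.
  rewrite -doubleS -muln2 natrM expr0n subr0 in h1 h2.
  have n1 : n.+1%:R != 0 :> R[i] by rewrite pnatr_eq0.
  have t1 : n.*2.+1%:R != 0 :> R[i] by rewrite pnatr_eq0.
  have t2 : 2%:R != 0 :> R[i] by rewrite pnatr_eq0.
  rewrite muln2 in h1 h2.
  have e1 : (n.+1%:R ^+ 2 - z ^+ 2) * cosint n.+1.*2 (2%:R * z) =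
      n.+1%:R * n.*2.+1%:R / 2%:R * cosint n.*2 (2%:R * z).
    apply: (mulfI (mulf_neq0 t2 t2)).
    transitivity (n.+1%:R * 2%:R * n.*2.+1%:R * cosint n.*2 (2%:R * z)); last by field.
    by rewrite -h1; ring.
  have e2 : n.+1%:R ^+ 2 * cosint n.+1.*2 0 = n.+1%:R * n.*2.+1%:R / 2%:R * cosint n.*2 0.
    apply: (mulfI (mulf_neq0 t2 t2)).
    transitivity (n.+1%:R * 2%:R * n.*2.+1%:R * cosint n.*2 0); last by field.
    by rewrite -h2; ring.
  have d0 : n.+1%:R * n.*2.+1%:R / 2%:R != 0 :> R[i] by rewrite !mulf_neq0 ?invr_eq0.
  transitivity ((n.+1%:R ^+ 2 - z ^+ 2) * cosint n.+1.*2 (2%:R * z) / cosint n.+1.*2 0).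
    exact: mulrA.
  rewrite e1 /w; apply: (mulIf (cn n.+1)); rewrite mulfVK//.
  rewrite [RHS]mulrAC e2; move: (cn n); move: (cosint n.*2 0) => c c0.
  by field.
have w1 : near1 w.
  have [K K0 h] := cosint_concentration (2%:R * z).
  apply: (@near1_bound _ K 1 1) => // -[//|n] e _ e0.
  apply: (le_trans (h n e e0)); rewrite ler_wpM2l// lerD2l.
  rewrite invfM mul1r mulrC ler_wpM2r ?invr_ge0 ?(ltW e0)//.
  by rewrite lef_pV2 ?posrE ?ltr0n// ler_nat ltnS -addnn leq_addr.
have w0 : w 0 = csin (pi%:C * z) / (pi%:C * z).
  rewrite /w double0 cosint0// cosint_z0 rcosint0 [pi%:C * z]mulrC.
  by rewrite -mulrA -invfM.
have wn n : \prod_(k < n) (k.+1%:R ^+ 2 - z ^+ 2) / n`!%:R ^+ 2 * w n = w 0.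
  elim: n => [|n <-]; first by rewrite big_ord0 expr1n divr1 mul1r.
  rewrite big_ord_recr/= factS natrM exprMn.
  have f0 : n`!%:R != 0 :> R[i] by rewrite pnatr_eq0 -lt0n fact_gt0.
  have n1 : n.+1%:R != 0 :> R[i] by rewrite pnatr_eq0.
  move: (wS n) n1 f0; move: (w n) (w n.+1) (n.+1%:R : R[i]) (n`!%:R : R[i]) (\prod_(k < n) _).
  move=> a b c f P Hab c0 f0.
  transitivity (P / f ^+ 2 / c ^+ 2 * ((c ^+ 2 - z ^+ 2) * b)); first by field; rewrite c0 f0.
  by rewrite Hab; field; rewrite c0 f0.
have h := near1M (near1M (gauss_near1 z1) (gauss_near1 Nz1)) w1.
set C := LHS; have C1 : near1 (fun=> C).
  move=> e /h[N hN]; exists N => n /hN; congr (normc (_ - 1) <= e).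
  rewrite !cGamma_rising// /C -w0 -(wn n) !cpowN.
  have -> : \prod_(k < n) (k.+1%:R ^+ 2 - z ^+ 2) =
     \prod_(k < n) (k.+1%:R + z) * \prod_(k < n) (k.+1%:R - z).
    by rewrite -big_split; apply: eq_bigr => k _ /=; ring.
  have f0 : n`!%:R != 0 :> R[i] by rewrite pnatr_eq0 -lt0n fact_gt0.
  by have c0 := cpow_neq0 n%:R z; field; rewrite f0 c0.
apply/eqP; rewrite -subr_eq0 -normc_eq0 eq_le normc_ge0 andbT.
apply/ler_addgt0Pr => e /C1[N /(_ N (leqnn N))]; by rewrite add0r.
Qed.

End sine_product.

(** * Small shift asymptotics of the confluent integrals *)

Section kint_asymptotics.
Context {R : realType}.
Local Notation mu := (@lebesgue_measure R).
Implicit Types (m b c z : R[i]) (s t u K : R).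

Let kfun_dom m b : -1 < Re m -> -1 < Re (m + b) ->
  exists2 g : R -> R, mu.-integrable `]0, +oo[ (EFin \o g) &
  forall s u, 0 < s < 1 -> 0 < u -> normc (kfun m b s 1 u) <= g u.
Proof.
move=> m1 mb1; rewrite Re_add in mb1.
have [g ig hg] := @kfun_dominated R (Re m) (Re b) 1 1 1 m1 ltr01 (lexx 1) ltr01.
have ip := @integrable_powR_expR R _ 1 mb1 ltr01.
exists (fun u => u `^ (Re m + Re b) * expR (- (1 * u)) + g u).
  exact: (integrableD (@measurable_itv0y R) ip ig).
move=> s u /andP[s0 s1] u0; rewrite normc_kfun//.
have := hg 1 u 1; rewrite lexx => /(_ isT isT u0) gu.
have E0 := expR_ge0 (- (1 * u)); have p0 := powR_ge0 u (Re m).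
have [b0|b0] := leP 0 (Re b).
  have h : (u + s) `^ Re b <= (u + 1) `^ Re b.
    by apply: ge0_ler_powR => //; rewrite ?nnegrE; lra.
  apply: ler_wpDl; first by rewrite mulr_ge0 ?powR_ge0.
  by apply: le_trans gu; rewrite ler_wpM2r// ler_wpM2l.
have h : (u + s) `^ Re b <= u `^ Re b.
  have [q q0 ->] : exists2 q, 0 <= q & Re b = - q.
    by exists (- Re b); [rewrite oppr_ge0 ltW|rewrite opprK].
  rewrite !powRN lef_pV2 ?posrE ?powR_gt0 ?addr_gt0//.
  by apply: ge0_ler_powR => //; rewrite ?nnegrE; lra.
apply: ler_wpDr; first by apply: le_trans gu; rewrite !mulr_ge0 ?powR_ge0.
by rewrite powRDr// ler_wpM2r// ler_wpM2l.
Qed.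

(** As the shift tends to [0] the two powers merge into one. *)
Lemma kint_ctends0 m b : -1 < Re m -> -1 < Re (m + b) ->
  ctends0 (fun s => kint m b s 1) (cGamma (m + b + 1)).
Proof.
move=> m1 mb1; have [g ig hg] := kfun_dom m1 mb1.
rewrite (cGammaD1 (m + b) 0) (kint_def (m + b)).
under eq_fun do rewrite kint_def.
apply: (@cintegral_ctends0 R _ _ mu `]0, +oo[ (fun s u => kfun m b s 1 u)
  (kfun (m + b) 0 0 1) g 1) => //.
- by move=> s _; exact: cmeas_kfun.
- exact: cmeas_kfun.
- move=> u; rewrite itv0yE => u0.
  have -> : kfun (m + b) 0 0 1 u = kfun m b 0 1 u.
    by rewrite /kfun cpow0 mulr1 cpowD addr0.
  have u1 : 0 < u + 0 by rewrite addr0.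
  have h := cderM (cderM (cder_cst (cpow u m) 0) (cder_cpow_shift b u1))
    (cder_cst (expR (- (1 * u)))%:C 0).
  exact: (cder_ctends0 h).
- by move=> s u s1; rewrite itv0yE => u0; exact: hg.
Qed.

(** In the scaled form it is the exponential that disappears, which needs
    convergence of the integral of the powers alone. *)
Lemma kint_scaled_ctends0 m b : -1 < Re m -> Re m + Re b < -1 ->
  ctends0 (fun s => kint m b 1 s) (kint m b 1 0).
Proof.
move=> m1 mb1; have /cintble_normc ig := cintble_kfun0 m1 mb1.
rewrite (kint_def m b 1 0); under eq_fun do rewrite kint_def.
apply: (@cintegral_ctends0 R _ _ mu `]0, +oo[ (fun s u => kfun m b 1 s u)
  (kfun m b 1 0) (fun u => normc (kfun m b 1 0 u)) 1) => //.
- by move=> s _; exact: cmeas_kfun.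
- exact: cmeas_kfun.
- move=> u _.
  have lin : is_derive (0 : R) (1 : R) (fun y : R => - (y * u) : R) (- u : R).
    have h := is_deriveN (is_deriveM (is_derive_id (0:R) (1 : R)) (is_derive_cst u (0:R) (1 : R))).
    by apply: (is_derive_eq h); rewrite /GRing.scale/= mulr0 mulr1 add0r.
  have h := cder_real (@is_derive1_comp _ expR (fun y : R => - (y * u)) 0 _ _
    (is_derive_expR (- (0 * u))) lin).
  exact: (cder_ctends0 (cderM (cder_cst (cpow u m * cpow (u + 1) b) 0) h)).
- exact: ig.
- move=> s u /andP[s0 s1]; rewrite itv0yE => u0; rewrite !normcM !normc_real.
  rewrite ler_wpM2l ?mulr_ge0 ?normc_ge0// !ger0_norm ?expR_ge0// ler_expR.
  by rewrite mul0r oppr0 oppr_le0 mulr_ge0// ltW.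
Qed.

Let kint_bound_gt m b : -1 < Re m -> -1 < Re (m + b) ->
  exists2 K, 0 <= K & forall s, 0 < s < 1 -> normc (kint m b s 1) <= K.
Proof.
move=> m1 mb1; have [g ig hg] := kfun_dom m1 mb1.
have bd s : 0 < s < 1 -> normc (kint m b s 1) <= 2 * \int[mu]_(u in `]0, +oo[) g u.
  move=> s01; rewrite kint_def; have B := normc_cintegral (m := mu) (D := `]0, +oo[)
    (g := g) (@measurable_itv0y R) (F := kfun m b s 1).
  rewrite (le_trans (B _ _ ig))//; first exact: cmeas_kfun.
  by move=> u; rewrite itv0yE => u0; exact: hg.
exists (2 * \int[mu]_(u in `]0, +oo[) g u); last by [].
by rewrite (le_trans (normc_ge0 _) (bd 2^-1 _))//; lra.
Qed.

Let kint_bound_lt m b : -1 < Re m -> Re (m + b) < -1 ->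
  exists2 K, 0 <= K & forall s, 0 < s < 1 ->
    normc (kint m b s 1) <= K * s `^ (Re (m + b) + 1).
Proof.
move=> m1 mb1; have mb2 : Re m + Re b < -1 by rewrite -Re_add.
have ig := cintble_normc (@measurable_itv0y R) (cintble_kfun0 m1 mb2).
have ig' : mu.-integrable `]0, +oo[ (EFin \o (fun u : R => normc (kfun m b 1 0 u))) by exact: ig.
pose C := 2 * \int[mu]_(u in `]0, +oo[) normc (kfun m b 1 0 u).
have bd s : 0 < s < 1 -> normc (kint m b 1 s) <= C.
  move=> s01; rewrite kint_def; have B := normc_cintegral (m := mu) (D := `]0, +oo[)
    (g := fun u => normc (kfun m b 1 0 u)) (@measurable_itv0y R) (F := kfun m b 1 s).
  rewrite (le_trans (B _ _ ig'))//; first exact: cmeas_kfun.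
  move=> u; rewrite itv0yE => u0; case/andP: s01 => s0 s1.
  rewrite !normcM !normc_real.
  rewrite ler_wpM2l ?mulr_ge0 ?normc_ge0// !ger0_norm ?expR_ge0// ler_expR.
  by rewrite mul0r oppr0 oppr_le0 mulr_ge0// ltW.
exists C; first by rewrite (le_trans (normc_ge0 _) (bd 2^-1 _))//; lra.
move=> s s01; case/andP: (s01) => s0 s1.
rewrite (kint_scale b m1 s0 ltr01) normcM normc_cpow// mulr1 mulrC.
by rewrite [Re (_ + 1)]Re_add ler_wpM2r ?powR_ge0 ?bd.
Qed.

(** When [Re (m + b) = -1] the contiguous relation expresses the integral by two
    others that are covered by absolute convergence at one end. *)
Lemma kint_bound m b : -1 < Re m -> m + b + 1 != 0 ->
  exists2 K, 0 <= K & forall s, 0 < s < 1 ->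
    normc (kint m b s 1) <= K * (1 + s `^ (Re (m + b) + 1)).
Proof.
move=> m1 mb0; have [h|h|h] := ltgtP (Re (m + b)) (-1).
- have [K K0 hK] := kint_bound_lt m1 h; exists K => // s s01.
  by rewrite (le_trans (hK s s01))// ler_wpM2l// lerDr.
- have [K K0 hK] := kint_bound_gt m1 h; exists K => // s s01.
  by rewrite (le_trans (hK s s01))// ler_peMr// lerDl powR_ge0.
have m2 : -1 < Re (m + 1) by rewrite Re_add/=; lra.
have h1 : Re (m + (b - 1)) < -1 by move: h; rewrite !Re_add Re_opp/=; lra.
have h2 : -1 < Re (m + 1 + b) by move: h; rewrite !Re_add/=; lra.
have [K1 K10 hK1] := kint_bound_lt m1 h1; have [K2 K20 hK2] := kint_bound_gt m2 h2.
exists (normc (m + b + 1)^-1 * (normc b * K1 + K2)).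
  by rewrite mulr_ge0 ?normc_ge0// addr_ge0// mulr_ge0 ?normc_ge0.
move=> s s01; case/andP: (s01) => s0 s1.
have -> : kint m b s 1 = (m + b + 1)^-1 * (b * s%:C * kint m (b - 1) s 1 + kint (m + 1) b s 1).
  by rewrite kint_contiguous// subrK mulKf.
rewrite h addNr powRr0 normcM -[leRHS]mulrA ler_wpM2l ?normc_ge0//.
rewrite (le_trans (le_normcD _ _))//.
have a1 : normc (b * s%:C * kint m (b - 1) s 1) <= normc b * K1.
  rewrite !normcM normc_real gtr0_norm// -mulrA ler_wpM2l ?normc_ge0//.
  have := hK1 s s01; rewrite (_ : Re (m + (b - 1)) + 1 = -1); last first.
    by move: h; rewrite !Re_add Re_opp/=; lra.
  move=> /(ler_wpM2l (ltW s0))/le_trans; apply.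
  by rewrite powR_inv1 ?(ltW s0)// mulrCA divff ?mulr1// gt_eqF.
have a2 := hK2 s s01.
have t : 0 <= normc b * K1 by rewrite mulr_ge0 ?normc_ge0.
by lra.
Qed.

Let powR_cvg0 (p : R) : 0 < p -> s `^ p @[s --> 0^'+] --> (0 : R).
Proof.
move=> p0; apply/cvgrPdist_le => e e0; near=> s.
have s0 : 0 < s by near: s; exact: nbhs_right_gt.
rewrite sub0r normrN ger0_norm ?powR_ge0//.
have -> : e = (e `^ p^-1) `^ p by rewrite -powRrM mulVf ?gt_eqF// powRr1// ltW.
apply: ge0_ler_powR; rewrite ?nnegrE ?powR_ge0 ?ltW//.
near: s; apply: nbhs_right_lt; exact: powR_gt0.
Unshelve. all: by end_near. Qed.

Let is_derive_spow (p q K : R) s : 0 < s -> p != 0 -> q != 0 ->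
  is_derive s (1 : R) (fun x : R => K * (x `^ p / p + x `^ q / q) : R)
   (K * (s `^ (p - 1) + s `^ (q - 1)) : R).
Proof.
move=> s0 p0 q0.
have hp := is_deriveM (@is_derive_powR R p s s0) (is_derive_cst p^-1 s (1 : R)).
have hq := is_deriveM (@is_derive_powR R q s s0) (is_derive_cst q^-1 s (1 : R)).
have h := is_deriveZ K (is_deriveD hp hq).
apply: (is_derive_eq h); rewrite /GRing.scale/=; field.
by rewrite p0 q0.
Qed.

Lemma power_bound_integrate (f f' : R -> R[i]) (p q K : R) : 0 < p -> 0 < q ->
  0 <= K -> (forall s, 0 < s < 1 -> cder f s (f' s)) -> ctends0 f 0 ->
  (forall s, 0 < s < 1 -> normc (f' s) <= K * (s `^ (p - 1) + s `^ (q - 1))) ->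
  forall s, 0 < s < 1 -> normc (f s) <= (2 * K * (p^-1 + q^-1)) * (s `^ p + s `^ q).
Proof.
move=> p0 q0 K0 df f0 fb s s01.
have H : K * (x `^ p / p + x `^ q / q) @[x --> 0^'+] --> (0 : R).
  have : K * (x `^ p / p + x `^ q / q) @[x --> 0^'+] --> K * (0 / p + 0 / q).
    apply: cvgM; first exact: cvg_cst.
    by apply: cvgD; apply: cvgM; [exact: powR_cvg0|exact: cvg_cst|exact: powR_cvg0|exact: cvg_cst].
  by rewrite !mul0r addr0 mulr0.
have := @cder_compare0 R f f' (fun x => K * (x `^ p / p + x `^ q / q))
   (fun x => K * (x `^ (p - 1) + x `^ (q - 1))) 1 df _ fb f0 H s s01.
have dg (x : R) : 0 < x < 1 -> is_derive x (1 : R) (fun x : R => K * (x `^ p / p + x `^ q / q) : R)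
   (K * (x `^ (p - 1) + x `^ (q - 1)) : R).
  by move=> /andP[x0 _]; apply: is_derive_spow => //; rewrite gt_eqF.
move=> /(_ dg)/le_trans; apply; rewrite -!mulrA ler_wpM2l// ler_wpM2l//.
have ip : 0 <= p^-1 by rewrite invr_ge0 ltW.
have iq : 0 <= q^-1 by rewrite invr_ge0 ltW.
have sp := powR_ge0 s p; have sq := powR_ge0 s q.
by nra.
Qed.

(** The derivative is [b * kint m (b - 1) s 1], of order [1 + s^(Re (m + b))] by
    [kint_bound]. *)
Lemma kint_expansion0 m b : -1 < Re m -> -1 < Re (m + b) -> m + b != 0 ->
  exists2 K, 0 <= K & forall s, 0 < s < 1 ->
    normc (kint m b s 1 - cGamma (m + b + 1)) <= K * (s + s `^ (Re (m + b) + 1)).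
Proof.
move=> m1 mb1 mb0.
have h : m + (b - 1) + 1 != 0 by rewrite addrA subrK.
have [K K0 hK] := kint_bound m1 h.
have q0 : 0 < Re (m + b) + 1 by lra.
exists (2 * (normc b * K) * (1^-1 + (Re (m + b) + 1)^-1)).
  rewrite mulr_ge0 ?mulr_ge0 ?normc_ge0// addr_ge0// ?invr_ge0 ?ltW//.
move=> s s01; have := @power_bound_integrate
  (fun s => kint m b s 1 - cGamma (m + b + 1)) (fun s => b * kint m (b - 1) s 1)
  1 (Re (m + b) + 1) (normc b * K) ltr01 q0 (mulr_ge0 (normc_ge0 _) K0).
move=> H; have {}H := H _ _ _ s s01.
case/andP: (s01) => s0 s1; rewrite powRr1 ?(ltW s0)// in H; apply: H.
- move=> x /andP[x0 _]; apply: cder_eq (cderB (cder_kint_shift b m1 x0 ltr01) (cder_cst _ x)) _.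
  exact: subr0.
- rewrite -(subrr (cGamma (m + b + 1))).
  exact: (ctends0B (kint_ctends0 m1 mb1) (ctends0_cst _)).
- move=> x x01; rewrite normcM -mulrA ler_wpM2l ?normc_ge0// subrr powRr0.
  by have := hK x x01; rewrite addrA Re_sub/= subrK addrK.
Qed.

(** The derivative of the remainder is [b] times the remainder of the previous
    order at [b - 1]. *)
Lemma kint_expansion1 m b : -1 < Re m -> 0 < Re (m + b) -> m + b != 1 ->
  exists2 K, 0 <= K & forall s, 0 < s < 1 ->
    normc (kint m b s 1 - cGamma (m + b + 1) - b * cGamma (m + b) * s%:C) <=
      K * (s ^+ 2 + s `^ (Re (m + b) + 1)).
Proof.
move=> m1 mb1 mb0; pose B := Re (m + b).
have r1 : Re (m + (b - 1)) = B - 1 by rewrite addrA Re_sub.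
have h1 : -1 < Re (m + (b - 1)) by rewrite r1 /B; lra.
have h2 : m + (b - 1) != 0 by rewrite addrA subr_eq0.
have [K K0 hK] := kint_expansion0 m1 h1 h2; rewrite r1 addrA !subrK in hK.
have q0 : 0 < B + 1 by rewrite /B; lra.
exists (2 * (normc b * K) * (2^-1 + (B + 1)^-1)).
  rewrite mulr_ge0 ?mulr_ge0 ?normc_ge0// addr_ge0// ?invr_ge0 ?ltW//.
move=> s s01; have := @power_bound_integrate
  (fun s => kint m b s 1 - cGamma (m + b + 1) - b * cGamma (m + b) * s%:C)
  (fun s => b * (kint m (b - 1) s 1 - cGamma (m + b)))
  2 (B + 1) (normc b * K) (@ltr0Sn R 1) q0 (mulr_ge0 (normc_ge0 _) K0).
move=> H; have {}H := H _ _ _ s s01.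
case/andP: (s01) => s0 s1; rewrite (powR_mulrn 2 (ltW s0)) in H; apply: H.
- move=> x /andP[x0 _]; apply: cder_eq (cderB (cderB (cder_kint_shift b m1 x0 ltr01)
    (cder_cst _ x)) (cderZ _ (cder_real (is_derive_id x (1 : R))))) _.
  by rewrite subr0 mulr1 mulrBr.
- have c0 : ctends0 (fun x : R => x%:C) 0 by exact: (cder_ctends0 (cder_real (is_derive_id (0 : R) (1 : R)))).
  have mb2 : -1 < Re (m + b) by lra.
  have E : cGamma (m + b + 1) - cGamma (m + b + 1) - b * cGamma (m + b) * 0 = 0.
    by rewrite subrr mulr0 subr0.
  rewrite -E; apply: ctends0B; last exact: (ctends0M (ctends0_cst _) c0).
  exact: (ctends0B (kint_ctends0 m1 mb2) (ctends0_cst _)).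
- move=> x x01; rewrite normcM -mulrA ler_wpM2l ?normc_ge0//.
  rewrite (_ : 2 - 1 = 1); last by lra.
  have := hK x x01; case/andP: x01 => x0 _.
  by rewrite powRr1 ?(ltW x0)// addrK.
Qed.

Lemma ctends0_power_bound (f : R -> R[i]) (p q K : R) : 0 < p -> 0 < q ->
  (forall s, 0 < s < 1 -> normc (f s) <= K * (s `^ p + s `^ q)) -> ctends0 f 0.
Proof.
move=> p0 q0 fb; have K0 : K * (x `^ p + x `^ q) @[x --> 0^'+] --> (0 : R).
  have : K * (x `^ p + x `^ q) @[x --> 0^'+] --> K * (0 + 0).
    by apply: cvgM; [exact: cvg_cst|apply: cvgD; exact: powR_cvg0].
  by rewrite addr0 mulr0.
apply: (@squeeze_cvgr _ _ _ _ (cst 0) _ _ _ _ _ K0); last exact: cvg_cst.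
near=> s; rewrite normc_ge0/= subr0; apply: fb; near: s.
exact: near0_itv.
Unshelve. all: by end_near. Qed.

(** For [-1 < Re (m + b) < 1] the integral defining [Gamma (m + b)] may diverge, so
    the coefficient of [s] is written as its continuation
    [Gamma (m + b + 1) / (m + b)]. *)
Definition kint_remainder m b s : R[i] := kint m b s 1 - cGamma (m + b + 1)
   - b * (cGamma (m + b + 1) / (m + b)) * s%:C.

(** Two steps of the contiguous relation bring the shift exponent down to [b - 2],
    where the scaled integral converges at [s = 0] to a beta integral. *)
Lemma kint_remainder_limit m b : -1 < Re m -> -1 < Re (m + b) < 1 -> m + b != 0 ->
  ctends0 (fun s => cpow s (- (m + b + 1)) * kint_remainder m b s)
    (b * (b - 1) / ((m + b) * (m + b + 1)) * kint m (b - 2%:R) 1 0).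
Proof.
rewrite /kint_remainder => m1 /andP[g1 g2] g0.
have m2 : -1 < Re (m + 1) by rewrite Re_add/=; lra.
have gS : m + b + 1 != 0.
  by apply/eqP => h; have := congr1 (@complex.Re R) h; rewrite Re_add/=; lra.
have e1 : m + 1 + b = m + b + 1 by rewrite addrAC.
have e0 : m + 1 + (b - 1) = m + b by ring.
have k0 : 0 < Re (m + 1 + b) by rewrite e1 Re_add/=; lra.
have k1 : m + 1 + b != 1 by rewrite e1 -subr_eq0 addrK.
have k2 : -1 < Re (m + 1 + (b - 1)) by rewrite e0.
have k3 : m + 1 + (b - 1) != 0 by rewrite e0.
have [K1 K10 hK1] := kint_expansion1 m2 k0 k1; rewrite e1 in hK1.
have [K2 K20 hK2] := kint_expansion0 m2 k2 k3; rewrite e0 in hK2.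
have b2 : Re m + Re (b - 2%:R) < -1.
  by rewrite -Re_add addrA Re_sub Re_nat; lra.
have e2 : m + (b - 2%:R) + 1 = m + b - 1 by ring.
have e3 : m + (b - 1) + 1 = m + b by rewrite addrA subrK.
have q := kint_scaled_ctends0 m1 b2.
have GS : cGamma (m + b + 1 + 1) = (m + b + 1) * cGamma (m + b + 1).
  by rewrite cGammaS// Re_add/=; lra.
pose rho := Re (m + b) + 1.
pose E s := (b * s%:C * (kint (m + 1) (b - 1) s 1 - cGamma (m + b + 1)) / (m + b) +
    (kint (m + 1) b s 1 - cGamma (m + b + 1 + 1) - b * cGamma (m + b + 1) * s%:C))
    / (m + b + 1).
have id s : 0 < s -> cpow s (- (m + b + 1)) * (kint m b s 1 - cGamma (m + b + 1)
      - b * (cGamma (m + b + 1) / (m + b)) * s%:C) =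
    b * (b - 1) / ((m + b) * (m + b + 1)) * kint m (b - 2%:R) 1 s
      + cpow s (- (m + b + 1)) * E s.
  move=> s0; have sn0 : s%:C != 0 :> R[i] by rewrite fmorph_eq0 gt_eqF.
  have h1 := kint_contiguous b m1 s0; have h2 := kint_contiguous (b - 1) m1 s0.
  rewrite e3 (_ : b - 1 - 1 = b - 2%:R) in h2; last by ring.
  have h3 := kint_scale (b - 2%:R) m1 s0 ltr01; rewrite mulr1 e2 in h3.
  have h4 : kint m (b - 2%:R) 1 s = cpow s (- (m + b + 1)) * s%:C ^+ 2 * kint m (b - 2%:R) s 1.
    have -> : s%:C ^+ 2 = cpow s 2%:R by rewrite cpow_nat// rmorphXn.
    rewrite h3 mulrA -!cpowD (_ : _ + (m + b - 1) = 0) ?cpow0 ?mul1r//.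
    by ring.
  rewrite h4 /E GS; move: g0 gS h1 h2.
  move: (m + b) (cpow s _) (cGamma _) (kint (m + 1) (b - 1) s 1) (kint (m + 1) b s 1)
    (kint m (b - 2%:R) s 1) (kint m (b - 1) s 1) (kint m b s 1) => g P G B A Z Y X.
  move=> g0 gS h1 h2.
  have -> : X = (b * s%:C * Y + A) / (g + 1).
    by apply: (mulIf gS); rewrite mulfVK// h1 subrK mulrC.
  have -> : Y = ((b - 1) * s%:C * Z + B) / g.
    by apply: (mulIf g0); rewrite mulfVK// h2 subrK mulrC.
  by field; rewrite g0 gS.
have L : ctends0 (fun s => b * (b - 1) / ((m + b) * (m + b + 1)) * kint m (b - 2%:R) 1 s
      + cpow s (- (m + b + 1)) * E s)
    (b * (b - 1) / ((m + b) * (m + b + 1)) * kint m (b - 2%:R) 1 0).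
  rewrite -[X in ctends0 _ X]addr0; apply: ctends0D; first exact: (ctends0M (ctends0_cst _) q).
  pose C := (normc b * K2 / normc (m + b) + K1) / normc (m + b + 1).
  apply: (@ctends0_power_bound _ (2 - rho) 1 C); rewrite ?/rho//; first by lra.
  move=> s s01; case/andP: (s01) => s0 s1.
  have P : normc (cpow s (- (m + b + 1))) = s `^ (- rho).
    by rewrite normc_cpow// Re_opp Re_add.
  have H1 := hK1 s s01; have H2 := hK2 s s01.
  have r2 : Re (m + b + 1) + 1 = rho + 1 by rewrite Re_add.
  rewrite r2 in H1; rewrite -/rho in H2.
  have sr : s * s `^ rho = s `^ (rho + 1) by rewrite (powRDr rho 1 s0) powRr1 ?(ltW s0)// mulrC.
  have NE : normc (E s) <= C * (s ^+ 2 + s `^ (rho + 1)).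
    rewrite /E normcM normcV /C -[leRHS]mulrA [_^-1 * _]mulrC [leRHS]mulrA.
    rewrite ler_wpM2r ?invr_ge0 ?normc_ge0// (le_trans (le_normcD _ _))//.
    rewrite mulrDl lerD//.
    rewrite !normcM normcV normc_real gtr0_norm// -!mulrA ler_wpM2l ?normc_ge0//.
    rewrite [leRHS]mulrA [K2 / _]mulrC -[leRHS]mulrA [leLHS]mulrA [leLHS]mulrC.
    rewrite ler_wpM2l ?invr_ge0 ?normc_ge0//.
    by rewrite (le_trans (ler_wpM2l (ltW s0) H2))// mulrCA mulrDr -expr2 sr.
  rewrite normcM P (le_trans (ler_wpM2l (powR_ge0 _ _) NE))//.
  rewrite mulrCA mulrDr -powR_mulrn ?(ltW s0)// -!powRDr//.
  by rewrite addKr [- rho + _]addrC.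
apply: (ctends0_near _ L); near=> s.
by rewrite id//; near: s; exact: nbhs_right_gt.
Unshelve. all: by end_near. Qed.

(** With [g = m + b], [s^(-g-1)] times the remainder has a derivative of order
    [s^(-Re g) + 1],
    because the contiguous relation turns the Euler operator [s d/ds - (g + 1)]
    into a raising of [m]; so its limit at the origin is attained with a rate. *)
Lemma kint_expansion2 m b : -1 < Re m -> -1 < Re (m + b) < 1 -> m + b != 0 ->
  exists2 K, 0 <= K & forall s, 0 < s < 1 ->
    normc (kint_remainder m b s
      - b * (b - 1) / ((m + b) * (m + b + 1)) * kint m (b - 2%:R) 1 0 * cpow s (m + b + 1))
    <= K * (s ^+ 2 + s `^ (Re (m + b) + 2)).
Proof.
move=> m1 g12 g0; have lim := kint_remainder_limit m1 g12 g0.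
move: lim; set c := _ * kint _ _ _ _ => lim.
case/andP: (g12) => g1 g2.
have m2 : -1 < Re (m + 1) by rewrite Re_add/=; lra.
have e1 : m + 1 + b = m + b + 1 by rewrite addrAC.
have k0 : 0 < Re (m + 1 + b) by rewrite e1 Re_add/=; lra.
have k1 : m + 1 + b != 1 by rewrite e1 -subr_eq0 addrK.
have [K1 K10 hK1] := kint_expansion1 m2 k0 k1; rewrite e1 in hK1.
have GS : cGamma (m + b + 1 + 1) = (m + b + 1) * cGamma (m + b + 1).
  by rewrite cGammaS// Re_add/=; lra.
pose rho := Re (m + b) + 1; have rho2 : 0 < 2 - rho by rewrite /rho; lra.
pose z s := cpow s (- (m + b + 1)) * kint_remainder m b s - c.
pose z' s := - (cpow s (- (m + b + 1) - 1) * (kint (m + 1) b s 1 -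
  cGamma (m + b + 1 + 1) - b * cGamma (m + b + 1) * s%:C)).
have dz s : 0 < s < 1 -> cder z s (z' s).
  move=> /andP[s0 s1].
  have h := cderB (cderM (cder_cpow (- (m + b + 1)) s0) (cderB (cderB
    (cder_kint_shift b m1 s0 ltr01) (cder_cst (cGamma (m + b + 1)) s))
    (cderZ (b * (cGamma (m + b + 1) / (m + b))) (cder_real (is_derive_id s (1 : R))))))
    (cder_cst c s).
  apply: cder_eq h _; rewrite /z' GS.
  have -> : cpow s (- (m + b + 1)) = s%:C * cpow s (- (m + b + 1) - 1).
    by rewrite -cpowS// subrK.
  have h1 := kint_contiguous b m1 s0; rewrite rmorph1.
  move: g0 h1; move: (m + b) (cpow s _) (cGamma (m + b + 1)) (kint (m + 1) b s 1)
    (kint m (b - 1) s 1) (kint m b s 1) => g P G A Y X g0 h1.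
  have -> : A = (g + 1) * X - b * s%:C * Y by rewrite h1 opprB addrCA subrr addr0.
  by field.
have lz : ctends0 z 0 by rewrite -(subrr c); exact: (ctends0B lim (ctends0_cst c)).
have bz s : 0 < s < 1 -> normc (z' s) <= K1 * (s `^ (2 - rho - 1) + s `^ (1 - 1)).
  move=> s01; case/andP: (s01) => s0 s1; rewrite normcN normcM normc_cpow//.
  rewrite Re_sub Re_opp Re_add/= -/rho (le_trans (ler_wpM2l (powR_ge0 _ _) (hK1 s s01)))//.
  rewrite mulrCA mulrDr -powR_mulrn ?(ltW s0)// -!powRDr// Re_add/= -/rho.
  by rewrite le_eqVlt; apply/orP; left; apply/eqP; congr (_ * (_ `^ _ + _ `^ _)); ring.
have H := power_bound_integrate rho2 ltr01 K10 dz lz bz.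
exists (2 * K1 * ((2 - rho)^-1 + 1^-1)).
  by rewrite !mulr_ge0// addr_ge0 ?invr_ge0// ltW.
move=> s s01; case/andP: (s01) => s0 s1.
have -> : kint_remainder m b s - c * cpow s (m + b + 1) = cpow s (m + b + 1) * z s.
  by rewrite /z mulrBr mulrA -cpowD subrr cpow0 mul1r [c * _]mulrC.
have r : Re (m + b + 1) = rho by rewrite Re_add.
rewrite normcM normc_cpow// r.
move: H; set C := _ * (_ + _) => H.
rewrite (le_trans (ler_wpM2l (powR_ge0 _ _) (H s s01)))//.
rewrite mulrCA mulrDr -powR_mulrn ?(ltW s0)// -!powRDr//.
by rewrite le_eqVlt; apply/orP; left; apply/eqP; congr (_ * (_ `^ _ + _ `^ _)); rewrite /rho; ring.
Qed.

Lemma csin0 : csin (0 : R[i]) = 0.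
Proof. by rewrite /csin mul0r oppr0 subrr mul0r. Qed.

Lemma cexp_pi : cexp (pi%:C * 'i%C) = -1 :> R[i].
Proof.
Transparent cexp.
have [r i] : Re (pi%:C * 'i%C) = 0 :> R /\ Im (pi%:C * 'i%C) = pi :> R.
  by rewrite Re_mul Im_mul/= mulr0 !mul0r mulr1 subr0 addr0.
rewrite /cexp r i expR0 !mul1r cospi sinpi.
by apply: complex_eqP; rewrite ?Re_opp ?Im_opp/= ?oppr0.
Qed.
Opaque cexp.

Lemma csinDpi z : csin (z + pi%:C) = - csin z.
Proof.
rewrite /csin [(z + _) * _]mulrDl [- (_ + _)]opprD !cexpD [cexp (- (pi%:C * _))]cexpN cexp_pi invrN1 !mulrN1.
by rewrite -opprD mulNr.
Qed.

(** The reflection formula at [b], or at [b - 1] when [Re b >= 1]. *)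
Lemma cGamma_reflection_shift b : -1 < Re b < 2 ->
  cGamma (b + 1) * cGamma (2%:R - b) * csin (pi%:C * b) = pi%:C * b * (1 - b).
Proof.
move=> /andP[b1 b2].
have pi0 : pi%:C != 0 :> R[i] by rewrite fmorph_eq0 gt_eqF ?pi_gt0.
have [h|h] := ltP (Re b) 1.
  have [->|b0] := eqVneq b 0; first by rewrite mulr0 csin0 !mulr0 mul0r.
  have b3 : `|Re b| < 1 by rewrite ltr_norml b1.
  have := cGamma_reflection b0 b3; rewrite [1 + b]addrC.
  have -> : 2%:R - b = (1 - b) + 1 by ring.
  rewrite [cGamma (1 - b + 1)]cGammaS; last by rewrite Re_sub/=; lra.
  move=> /(congr1 (fun x => pi%:C * b * (1 - b) * x)); rewrite mulr1 => <-.
  move: pi%:C pi0 (csin _) => p p0 S; by field; rewrite p0 b0.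
pose c := b - 1; have -> : b = c + 1 by rewrite subrK.
have c3 : `|Re c| < 1 by rewrite Re_sub ltr_norml/=; lra.
rewrite mulrDr mulr1 csinDpi (_ : 2%:R - (c + 1) = 1 - c); last by ring.
have [->|c0] := eqVneq c 0; first by rewrite mulr0 csin0; ring.
have := cGamma_reflection c0 c3; rewrite [1 + c]addrC.
rewrite [cGamma (c + 1 + 1)]cGammaS; last by rewrite Re_add Re_sub/=; lra.
move=> /(congr1 (fun x => - (pi%:C * c * (c + 1)) * x)) H.
transitivity (- (pi%:C * c * (c + 1)) * 1); last by ring.
by rewrite -{}H; move: pi%:C pi0 (csin _) => p p0 S; field; rewrite p0 c0.
Qed.

(** The Beta integral contributes [Gamma (1 - (m + b)) / Gamma (2 - b)]; reflection
    at [m + b] and at [b] exchanges these two values for the quotient of sines. *)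
Lemma kint_limit_constant m b : -1 < Re m -> -1 < Re b -> -1 < Re (m + b) < 1 ->
  m + b != 0 ->
  b * (b - 1) / ((m + b) * (m + b + 1)) * kint m (b - 2%:R) 1 0 =
  - (cGamma (m + 1) * cGamma (b + 1) / cGamma (m + b + 2%:R) *
      (csin (pi%:C * b) / csin (pi%:C * (m + b)))).
Proof.
move=> m1 b1 /andP[g1 g2] g0.
have pi0 : pi%:C != 0 :> R[i] by rewrite fmorph_eq0 gt_eqF ?pi_gt0.
have p0 : 0 < Re (1 - (m + b)) by rewrite Re_sub/=; lra.
have q0 : 0 < Re (m + 1) by rewrite Re_add/=; lra.
have := beta_half_line p0 q0; rewrite addrK.
have -> : 1 - (m + b) + (m + 1) = 2%:R - b by ring.
rewrite opprB => beta.
have b2 : -1 < Re b < 2 by rewrite Re_add in g2; rewrite b1/=; lra.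
have R1 := cGamma_reflection_shift b2.
have g3 : `|Re (m + b)| < 1 by rewrite ltr_norml g1.
have R2 := cGamma_reflection g0 g3.
have n1 : cGamma (2%:R - b) != 0 by apply: cGamma_neq0; rewrite Re_sub Re_nat; lra.
have n2 : cGamma (m + b + 1) != 0 by apply: cGamma_neq0; rewrite Re_add/=; lra.
have sn0 : csin (pi%:C * (m + b)) != 0.
  by apply: contra_eq_neq R2 => ->; rewrite mul0r mulr0 eq_sym oner_eq0.
have gS : m + b + 1 != 0.
  by apply/eqP => h; have := congr1 (@complex.Re R) h; rewrite Re_add/=; lra.
have -> : m + b + 2%:R = m + b + 1 + 1 by ring.
rewrite [cGamma (m + b + 1 + 1)]cGammaS; last by rewrite Re_add/=; lra.
rewrite [1 + (m + b)]addrC in R2.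
move: beta R1 R2 n1 n2 sn0 g0 gS.
move: (m + b) pi%:C pi0 (csin (pi%:C * (m + b))) (csin (pi%:C * b)) (cGamma (m + b + 1))
  (cGamma (b + 1)) (cGamma (m + 1)) (cGamma (1 - (m + b))) (cGamma (2%:R - b)) (kint _ _ _ _).
move=> g p pi0 Sg Sb A B M G1 G2 X beta R1 R2 n1 n2 sn0 g0 gS.
apply: (mulIf n1); rewrite -[LHS]mulrA beta.
transitivity (b * (b - 1) / (g * (g + 1)) * M * (A * G1 * (Sg / (p * g))) * (p * g) / (A * Sg)).
  by field; rewrite ?n2 ?sn0 ?gS ?g0 ?pi0.
rewrite R2; transitivity (- (M / ((g + 1) * A * Sg)) * (p * b * (1 - b))).
  by field; rewrite ?n2 ?sn0 ?gS ?g0 ?pi0.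
by rewrite -R1; field; rewrite ?n2 ?sn0 ?gS.
Qed.

End kint_asymptotics.

(** * Two-scale expansions *)

Section two_scale.
Context {R : realType}.
Implicit Types (z c : R[i]) (s K : R) (f g : R -> R[i]) (p q : {poly R[i]}) (k l : nat).
Variable al : R[i].
Hypothesis al1 : -1 < Re al.

Definition scale s : R := s + s `^ (Re al + 1).

Definition bigh k f :=
  exists2 K, 0 <= K & forall s, 0 < s < 1 -> normc (f s) <= K * scale s ^+ k.

Lemma scale_ge0 s : 0 < s < 1 -> 0 <= scale s.
Proof. by move=> /andP[s0 _]; rewrite /scale addr_ge0 ?powR_ge0// ltW. Qed.

Lemma scale_le2 s : 0 < s < 1 -> scale s <= 2.
Proof.
move=> /andP[s0 s1]; have : s `^ (Re al + 1) <= s `^ 0.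
  by apply: ger_powR; [rewrite s0 ltW|move: al1; lra].
by rewrite powRr0 /scale; lra.
Qed.

Lemma id_le_scale s : 0 < s < 1 -> s <= scale s.
Proof. by move=> _; rewrite lerDl powR_ge0. Qed.

Lemma powR_le_scale s : 0 < s < 1 -> s `^ (Re al + 1) <= scale s.
Proof. by move=> /andP[s0 _]; rewrite lerDr ltW. Qed.

Lemma bigh_eq f g k : (forall s, 0 < s < 1 -> f s = g s) -> bigh k f -> bigh k g.
Proof. by move=> fg [K K0 hf]; exists K => // s s01; rewrite -fg// hf. Qed.

Lemma bighD k f g : bigh k f -> bigh k g -> bigh k (fun s => f s + g s).
Proof.
move=> [K K0 hf] [L L0 hg]; exists (K + L); first exact: addr_ge0.
move=> s s01; rewrite (le_trans (le_normcD _ _))// mulrDl.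
by apply: lerD; [exact: hf|exact: hg].
Qed.

Lemma bighM k l f g : bigh k f -> bigh l g -> bigh (k + l) (fun s => f s * g s).
Proof.
move=> [K K0 hf] [L L0 hg]; exists (K * L); first exact: mulr_ge0.
move=> s s01; rewrite normcM exprD mulrACA.
by apply: ler_pM; rewrite ?normc_ge0 ?hf ?hg.
Qed.

Lemma bigh_cst c : bigh 0 (fun=> c).
Proof. by exists (normc c) => [|s _]; rewrite ?normc_ge0// expr0 mulr1. Qed.

Lemma bighZ k c f : bigh k f -> bigh k (fun s => c * f s).
Proof. exact: bighM (bigh_cst c). Qed.

Lemma bighN k f : bigh k f -> bigh k (fun s => - f s).
Proof. by move=> [K K0 hf]; exists K => // s s01; rewrite normcN hf. Qed.

Lemma bighB k f g : bigh k f -> bigh k g -> bigh k (fun s => f s - g s).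
Proof. by move=> hf /bighN; exact: bighD. Qed.

Lemma bigh_weaken l k f : (l <= k)%N -> bigh k f -> bigh l f.
Proof.
move=> lk [K K0 hf]; exists (K * 2 ^+ (k - l)); first by rewrite mulr_ge0 ?exprn_ge0.
move=> s s01; rewrite (le_trans (hf s s01))// -mulrA ler_wpM2l//.
rewrite -{1}(subnK lk) exprD ler_wpM2r ?exprn_ge0 ?scale_ge0//.
by rewrite lerXn2r ?nnegrE ?scale_ge0 ?scale_le2.
Qed.

Lemma bigh_id : bigh 1 (fun s => s%:C).
Proof.
exists 1 => // s s01; rewrite normc_real mul1r expr1 gtr0_norm.
  exact: id_le_scale.
by case/andP: s01.
Qed.

Lemma bigh_cpow : bigh 1 (fun s => cpow s (al + 1)).
Proof.
exists 1 => // s s01; rewrite normc_cpow; last by case/andP: s01.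
by rewrite Re_add mul1r expr1 powR_le_scale.
Qed.

Lemma bigh2_powR f (r K : R) : 0 <= K ->
  (forall s, 0 < s < 1 -> s `^ r <= scale s ^+ 2) ->
  (forall s, 0 < s < 1 -> normc (f s) <= K * (s ^+ 2 + s `^ r)) -> bigh 2 f.
Proof.
move=> K0 hr hf; exists (K * 2); first by rewrite mulr_ge0.
move=> s s01; rewrite (le_trans (hf s s01))// -mulrA ler_wpM2l//.
have : s ^+ 2 <= scale s ^+ 2.
  rewrite lerXn2r ?nnegrE ?scale_ge0 ?id_le_scale//.
  by case/andP: s01 => /ltW.
by have := hr s s01; lra.
Qed.

Lemma powR_le_scale2 s (r : R) : 0 < s < 1 -> 2 <= r \/ Re al + 2 <= r ->
  s `^ r <= scale s ^+ 2.
Proof.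
move=> s01 hr; case/andP: (s01) => s0 s1; have h0 := scale_ge0 s01.
have h1 := id_le_scale s01; have h2 := powR_le_scale s01.
rewrite expr2; case: hr => hr.
  apply: (@le_trans _ _ (s * s)); last by rewrite ler_pM ?(ltW s0).
  rewrite -expr2 -(powR_mulrn 2 (ltW s0)); apply: ger_powR => //.
  by rewrite s0 ltW.
apply: (@le_trans _ _ (s * s `^ (Re al + 1))); last by rewrite ler_pM ?(ltW s0) ?powR_ge0.
rewrite -powRS// -addrA (_ : 1 + 1 = 2 :> R)//; apply: ger_powR => //.
by rewrite s0 ltW.
Qed.

(** [f = p_0 + p_1 s + q_1 s^(al+1)] up to the square of the scale, and the Euler
    derivative [s f'] has the expansion obtained term by term.  The coefficients
    are stored in two polynomials with the same constant term because truncated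
    multiplication of such expansions is then multiplication of polynomials
    modulo ['X^2] in each of them. *)
Definition two_scale f p q := [/\ p`_0 = q`_0,
  bigh 2 (fun s => f s - (p`_0 + p`_1 * s%:C + q`_1 * cpow s (al + 1))) &
  exists2 f', (forall s, 0 < s < 1 -> cder f s (f' s)) &
    bigh 2 (fun s => s%:C * f' s -
      (p`_1 * s%:C + (al + 1) * q`_1 * cpow s (al + 1)))].

Lemma two_scale_coef f p q p' q' : p`_0 = p'`_0 -> p`_1 = p'`_1 ->
  q`_0 = q'`_0 -> q`_1 = q'`_1 -> two_scale f p q -> two_scale f p' q'.
Proof. by rewrite /two_scale => -> -> -> ->. Qed.

Lemma two_scale_cst c : two_scale (fun=> c) c%:P c%:P.
Proof.
have h : bigh 2 (fun=> 0) by exists 0 => // s _; rewrite normc0 mul0r.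
split; rewrite ?coefC//=.
  by apply: bigh_eq h => s _; rewrite !mul0r !addr0 subrr.
exists (fun=> 0); first by move=> s _; exact: cder_cst.
by apply: bigh_eq h => s _; rewrite !mulr0 !mul0r addr0 subrr.
Qed.

Lemma two_scaleD f g p q r t : two_scale f p q -> two_scale g r t ->
  two_scale (fun s => f s + g s) (p + r) (q + t).
Proof.
move=> [pq ef [f' df ef']] [rt eg [g' dg eg']]; split; rewrite ?coefD ?pq ?rt//.
  by apply: bigh_eq (bighD ef eg) => s _; rewrite -pq -rt; ring.
exists (fun s => f' s + g' s); first by move=> s s01; apply: cderD; [exact: df|exact: dg].
by apply: bigh_eq (bighD ef' eg') => s _; ring.
Qed.

Let coef1M p q : (p * q)`_1 = p`_0 * q`_1 + p`_1 * q`_0.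
Proof. by rewrite coefM big_ord_recr big_ord1. Qed.

(** Products of two first-order remainders are of second order.  By the Leibniz
    rule the Euler derivative of a product has the same shape as the product, and
    is treated alike. *)
Lemma two_scaleM f g p q r t : two_scale f p q -> two_scale g r t ->
  two_scale (fun s => f s * g s) (p * r) (q * t).
Proof.
have first_order u (a b c : R[i]) :
    bigh 2 (fun s => u s - (a + b * s%:C + c * cpow s (al + 1))) ->
    bigh 1 (fun s => u s - a).
  move=> h2; have h := @bigh_weaken 1 2 _ isT h2.
  by apply: bigh_eq (bighD h (bighD (bighZ b bigh_id) (bighZ c bigh_cpow))) => s _; ring.
have first_order' u (b c : R[i]) :
    bigh 2 (fun s => u s - (b * s%:C + c * cpow s (al + 1))) -> bigh 1 u.
  move=> h2; have h := @bigh_weaken 1 2 _ isT h2.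
  by apply: bigh_eq (bighD h (bighD (bighZ b bigh_id) (bighZ c bigh_cpow))) => s _; ring.
move=> [pq ef [f' df ef']] [rt eg [g' dg eg']].
have f1 := first_order _ _ _ _ ef; have g1 := first_order _ _ _ _ eg.
have f2 := first_order' _ _ _ ef'; have g2 := first_order' _ _ _ eg'.
split; rewrite ?coef0M ?coef1M ?pq ?rt//.
  rewrite pq in ef f1; rewrite rt in eg g1.
  apply: bigh_eq (bighD (bighM f1 g1) (bighD (bighZ q`_0 eg) (bighZ t`_0 ef))) => s _.
  by ring.
exists (fun s => f s * g' s + f' s * g s).
  by move=> s s01; apply: cderM; [exact: df|exact: dg].
rewrite pq in f1; rewrite rt in g1.
apply: bigh_eq (bighD (bighD (bighM f1 g2) (bighM g1 f2))
  (bighD (bighZ q`_0 eg') (bighZ t`_0 ef'))) => s _.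
by ring.
Qed.

Lemma two_scale_sum I (r : seq I) (f : I -> R -> R[i]) (p q : I -> {poly R[i]}) :
  (forall i, two_scale (f i) (p i) (q i)) ->
  two_scale (fun s => \sum_(i <- r) f i s) (\sum_(i <- r) p i) (\sum_(i <- r) q i).
Proof.
move=> h; elim: r => [|i r IH].
  by rewrite !big_nil (_ : (fun s => _) = fun=> 0); [exact: (two_scale_cst 0)|apply/funext => s; rewrite big_nil].
rewrite !big_cons (_ : (fun s => _) = fun s => f i s + \sum_(i <- r) f i s).
  exact: two_scaleD.
by apply/funext => s; rewrite big_cons.
Qed.

Lemma two_scale_prod I (r : seq I) (f : I -> R -> R[i]) (p q : I -> {poly R[i]}) :
  (forall i, two_scale (f i) (p i) (q i)) ->
  two_scale (fun s => \prod_(i <- r) f i s) (\prod_(i <- r) p i) (\prod_(i <- r) q i).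
Proof.
move=> h; elim: r => [|i r IH].
  by rewrite !big_nil (_ : (fun s => _) = fun=> 1); [exact: (two_scale_cst 1)|apply/funext => s; rewrite big_nil].
rewrite !big_cons (_ : (fun s => _) = fun s => f i s * \prod_(i <- r) f i s).
  exact: two_scaleM.
by apply/funext => s; rewrite big_cons.
Qed.

Lemma two_scale_det n (f : 'I_n -> 'I_n -> R -> R[i]) (p q : 'M[{poly R[i]}]_n) :
  (forall i j, two_scale (f i j) (p i j) (q i j)) ->
  two_scale (fun s => \det (\matrix_(i, j) f i j s)) (\det p) (\det q).
Proof.
move=> h; rewrite (_ : (fun s => _) = fun s => \sum_(w : {perm 'I_n}) ((-1) ^+ w * \prod_i f i (w i) s)).
  apply: two_scale_sum => w; apply: two_scaleM; last exact: two_scale_prod.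
  by apply: two_scale_coef (two_scale_cst ((-1) ^+ w)); rewrite -?polyCN -?polyC_exp.
apply/funext => s; rewrite /determinant; apply: eq_bigr => w _.
by congr (_ * _); apply: eq_bigr => i _; rewrite mxE.
Qed.

(** For [Re al >= 1] the power [s^(al+1)] lies within the error, so its coefficient
    is arbitrary: the expansion can be given one uniform shape. *)
Lemma two_scale_free f p q q' : 1 <= Re al -> q`_0 = q'`_0 ->
  two_scale f p q -> two_scale f p q'.
Proof.
move=> al2 qq [pq ef [f' df ef']].
have h : bigh 2 (fun s => cpow s (al + 1)).
  exists 1 => // s s01; rewrite normc_cpow; last by case/andP: s01.
  by rewrite Re_add/= mul1r; apply: powR_le_scale2 => //; left; lra.
split; first by rewrite pq qq.
  by apply: bigh_eq (bighD ef (bighZ (q`_1 - q'`_1) h)) => s _; ring.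
exists f' => //.
by apply: bigh_eq (bighD ef' (bighZ ((al + 1) * (q`_1 - q'`_1)) h)) => s _; ring.
Qed.

Lemma two_scale_expR : two_scale (fun s => (expR (- s))%:C) (1 - 'X) 1.
Proof.
have bd s : 0 < s < 1 -> 1 - s <= expR (- s) <= 1 - s + s ^+ 2.
  move=> /andP[s0 s1]; rewrite expR_ge1Dx/= expRN.
  have e1 := expR_ge1Dx s; have e0 := expR_gt0 s.
  rewrite -[leLHS]mul1r ler_pdivrMr// [leRHS]mulrC.
  have : (1 + s) * (1 - s + s ^+ 2) <= expR s * (1 - s + s ^+ 2).
    by rewrite ler_wpM2r//; nra.
  have : 1 <= (1 + s) * (1 - s + s ^+ 2).
    rewrite (_ : _ * _ = 1 + s ^+ 3); last by ring.
    by rewrite lerDl exprn_ge0// ltW.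
  by lra.
have sc s : 0 < s < 1 -> s ^+ 2 <= scale s ^+ 2.
  move=> s01; rewrite lerXn2r ?nnegrE ?scale_ge0 ?id_le_scale//.
  by case/andP: s01 => /ltW.
split; rewrite ?coefB ?coef1 ?coefX ?subr0//=.
  exists 1 => // s s01; rewrite mul1r; apply: le_trans (sc s s01).
  rewrite (_ : _ - _ = (expR (- s) - (1 - s))%:C).
    rewrite normc_real ler_norml; have /andP[b1 b2] := bd s s01.
    by apply/andP; split; lra.
  by rewrite !rmorphB rmorph1; ring.
exists (fun s => (- expR (- s))%:C).
  move=> s _; apply: cder_real.
  have lin : is_derive s (1 : R) (fun y : R => - y : R) (- 1 : R).
    exact: (is_deriveN (is_derive_id s (1 : R))).
  have h := @is_derive1_comp _ expR (fun y : R => - y) s _ _ (is_derive_expR (- s)) lin.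
  by apply: (is_derive_eq h); rewrite mulrN1.
exists 1 => // s s01; rewrite mul1r; apply: le_trans (sc s s01).
rewrite (_ : _ - _ = (s * (1 - expR (- s)))%:C).
  rewrite normc_real; have /andP[b1 b2] := bd s s01; case/andP: s01 => s0 s1.
  by rewrite ler_norml; apply/andP; split; nra.
by rewrite rmorphN rmorphM rmorphB rmorph1; ring.
Qed.

End two_scale.

(** * The moments of the weight *)

Section moments.
Context {R : realType}.
Implicit Types (z c m b : R[i]) (s K : R) (n : nat).

Definition jet c0 c1 : {poly R[i]} := Poly [:: c0; c1].

Lemma coef0_jet c0 c1 : (jet c0 c1)`_0 = c0. Proof. by rewrite coef_Poly. Qed.
Lemma coef1_jet c0 c1 : (jet c0 c1)`_1 = c1. Proof. by rewrite coef_Poly. Qed.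

Opaque jet.

(** The hypothesis on [Re (m + b) + 1], the exponent of the singular power of this
    integral, places that power within the square of the scale. *)
Lemma two_scale_kint_regular al m b : -1 < Re al -> -1 < Re m -> 0 < Re (m + b) ->
  m + b != 1 -> 2 <= Re (m + b) + 1 \/ Re al + 2 <= Re (m + b) + 1 ->
  two_scale al (fun s => kint m b s 1)
    (jet (cGamma (m + b + 1)) (b * cGamma (m + b))) (jet (cGamma (m + b + 1)) 0).
Proof.
move=> al1 m1 mb0 mb1 hr.
have hs s : 0 < s < 1 -> s `^ (Re (m + b) + 1) <= scale al s ^+ 2.
  by move=> s01; exact: powR_le_scale2.
split; rewrite ?coef0_jet ?coef1_jet//.
  have [K K0 hK] := kint_expansion1 m1 mb0 mb1.
  apply: (bigh2_powR K0 hs) => s s01.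
  by rewrite mul0r addr0 opprD addrA hK.
exists (fun s => b * kint m (b - 1) s 1).
  by move=> s /andP[s0 _]; exact: cder_kint_shift.
have r1 : Re (m + (b - 1)) = Re (m + b) - 1 by rewrite addrA Re_sub.
have h1 : -1 < Re (m + (b - 1)) by rewrite r1; lra.
have h2 : m + (b - 1) != 0 by rewrite addrA subr_eq0.
have [K K0 hK] := kint_expansion0 m1 h1 h2; rewrite r1 addrA !subrK in hK.
apply: (bigh2_powR (mulr_ge0 (normc_ge0 b) K0) hs) => s s01.
case/andP: (s01) => s0 s1.
have -> : s%:C * (b * kint m (b - 1) s 1) - (b * cGamma (m + b) * s%:C +
    (al + 1) * 0 * cpow s (al + 1)) = b * (s%:C * (kint m (b - 1) s 1 - cGamma (m + b))).
  by ring.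
rewrite !normcM normc_real gtr0_norm// -mulrA ler_wpM2l ?normc_ge0//.
rewrite (le_trans (ler_wpM2l (ltW s0) (hK s s01)))// powRS//.
by rewrite mulrCA mulrDr -expr2.
Qed.

(** Here the singular power is [s^(al+1)] itself.  The contiguous relation expresses
    the Euler derivative by the integral and by [kint (m + 1) b s 1], whose own
    singular power is negligible. *)
Lemma two_scale_kint_singular m b : -1 < Re m -> -1 < Re b -> -1 < Re (m + b) < 1 ->
  m + b != 0 ->
  two_scale (m + b) (fun s => kint m b s 1)
    (jet (cGamma (m + b + 1)) (b * (cGamma (m + b + 1) / (m + b))))
    (jet (cGamma (m + b + 1)) (- (cGamma (m + 1) * cGamma (b + 1) / cGamma (m + b + 2%:R) *
      (csin (pi%:C * b) / csin (pi%:C * (m + b)))))).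
Proof.
move=> m1 b1 g12 g0; case/andP: (g12) => g1 g2.
have [K K0 hK] := kint_expansion2 m1 g12 g0; rewrite kint_limit_constant// in hK.
move: hK; set c := - _ => hK; rewrite /kint_remainder in hK.
have m2 : -1 < Re (m + 1) by rewrite Re_add/=; lra.
have e1 : m + 1 + b = m + b + 1 by rewrite addrAC.
have k0 : 0 < Re (m + 1 + b) by rewrite e1 Re_add/=; lra.
have k1 : m + 1 + b != 1 by rewrite e1 -subr_eq0 addrK.
have [K1 K10 hK1] := kint_expansion1 m2 k0 k1; rewrite e1 in hK1.
have hs s (r : R) : 0 < s < 1 -> r = Re (m + b) + 2 -> s `^ r <= scale (m + b) s ^+ 2.
  by move=> s01 ->; apply: powR_le_scale2 => //; right.
have B1 : bigh (m + b) 2 (fun s => kint m b s 1 - cGamma (m + b + 1)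
     - b * (cGamma (m + b + 1) / (m + b)) * s%:C - c * cpow s (m + b + 1)).
  by apply: (bigh2_powR K0 _ hK) => s s01; exact: hs.
have B2 : bigh (m + b) 2 (fun s => kint (m + 1) b s 1 - cGamma (m + b + 1 + 1)
    - b * cGamma (m + b + 1) * s%:C).
  apply: (bigh2_powR K10 _ hK1) => s s01; apply: hs => //.
  by rewrite [Re (_ + 1)]Re_add/= -addrA.
split; rewrite ?coef0_jet ?coef1_jet//.
  by apply: bigh_eq B1 => s _; ring.
exists (fun s => b * kint m (b - 1) s 1).
  by move=> s /andP[s0 _]; exact: cder_kint_shift.
have GS : cGamma (m + b + 1 + 1) = (m + b + 1) * cGamma (m + b + 1).
  by rewrite cGammaS// Re_add/=; lra.
apply: bigh_eq (bighB (bighZ (m + b + 1) B1) B2) => s /andP[s0 _].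
have -> : s%:C * (b * kint m (b - 1) s 1) = (m + b + 1) * kint m b s 1 - kint (m + 1) b s 1.
  by rewrite mulrCA mulrA; exact: kint_contiguous.
rewrite GS; clearbody c; move: g0; move: (m + b) (cpow s _) (cGamma _) (kint (m + 1) b s 1) (kint m b s 1).
by move=> g P G A X g0; field.
Qed.

(** The power alone is already of the order of the scale, so that only the value
    of [gint] at [0] is visible; for [n > 0] the additional factor [s^n] makes
    the whole term negligible. *)
Lemma two_scale_gint m b n : -1 < Re m -> -1 < Re b -> -1 < Re (m + b) ->
  two_scale (m + b) (fun s => cpow s (m + (b + n%:R) + 1) * gint m (b + n%:R) s)
    0 (jet 0 (if n is 0 then gint m b 0 else 0)).
Proof.
move=> m1 b1 g1; set b' := b + n%:R; have b'1 : -1 < Re b'.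
  by rewrite Re_add Re_nat; have := ler0n R n; lra.
have b'2 : -1 < Re (b' + 1) by rewrite Re_add/=; lra.
have near (c : R[i]) : -1 < Re c -> bigh (m + b) 1 (fun s => gint m c s - gint m c 0).
  move=> c1; have [K K0 hK] := gint_near0 m1 c1; exists K => // s s01.
  case/andP: (s01) => s0 _; rewrite expr1 (le_trans (hK s s0))// ler_wpM2l//.
  exact: id_le_scale.
have bdd (c : R[i]) : -1 < Re c -> bigh (m + b) 0 (fun s => gint m c s).
  move=> /near h; have h0 := @bigh_weaken _ _ g1 0 1 _ isT h.
  by apply: bigh_eq (bighD h0 (bigh_cst _ (gint m c 0))) => s _; rewrite subrK.
have [P PE hP] : exists2 P, (forall s, P s = cpow s (m + b + 1)) & bigh (m + b) 1 P.
  by exists (fun s => cpow s (m + b + 1)) => //; exact: bigh_cpow.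
have E s : 0 < s -> cpow s (m + b' + 1) = (s ^+ n)%:C * P s.
  move=> s0; rewrite PE -cpow_nat// -cpowD; congr (cpow s _); rewrite /b'; ring.
pose f' s := cpow s (m + b' + 1) * (- gint m (b' + 1) s) +
  (m + b' + 1) * cpow s (m + b' + 1 - 1) * gint m b' s.
have df s : 0 < s < 1 -> cder (fun s => cpow s (m + b' + 1) * gint m b' s) s (f' s).
  by move=> /andP[s0 _]; apply: cderM; [exact: cder_cpow|exact: cder_gint].
have sf s : 0 < s -> s%:C * f' s = (s ^+ n)%:C * P s *
    ((m + b' + 1) * gint m b' s - s%:C * gint m (b' + 1) s).
  move=> s0; rewrite /f' mulrDr [s%:C * (_ * cpow s (_ - 1) * _)]mulrA.
  rewrite [s%:C * (_ * cpow s (_ - 1))]mulrCA -cpowS// subrK E//; ring.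
have hs : bigh (m + b) 1 (fun s => s%:C) by exact: bigh_id.
case: n => [|n] in b' b'1 b'2 f' df sf E *.
  have e : b' = b by rewrite /b' addr0.
  rewrite e in b'2 f' df sf E *; split; rewrite ?coef0_jet ?coef1_jet ?coef0//.
    apply: bigh_eq (bighM hP (near b b1)) => s /andP[s0 _].
    by rewrite -PE; move: (P s) (gint m b s) (gint m b 0) => p g g'; ring.
  exists f' => //.
  apply: bigh_eq (bighB (bighZ (m + b + 1) (bighM hP (near b b1)))
    (bighM (bighM hs hP) (bdd _ b'2))) => s /andP[s0 _].
  rewrite sf// -PE expr0; move: (P s) (gint m b s) (gint m b 0) (gint _ _ s) => p g g' g''; ring.
have hsn : bigh (m + b) 1 (fun s => (s ^+ n.+1)%:C).
  exists 1 => // s s01; rewrite normc_real mul1r expr1 ger0_norm; last first.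
    by rewrite exprn_ge0//; case/andP: s01 => /ltW.
  apply: le_trans (id_le_scale _ s01); case/andP: s01 => s0 s1.
  by rewrite exprS ler_piMr ?(ltW s0)// exprn_ile1// ltW.
split; rewrite ?coef0_jet ?coef1_jet ?coef0//.
  apply: bigh_eq (bighM (bighM hsn hP) (bdd b' b'1)) => s /andP[s0 _].
  by rewrite E//; move: (P s) (gint _ _ s) => p g; ring.
exists f' => //.
have h1 := bighZ (m + b' + 1) (bdd b' b'1).
have h2 := @bigh_weaken _ _ g1 0 1 _ isT (bighM hs (bdd _ b'2)).
apply: bigh_eq (bighM (bighM hsn hP) (bighB h1 h2)) => s /andP[s0 _].
rewrite sf//; move: (P s) (gint _ _ s) (gint m b' s) => p g g'; ring.
Qed.

(** The parts of the weight above and below [s], where [k] stands for the constant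
    factor of the weight below [s]; [cintegral_weight] identifies it with the
    moment of order [n]. *)
Definition moment m a k n s : R[i] :=
  (expR (- s))%:C * kint m (a + n%:R) s 1
  + k * (cpow s (m + (a + n%:R) + 1) * gint m (a + n%:R) s).

(** The factor [exp (- s)] turns the slope [a + n] of the confluent integral, relative
    to [Gamma (m + a + n + 1) / (m + a + n)], into [(a + n) - (m + a + n) = - m].
    The power [s^(m+a+1)] is visible only for [n = 0], where the confluent
    integral brings the quotient of sines and the part below [s] brings [k]
    times a Beta integral. *)
Lemma two_scale_moment m a k n : -1 < Re m -> -1 < Re a -> -1 < Re (m + a) ->
  (forall j : nat, m + a != j%:R) ->
  two_scale (m + a) (moment m a k n)
    (jet (cGamma (m + a + n%:R + 1)) (- m * (cGamma (m + a + n%:R + 1) / (m + a + n%:R))))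
    (jet (cGamma (m + a + n%:R + 1)) (if n is 0 then
       cGamma (m + 1) * cGamma (a + 1) / cGamma (m + a + 2%:R) *
         (k - csin (pi%:C * a) / csin (pi%:C * (m + a))) else 0)).
Proof.
move=> m1 a1 g1 hint; set C := _ / _ * (_ - _).
pose c := - (cGamma (m + 1) * cGamma (a + 1) / cGamma (m + a + 2%:R) *
  (csin (pi%:C * a) / csin (pi%:C * (m + a)))).
have gn : m + (a + n%:R) = m + a + n%:R by rewrite addrA.
have gn0 : m + a + n%:R != 0.
  case: n gn => [|n] _; first by rewrite addr0 (hint 0%N).
  apply/eqP => h; have := congr1 (@complex.Re R) h; rewrite Re_add Re_nat -natr1/=.
  by have := ler0n R n; lra.
have J : two_scale (m + a) (fun s => kint m (a + n%:R) s 1)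
    (jet (cGamma (m + a + n%:R + 1)) ((a + n%:R) * (cGamma (m + a + n%:R + 1) / (m + a + n%:R))))
    (jet (cGamma (m + a + n%:R + 1)) (if n is 0 then c else 0)).
  case: n gn gn0 => [|n] gn gn0.
    rewrite !addr0; have [g2|g2] := ltP (Re (m + a)) 1.
      by apply: two_scale_kint_singular; rewrite ?g1 ?g2// (hint 0%N).
    have h0 : 0 < Re (m + a) by lra.
    have h1 : 2 <= Re (m + a) + 1 \/ Re (m + a) + 2 <= Re (m + a) + 1 by left; lra.
    have := two_scale_kint_regular g1 m1 h0 (hint 1%N) h1.
    rewrite -(mulKf (hint 0%N) (cGamma (m + a))) -cGammaS// [_^-1 * _]mulrC.
    by apply: two_scale_free; rewrite ?coef0_jet.
  have h0 : 0 < Re (m + (a + n.+1%:R)).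
    by rewrite gn Re_add Re_nat -natr1; have := ler0n R n; lra.
  have h1 : m + (a + n.+1%:R) != 1.
    rewrite gn -natr1 addrA -subr_eq0 addrK; case: n {gn gn0 h0} => [|n].
      by rewrite addr0 (hint 0%N).
    apply/eqP => h; have := congr1 (@complex.Re R) h; rewrite Re_add Re_nat -natr1/=.
    by have := ler0n R n; lra.
  have h2 : 2 <= Re (m + (a + n.+1%:R)) + 1 \/
      Re (m + a) + 2 <= Re (m + (a + n.+1%:R)) + 1.
    by right; rewrite gn [Re (_ + n.+1%:R)]Re_add Re_nat -natr1; have := ler0n R n; lra.
  have := two_scale_kint_regular g1 m1 h0 h1 h2; rewrite gn in h0 *.
  by rewrite -[cGamma (_ + n.+1%:R)](mulKf gn0) -cGammaS// [_^-1 * _]mulrC.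
have T := two_scaleD (two_scaleM g1 (two_scale_expR _) J)
  (two_scaleM g1 (two_scale_cst (m + a) k) (two_scale_gint n m1 a1 g1)).
rewrite mulr0 addr0 !mul1r mulrBl mul1r mul_polyC in T.
apply: (two_scale_coef _ _ _ _ T).
- by rewrite coefB coefXM !coef0_jet subr0.
- rewrite coefB coefXM /= !coef1_jet coef0_jet.
  have -> : a + n%:R = m + a + n%:R - m by rewrite [m + a]addrC addrAC addrK.
  by move: gn0; move: (m + a + n%:R) (cGamma _) => g G g0; field.
- by rewrite coefD coefZ !coef0_jet mulr0 addr0.
- rewrite coefD coefZ !coef1_jet /C /c.
  case: (n) => [|n'] /=; last by rewrite mulr0 addr0.
  have Gn0 : cGamma (m + a + 2%:R) != 0.
    by apply: cGamma_neq0; rewrite Re_add Re_nat; lra.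
  rewrite -(beta_unit_interval m1 a1) mulfK//.
  by move: (gint _ _ _) (csin _ / csin _) => B S; ring.
Qed.

End moments.

(** * Hankel determinants of shifted factorials *)

Section hankel.
Context {F : numFieldType}.
Implicit Types (x y c : F) (n k : nat).

(** The change of basis from the powers of ['X] is unitriangular. *)
Lemma det_monic_family n (p : 'I_n -> {poly F}) (y : 'I_n -> F) :
  (forall j, p j \is monic) -> (forall j, size (p j) = j.+1) ->
  \det (\matrix_(i, j) (p j).[y i]) = \prod_(i < n) \prod_(j < n | (i < j)%N) (y j - y i).
Proof.
move=> mp sp; pose U : 'M[F]_n := \matrix_(j, k) (p j)`_k.
have -> : \matrix_(i, j) (p j).[y i] = (Vandermonde n (\row_i y i))^T *m U^T.
  apply/matrixP => i j; rewrite !mxE (@horner_coef_wide _ n); last by rewrite sp.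
  by apply: eq_bigr => k _; rewrite !mxE mulrC.
rewrite det_mulmx !det_tr det_Vandermonde det_trig.
  rewrite [X in _ * X]big1 ?mulr1 => [|i _].
    by apply: eq_bigr => i _; apply: eq_bigr => j _; rewrite !mxE.
  by have /monicP := mp i; rewrite mxE lead_coefE sp.
apply/is_trig_mxP => i j ij; rewrite mxE nth_default// sp//.
Qed.

Definition rising k : {poly F} := \prod_(i < k) ('X + i%:R%:P).

Lemma risingS k : rising k.+1 = rising k * ('X + k%:R%:P).
Proof. by rewrite /rising big_ord_recr. Qed.

Lemma monic_rising k : rising k \is monic.
Proof. by apply: monic_prod => i _; rewrite -[_%:P]opprK -polyCN monicXsubC. Qed.

Lemma size_rising k : size (rising k) = k.+1.
Proof.
elim: k => [|k IH]; first by rewrite /rising big_ord0 size_poly1.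
rewrite risingS -[_%:P]opprK -polyCN size_Mmonic ?monicXsubC ?monic_neq0 ?monic_rising//.
by rewrite IH size_XsubC addn2.
Qed.

Lemma prod_gap n : \prod_(i < n) \prod_(j < n | (i < j)%N) (j%:R - i%:R) =
  \prod_(j < n) j`!%:R :> F.
Proof.
rewrite (exchange_big_dep predT)//=; apply: eq_bigr => j _.
transitivity (\prod_(i < j) (j%:R - i%:R) : F).
  by rewrite (big_ord_widen _ (fun i => j%:R - i%:R : F) (ltnW (ltn_ord j))).
rewrite fact_prod big_add1 big_mkord natr_prod (reindex_inj rev_ord_inj)/=.
apply: eq_bigr => i _; by rewrite natrB ?ltn_ord// subKr.
Qed.

Variables (x : F) (g : nat -> F).
Hypothesis gS : forall n, g n.+1 = (x + n%:R) * g n.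

Lemma shifted_rising i j : g (i + j) = g i * (rising j).[x + i%:R].
Proof.
elim: j => [|j IH]; first by rewrite addn0 /rising big_ord0 hornerC mulr1.
by rewrite addnS gS IH risingS hornerM hornerD hornerX hornerC natrD; ring.
Qed.

(** [g (i + j)] is [g i] times a monic polynomial of degree [j] at the node
    [x + i], which leaves a Vandermonde determinant. *)
Lemma det_hankel n :
  \det (\matrix_(i < n, j < n) g (i + j)) = \prod_(j < n) (j`!%:R * g j).
Proof.
pose Y : 'M[F]_n := \matrix_(i, j) (rising j).[x + i%:R].
have -> : \matrix_(i < n, j < n) g (i + j) = diag_mx (\row_i g i) *m Y.
  apply/matrixP => i j; rewrite mul_diag_mx !mxE; exact: shifted_rising.
have V := @det_monic_family n (fun j => rising j) (fun i => x + i%:R)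
  (fun j => monic_rising j) (fun j => size_rising j).
rewrite det_mulmx det_diag {}V.
rewrite big_split/= mulrC; congr (_ * _); last by apply: eq_bigr => i _; rewrite mxE.
rewrite -prod_gap; apply: eq_bigr => i _; apply: eq_bigr => j _; ring.
Qed.

End hankel.

Section hankel_perturbation.
Context {F : numFieldType}.
Implicit Types (c : F).

(** A permutation other than the identity moves at least two points, so its term
    is divisible by ['X^2]. *)
Lemma coef_det_1addX n (M : 'M[F]_n) :
  (\det (1%:M + 'X *: map_mx polyC M))`_0 = 1 /\
  (\det (1%:M + 'X *: map_mx polyC M))`_1 = \tr M.
Proof.
have entry i j : (1%:M + 'X *: map_mx polyC M) i j = (i == j)%:R + 'X * (M i j)%:P.
  by rewrite !mxE.
split.
  rewrite -horner_coef0 -[LHS]/(horner_eval 0 _) -det_map_mx -[RHS](det1 F n); congr (\det _).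
  apply/matrixP => i j; rewrite [LHS]mxE entry [RHS]mxE.
  rewrite -[LHS]/(((i == j)%:R + 'X * (M i j)%:P).[0]) hornerD hornerM hornerX mul0r addr0.
  by rewrite -polyC_natr hornerC.
rewrite /determinant coef_sum (bigD1 (1%g : {perm 'I_n}))//= [X in _ + X]big1 ?addr0 => [|w w1].
  rewrite odd_perm1 expr0 mul1r.
  under eq_bigr => i _ do rewrite perm1 entry eqxx.
  rewrite /mxtrace; move: (index_enum _) => r.
  suff : (\prod_(i <- r) (1 + 'X * (M i i)%:P))`_0 = 1 /\
    (\prod_(i <- r) (1 + 'X * (M i i)%:P))`_1 = \sum_(i <- r) M i i by case.
  elim: r => [|i r [IH0 IH1]]; first by rewrite !big_nil !coef1.
  rewrite !big_cons mulrDl mul1r -mulrA !coefD !coefXM/= coefCM IH0 IH1.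
  by rewrite addr0 mulr1 addrC.
have [i wi] : exists i, w i != i.
  apply/existsP; apply: contraNT w1; rewrite negb_exists => /forallP h.
  by apply/eqP/permP => i; rewrite perm1; apply/eqP; rewrite -[_ == _]negbK.
have wwi : w (w i) != w i by rewrite (inj_eq perm_inj).
rewrite (bigD1 i)//= (bigD1 (w i))//= !entry eq_sym (negPf wi) eq_sym (negPf wwi) !add0r.
set P := \prod_(_ < _ | _) _.
rewrite (_ : _ * _ = 'X * ('X * ((-1) ^+ w * (M i (w i))%:P * (M (w i) (w (w i)))%:P * P))).
  by rewrite !coefXM.
by move: ((-1) ^+ w) => e; ring.
Qed.

(** A determinant is affine in one entry, with the cofactor as slope. *)
Lemma coef_det_corner n (A : 'M[F]_n.+1) c :
  (\det (map_mx polyC A + (c *: 'X) *: delta_mx ord0 ord0))`_0 = \det A /\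
  (\det (map_mx polyC A + (c *: 'X) *: delta_mx ord0 ord0))`_1 =
    c * \det (\matrix_(i < n, j < n) A (lift ord0 i) (lift ord0 j)).
Proof.
set Q := _ + _; have cof j : cofactor Q ord0 j = (cofactor A ord0 j)%:P.
  rewrite /cofactor rmorphM/= rmorphXn/= rmorphN1 -det_map_mx; congr (_ * \det _).
  by apply/matrixP => i k; rewrite !mxE [lift _ _ == _]eq_sym (negPf (neq_lift _ _))/= mulr0 addr0.
have E : \det Q = (\det A)%:P + c *: 'X * (cofactor A ord0 ord0)%:P.
  rewrite (expand_det_row Q ord0) (expand_det_row A ord0) rmorph_sum/=.
  under eq_bigr => j _ do rewrite cof !mxE mulrDl eqxx/=.
  rewrite big_split/=; congr (_ + _); first by apply: eq_bigr => j _; rewrite -polyCM.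
  rewrite (bigD1 ord0)//= big1 ?addr0 ?mulr1// => j /negPf ->.
  by rewrite mulr0 mul0r.
have C : cofactor A ord0 ord0 = \det (\matrix_(i < n, j < n) A (lift ord0 i) (lift ord0 j)).
  rewrite /cofactor expr0 mul1r; congr (\det _); apply/matrixP => i j; by rewrite !mxE.
rewrite E -C -scalerAl !coefD !coefZ !coefXM !coefC/=.
by rewrite mulr0 addr0 add0r.
Qed.

Variables (x : F) (g : nat -> F).
Hypothesis x0 : forall n, x + n%:R != 0.
Hypothesis g0 : forall n, g n != 0.
Hypothesis gS : forall n, g n.+1 = (x + n%:R) * g n.

(** For [j > 0] the column [j] of the perturbation [g (i + j)] is the column [j - 1]
    of the unperturbed matrix [A] with entries [g (i + j).+1].  The perturbed matrix
    is thus [A (1 + c X T)], where [T] has zero diagonal but for the weight [l 0 0]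
    of the first column of [A] in the expression of the vector of the [g i] by the
    columns of [A], and the coefficient sought is [c * l 0 0 * \det A].  Dividing by
    [g i], these weights are the coefficients on the rising factorials of [1 - q],
    where [q] is the polynomial of degree [n + 1] with [q.[0] = 1] that vanishes at
    the nodes [x + i].  All rising factorials but the first vanish at [-1], so that
    [q.[-1] = 1 + l 0 0]; and [q] is known in factored form. *)
Lemma coef1_det_hankel_shift n c :
  (\det (\matrix_(i < n.+1, j < n.+1)
     ((g (i + j).+1)%:P + (c * g (i + j)) *: 'X)))`_1 =
  c * (n.+1%:R / x) * \det (\matrix_(i < n.+1, j < n.+1) g (i + j).+1).
Proof.
pose A : 'M[F]_n.+1 := \matrix_(i, j) g (i + j).+1.
have gS' k : g k.+2 = (x + 1 + k%:R) * g k.+1 by rewrite gS -natr1; ring.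
have dA : \det A != 0.
  rewrite (det_hankel (x := x + 1) (g := fun k => g k.+1))//.
  by apply/prodf_neq0 => i _; rewrite mulf_neq0 ?g0// pnatr_eq0 -lt0n fact_gt0.
have uA : A \in unitmx by rewrite unitmxE unitfE.
pose v : 'cV[F]_n.+1 := \col_i g i; pose l := invmx A *m v.
have lE : A *m l = v by rewrite mulKVmx.
pose T : 'M[F]_n.+1 := \matrix_(i, j) if j == ord0 then l i 0 else (i.+1 == j)%:R.
have AT : A *m T = \matrix_(i, j) g (i + j).
  apply/matrixP => i j; rewrite !mxE; have [->|j0] := eqVneq j ord0.
    have := congr1 (fun M : 'cV_n.+1 => M i 0) lE; rewrite !mxE addn0 => <-.
    by apply: eq_bigr => k _; rewrite [T _ _]mxE eqxx.
  have j1 : (0 < j)%N by rewrite lt0n.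
  have jn : (j.-1 < n.+1)%N by rewrite (leq_ltn_trans (leq_pred _)).
  rewrite (bigD1 (Ordinal jn))//= big1 => [|k kj].
    by rewrite !mxE (negPf j0)/= prednK// eqxx mulr1 addr0 -addnS prednK.
  rewrite !mxE (negPf j0) (_ : (k.+1 == j) = false) ?mulr0//.
  apply/negP => /eqP kj'; move: kj; rewrite -val_eqE/= -kj' /= eqxx//.
have trT : \tr T = l 0 0.
  rewrite /mxtrace (bigD1 ord0)//= big1 => [|i i0]; first by rewrite mxE eqxx addr0.
  by rewrite mxE (negPf i0) (gtn_eqF (ltnSn i)).
have l0 : l 0 0 = n.+1%:R / x.
  pose q : {poly F} := 1 - \sum_(k < n.+1) l k 0 *: rising k.+1.
  have qr (i : 'I_n.+1) : root q (x + i%:R).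
    apply/rootP; rewrite hornerD hornerN hornerC horner_sum; apply: (mulfI (g0 i)).
    rewrite mulr0 mulrBr mulr1; apply/eqP; rewrite subr_eq0; apply/eqP.
    have E := congr1 (fun M : 'cV_n.+1 => M i 0) lE; rewrite !mxE in E.
    rewrite -[LHS]E mulr_sumr; apply: eq_bigr => k _.
    by rewrite hornerZ mulrCA -(shifted_rising gS) !mxE addnS mulrC.
  have r0 k : (rising k.+1 : {poly F}).[0] = 0.
    by rewrite /rising big_ord_recl hornerM hornerD hornerX hornerC addr0 mul0r.
  have q0 : q.[0] = 1.
    rewrite hornerD hornerN hornerC horner_sum big1 ?subr0// => k _.
    by rewrite hornerZ r0 mulr0.
  have r1 k : (rising k.+2 : {poly F}).[-1] = 0.
    rewrite /rising big_ord_recl big_ord_recl !hornerM !hornerD !hornerX !hornerC /=.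
    by rewrite addNr mul0r mulr0.
  have q1 : q.[-1] = 1 + l 0 0.
    rewrite hornerD hornerN hornerC horner_sum (bigD1 ord0)//= big1 => [|k k0].
      rewrite hornerZ /rising big_ord1 hornerD hornerX hornerC addr0 addr0.
      by rewrite mulrN1 opprK.
    by case: k k0 => -[|k]//= kn _; rewrite hornerZ r1 mulr0.
  have sq : (size q <= n.+2)%N.
    rewrite (leq_trans (size_polyD _ _))// geq_max size_poly1/= size_polyN.
    rewrite (leq_trans (size_sum _ _ _))//; apply/bigmax_leqP => k _.
    by rewrite (leq_trans (size_scale_leq _ _))// size_rising ltnS.
  pose rs := [seq x + (val i)%:R | i <- enum 'I_n.+1].
  have urs : uniq_roots rs.
    rewrite uniq_rootsE map_inj_uniq ?enum_uniq// => i j /addrI/eqP.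
    by rewrite eqr_nat => /eqP/val_inj.
  have ars : all (root q) rs by apply/allP => _ /mapP[i _ ->]; exact: qr.
  have [q' qE] := uniq_roots_prod_XsubC ars urs.
  have prodE y : (\prod_(z <- rs) ('X - z%:P)).[y] = \prod_(i < n.+1) (y - (x + i%:R)).
    rewrite horner_prod big_map big_enum/=; apply: eq_bigr => i _.
    by rewrite hornerXsubC.
  have [c' cE] : exists c', q' = c'%:P.
    exists q'`_0; apply: size1_polyC; have [->|q'0] := eqVneq q' 0; first by rewrite size_poly0.
    move: sq; rewrite qE size_Mmonic//; last by apply: monic_prod => z _; exact: monicXsubC.
    by rewrite size_prod_XsubC size_map size_enum_ord addnS/= -[X in (_ <= X)%N]add1n leq_add2r.
  have e0 : c' * \prod_(i < n.+1) (0 - (x + i%:R)) = 1.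
    by rewrite -[RHS]q0 qE cE hornerM hornerC prodE.
  have e1 : c' * \prod_(i < n.+1) (-1 - (x + i%:R)) = 1 + l 0 0.
    by rewrite -[RHS]q1 qE cE hornerM hornerC prodE.
  (* Evaluating the factored form at [-1] and at [0] shifts the nodes by one, so the
     quotient telescopes. *)
  have tel m : x * \prod_(i < m) (-1 - (x + i%:R)) = (x + m%:R) * \prod_(i < m) (0 - (x + i%:R)).
    elim: m => [|m IH]; first by rewrite !big_ord0 addr0.
    rewrite !big_ord_recr/= mulrA IH -natr1; ring.
  have xn0 : x != 0 by have := x0 0; rewrite addr0.
  apply: (addrI 1); rewrite -e1; apply: (mulfI xn0); rewrite mulrCA tel mulrCA e0.
  by rewrite mulr1; field.
rewrite (_ : \matrix_(i, j) _ = map_mx polyC A *m (1%:M + 'X *: map_mx polyC (c *: T))); last first.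
  rewrite mulmxDr mulmx1 -scalemxAr -map_mxM -scalemxAr AT; apply/matrixP => i j.
  by rewrite !mxE -mul_polyC; congr (_ + _); exact: mulrC.
rewrite det_mulmx det_map_mx coefCM; have [_ ->] := coef_det_1addX (c *: T).
by rewrite mxtraceZ trT l0 mulrC.
Qed.

End hankel_perturbation.

(** * Integration over the positive orthant *)

Section tuple_integrals.
Context {R : realType}.
Local Notation RT := (measurableTypeR R).
Local Notation leb := (@lebesgue_measure R).

Lemma cmeas_comp d1 d2 (T1 : measurableType d1) (T2 : measurableType d2)
    (phi : T1 -> T2) (F : T2 -> R[i]) :
  measurable_fun setT phi -> cmeas setT F -> cmeas setT (fun x => F (phi x)).
Proof.
move=> mphi /cmeasP[h1 h2]; apply/cmeasP; split.
  exact: (measurableT_comp h1 mphi).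
exact: (measurableT_comp h2 mphi).
Qed.

Lemma cintegral_tensor d1 d2 (T1 : measurableType d1) (T2 : measurableType d2)
    (m1 : {sigma_finite_measure set T1 -> \bar R})
    (m2 : {sigma_finite_measure set T2 -> \bar R})
    (A : T1 -> R[i]) (B : T2 -> R[i]) :
  cintble m1 setT A -> cintble m2 setT B ->
  cintble (m1 \x m2)%E setT (fun z : T1 * T2 => A z.1 * B z.2) /\
  cintegral (m1 \x m2)%E setT (fun z : T1 * T2 => A z.1 * B z.2) =
  cintegral m1 setT A * cintegral m2 setT B.
Proof.
move=> iA iB; have mA := cintble_cmeas iA; have mB := cintble_cmeas iB.
have mAB : cmeas setT (fun z : T1 * T2 => A z.1 * B z.2).
  by apply: cmeasM; apply: cmeas_comp.
have iN : m1.-integrable setT (EFin \o (fun x => \int[m2]_y normc (A x * B y))).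
  have := integrableZr measurableT (\int[m2]_y normc (B y)) (cintble_normc measurableT iA).
  apply: eq_integrable => // x _ /=; rewrite -EFinM; congr EFin.
  rewrite -RintegralZl//; last exact: (cintble_normc measurableT iB).
  by apply: eq_Rintegral => y _; rewrite normcM.
have i2 x : cintble m2 setT (fun y => A x * B y) by exact: cintbleZ.
have ii := cintble_product mAB i2 iN; split=> //.
rewrite mulrC -cintegralZ//.
transitivity (cintegral m1 setT (fun x => cintegral m2 setT (fun y => A x * B y))); last first.
  by apply: cintegral_eq => x _; rewrite cintegralZ// mulrC.
have aux (f : T1 -> T2 -> R) : (forall x, m2.-integrable setT (EFin \o f x)) ->
   (m1 \x m2)%E.-integrable setT (fun z : T1 * T2 => (f z.1 z.2)%:E) ->
   \int[(m1 \x m2)%E]_z f z.1 z.2 = \int[m1]_x (\int[m2]_y f x y).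
  move=> if2 ig.
  have L x : (\int[m2]_y (f x y)%:E = (\int[m2]_y f x y)%:E)%E.
    by rewrite /Rintegral fineK//; exact: (integrable_fin_num _ (if2 x)).
  rewrite [LHS]/Rintegral -(integral12_prod_meas1 ig) /fubini_F /=.
  by under eq_integral do rewrite L.
have /cintbleP[i1' i2'] := ii.
Transparent cintegral.
rewrite /cintegral; apply: complex_eqP => /=.
  rewrite (aux (fun x y => Re (A x * B y)))// => x.
  by have /cintbleP[] := i2 x.
rewrite (aux (fun x y => Im (A x * B y)))// => x.
by have /cintbleP[] := i2 x.
Qed.
Opaque cintegral.

(** The measure on longer tuples is the image of a product measure. *)
Lemma cintegral_cons n (m : {sigma_finite_measure set (n.-tuple RT) -> \bar R})
    (f : n.+1.-tuple RT -> R[i]) :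
  cmeas setT f -> cintble (leb \x m)%E setT (fun z => f (cons_pair z)) ->
  cintble (lebesgue_cons m) setT f /\
  cintegral (lebesgue_cons m) setT f =
    cintegral (leb \x m)%E setT (fun z => f (cons_pair z)).
Proof.
move=> /cmeasP[mf1 mf2] /cintbleP[if1 if2].
have aux (g : n.+1.-tuple RT -> R) : measurable_fun setT g ->
    (leb \x m)%E.-integrable setT (EFin \o (fun z => g (cons_pair z))) ->
    (lebesgue_cons m).-integrable setT (EFin \o g) /\
    \int[lebesgue_cons m]_t g t = \int[(leb \x m)%E]_z g (cons_pair z).
  move=> mg ig; have mc := @measurable_cons_pair R n.
  have mg' : measurable_fun setT (EFin \o g) by exact/measurable_EFinP.
  have eqm (h : n.+1.-tuple RT -> \bar R) :
      (\int[lebesgue_cons m]_t h t = \int[pushforward (leb \x m) (@cons_pair R n)]_t h t)%E.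
    by apply: eq_measure_integral.
  split.
    apply/integrableP; split => //; rewrite eqm.
    by have /integrableP[] := integrable_pushforward mc mg' ig measurableT.
  by rewrite /Rintegral eqm (integral_pushforward mc mg' ig measurableT).
have [i1 e1] := aux _ mf1 if1; have [i2 e2] := aux _ mf2 if2.
split; first exact/cintbleP.
Transparent cintegral.
by rewrite /cintegral e1 e2.
Qed.
Opaque cintegral.

Lemma cintegral_tuple_prod n (F : 'I_n -> R -> R[i]) :
  (forall i, cintble leb setT (F i)) ->
  cintble (lebesgue_tuple R n) setT (fun t => \prod_(i < n) F i (tnth t i)) /\
  cintegral (lebesgue_tuple R n) setT (fun t => \prod_(i < n) F i (tnth t i)) =
  \prod_(i < n) cintegral leb setT (F i).
Proof.
elim: n F => [|n IH] F iF.
  have e (t : 0.-tuple RT) : \prod_(i < 0) F i (tnth t i) = (1 : R)%:C by rewrite big_ord0.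
  have I1 : (\int[lebesgue_tuple R 0]_(t in setT) 1%:E = 1)%E.
    by rewrite integral_cst// mul1e; exact: diracT.
  have i1 : cintble (lebesgue_tuple R 0) setT (fun=> (1 : R)%:C).
    apply/cintbleP; split => /=; last exact: (@integrable0 _ _ _ (lebesgue_tuple R 0) setT).
    apply/integrableP; split; first exact: measurable_cst.
    under eq_integral do rewrite /= normr1.
    by rewrite I1 ltry.
  split; first by apply: (cintble_eq _ i1) => // t _; rewrite e.
  rewrite (cintegral_eq _ (fun t _ => e t)) cintegral_real big_ord0.
  by rewrite /Rintegral I1.
have mF i : cmeas (setT : set RT) (F i) := cintble_cmeas (iF i).
have [iB eB] := IH (fun i => F (lift ord0 i)) (fun i => iF _).
have [iT eT] := cintegral_tensor (iF ord0) iB.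
have e (z : RT * n.-tuple RT) : \prod_(i < n.+1) F i (tnth (cons_pair z) i) =
    F ord0 z.1 * \prod_(i < n) F (lift ord0 i) (tnth z.2 i).
  rewrite big_ord_recl; congr (_ * _); apply: eq_bigr => i _.
  by rewrite tnthS.
have mP : cmeas setT (fun t : n.+1.-tuple RT => \prod_(i < n.+1) F i (tnth t i)).
  move: (index_enum _) => r; elim: r => [|i r IHr].
    by apply: cmeas_eq (cmeas_cst _ 1) => t _; rewrite big_nil.
  apply: (cmeas_eq (F := fun t : n.+1.-tuple RT => F i (tnth t i) * \prod_(j <- r) F j (tnth t j))).
    by move=> t _; rewrite big_cons.
  apply: cmeasM => //; apply: (cmeas_comp (phi := fun t : n.+1.-tuple RT => tnth t i)) => //.
  exact: measurable_tnth.
have [iC eC] := cintegral_cons mP (cintble_eq (fun z _ => esym (e z)) iT measurableT).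
split; first exact: iC.
by rewrite eC (cintegral_eq _ (fun z _ => e z)) eT eB big_ord_recl.
Qed.

Lemma cintegral_point (x : R) (c : R[i]) :
  cintble leb [set x] (fun=> c) /\ cintegral leb [set x] (fun=> c) = 0.
Proof.
Transparent cintegral.
split; last by rewrite /cintegral /Rintegral !integral_set1.
have aux (r : R) : leb.-integrable [set x] (EFin \o (fun=> r)).
  apply/integrableP; split; first exact: measurable_cst.
  by rewrite integral_set1.
by apply/cintbleP; split; exact: aux.
Qed.
Opaque cintegral.

End tuple_integrals.

Section andreief.
Context {R : realType}.
Local Notation RT := (measurableTypeR R).
Local Notation leb := (@lebesgue_measure R).
Implicit Types (mu a xi : R[i]) (s : R).

Definition jump mu xi : R[i] := (1 - xi) * cexp ((pi : R)%:C * 'i%C * mu).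

Definition weight mu a xi s n (x : R) : R[i] :=
  if 0 <= x then jump_weight mu xi s x * cpow x a * (expR (- x))%:C * (x ^+ n)%:C else 0.

(** The line is cut at [s] and at [0].  The value of the weight at [0] is a
    convention about powers, but points are null. *)
Lemma cintegral_weight mu a xi s n : -1 < Re mu -> -1 < Re a -> 0 < s ->
  cintble leb setT (weight mu a xi s n) /\
  cintegral leb setT (weight mu a xi s n) = moment mu a (jump mu xi) n s.
Proof.
move=> m1 a1 s0; have an1 : -1 < Re (a + n%:R).
  by rewrite Re_add Re_nat; have := ler0n R n; lra.
have [i1 e1] := @cintegral_incomplete_beta R mu (a + n%:R) 1 s m1 an1 ler01 s0.
have [i2 e2] := @cintegral_tail R mu (a + n%:R) s m1 s0.
pose c0 : R[i] := weight mu a xi s n 0.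
have [i3 e3] := cintegral_point 0 c0.
have mO : measurable (`]0, s[%classic : set RT) by exact: measurable_itvR.
have mT : measurable (`]s, +oo[%classic : set RT) by exact: measurable_itvR.
have mP : measurable ([set 0] : set RT) by exact: measurable_set1.
pose f1 (x : RT) := if x \in `]0, s[%classic then
  cpow (s - x) mu * cpow x (a + n%:R) * (expR (- (1 * x)))%:C else 0.
pose f2 (x : RT) := if x \in `]s, +oo[%classic then
  cpow (x - s) mu * cpow x (a + n%:R) * (expR (- x))%:C else 0.
pose f3 (x : RT) := if x \in [set 0] then c0 else 0.
have {}i1 : cintble leb setT f1 := (cintble_mkcond leb _ mO).1 i1.
have {}i2 : cintble leb setT f2 := (cintble_mkcond leb _ mT).1 i2.
have {}i3 : cintble leb setT f3 := (cintble_mkcond leb _ mP).1 i3.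
have {}e1 : cintegral leb setT f1 = _ := etrans (esym (cintegral_mkcond leb _ _)) e1.
have {}e2 : cintegral leb setT f2 = _ := etrans (esym (cintegral_mkcond leb _ _)) e2.
have {}e3 : cintegral leb setT f3 = _ := etrans (esym (cintegral_mkcond leb _ _)) e3.
have i4 := cintbleZ (jump mu xi) measurableT i1.
have i5 := cintbleD measurableT i2 i4.
have i6 := cintbleD measurableT i5 i3.
have cn (x : R) : 0 < x -> cpow x (a + n%:R) = cpow x a * (x ^+ n)%:C.
  by move=> x0; rewrite cpowD cpow_nat.
have E (x : R) : f2 x + jump mu xi * f1 x + f3 x = weight mu a xi s n x.
  have -> : f3 x = if x == 0 then c0 else 0.
    rewrite /f3 (_ : (x \in [set 0]) = (x == 0))//.
    by apply/idP/eqP => [/set_mem//|->]; exact/mem_set.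
  rewrite /f1 /f2 !mem_setE !in_itv/= andbT /weight /jump_weight.
  have [x0|x0|->] := ltgtP x 0; last first.
  - by rewrite /c0 /weight /jump_weight lexx (lt_gtF s0) s0/= mulr0 !add0r.
  - rewrite addr0/=; have [xs|xs|xs] := ltgtP x s.
    + by rewrite add0r cn// mul1r /jump; ring.
    + by rewrite mulr0 addr0 cn//; ring.
    + by rewrite mulr0 addr0 !mul0r.
  - rewrite addr0/= (_ : s < x = false) ?mulr0 ?addr0//.
    by apply/negbTE; rewrite -leNgt ltW// (lt_trans x0).
split; first by apply: (cintble_eq _ i6) => // x _; exact: E.
transitivity (cintegral leb setT (fun x : RT => f2 x + jump mu xi * f1 x + f3 x)).
  by apply: cintegral_eq => x _; rewrite E.
rewrite cintegralD; [|by []|exact: i5|exact: i3].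
rewrite cintegralD; [|by []|exact: i2|exact: i4].
rewrite cintegralZ; [|by []|exact: i1].
by rewrite e1 e2 e3 addr0 mul1r.
Qed.

(** For each [u] the inner sum is the determinant with rows permuted by [u], whose
    sign cancels the outer one: the [n!] outer terms are equal. *)
Lemma sum_perm_det (F : comNzRingType) n (w : nat -> F) :
  \sum_(u : {perm 'I_n}) \sum_(v : {perm 'I_n})
     ((-1) ^+ u * ((-1) ^+ v * \prod_i w (u i + v i)%N)) =
  n`!%:R * \det (\matrix_(i < n, j < n) w (i + j)%N).
Proof.
rewrite -card_Sn mulr_natl -sumr_const; apply: eq_bigr => u _.
rewrite -mulr_sumr; set M := \matrix_(i, j) _.
have -> : \sum_(v : {perm 'I_n}) ((-1) ^+ v * \prod_i w (u i + v i)%N) = \det (row_perm u M).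
  by rewrite /determinant; apply: eq_bigr => v _; congr (_ * _);
     apply: eq_bigr => i _; rewrite !mxE.
by rewrite row_permE det_mulmx det_perm mulrA -expr2 sqrr_sign mul1r.
Qed.

Lemma det_vandermonde_row (F : comNzRingType) n (l : 'I_n -> F) :
  \prod_(j < n) \prod_(k < n | (j < k)%N) (l k - l j) =
  \sum_(u : {perm 'I_n}) (-1) ^+ u * \prod_i l i ^+ u i.
Proof.
transitivity (\det (Vandermonde n (\row_i l i))).
  rewrite det_Vandermonde; apply: eq_bigr => j _; apply: eq_bigr => k _.
  by rewrite !mxE.
rewrite -det_tr /determinant; apply: eq_bigr => u _; congr (_ * _).
by apply: eq_bigr => i _; rewrite !mxE.
Qed.

(** Andreief's identity: expanding both Vandermonde factors turns the integrand
    into a sum of products of functions of one variable each. *)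
Lemma cintegral_lue_integrand N mu a xi s : -1 < Re mu -> -1 < Re a -> 0 < s ->
  cintegral (lebesgue_tuple R N) [set l | forall i, 0 <= tnth l i]
    (lue_integrand a mu xi s) =
  N`!%:R * \det (\matrix_(i < N, j < N) moment mu a (jump mu xi) (i + j)%N s).
Proof.
move=> m1 a1 s0; rewrite cintegral_mkcond.
pose W (u v : {perm 'I_N}) (t : N.-tuple RT) :=
  \prod_i weight mu a xi s (u i + v i)%N (tnth t i).
have E (t : N.-tuple RT) : (if t \in [set l : N.-tuple RT | forall i, 0 <= tnth l i] then
    lue_integrand a mu xi s t else 0) =
    \sum_(u : {perm 'I_N}) \sum_(v : {perm 'I_N}) (((-1) ^+ u * (-1) ^+ v) * W u v t).
  case: ifPn => [/set_mem/= t0|/negP tn].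
    rewrite /lue_integrand.
    have -> : (\prod_(j < N) \prod_(k < N | (j < k)%N) (tnth t k - tnth t j) ^+ 2)%:C =
        (\prod_(j < N) \prod_(k < N | (j < k)%N) ((tnth t k)%:C - (tnth t j)%:C)) ^+ 2 :> R[i].
      rewrite rmorph_prod -prodrXl; apply: eq_bigr => j _.
      rewrite rmorph_prod -prodrXl; apply: eq_bigr => k _.
      by rewrite rmorphXn rmorphB.
    rewrite (det_vandermonde_row (fun i => (tnth t i)%:C)) expr2 mulr_suml mulr_sumr.
    apply: eq_bigr => u _; rewrite mulr_sumr mulr_sumr; apply: eq_bigr => v _.
    have -> : W u v t = (\prod_(i < N) (jump_weight mu xi s (tnth t i) * cpow (tnth t i) a *
        (expR (- tnth t i))%:C)) * (\prod_i (tnth t i)%:C ^+ u i * \prod_i (tnth t i)%:C ^+ v i).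
      rewrite /W -!big_split; apply: eq_bigr => i _ /=.
      by rewrite /weight t0 rmorphXn exprD.
    have alg (A e f P Q : R[i]) : A * (e * P * (f * Q)) = e * f * (A * (P * Q)) by ring.
    exact: alg.
  have /existsNP[i /negP] : ~ (forall i, 0 <= tnth t i).
    by move=> h; apply: tn; apply/mem_set.
  rewrite -ltNge => ti.
  rewrite big1// => u _; rewrite big1// => v _.
  by rewrite /W (bigD1 i)//= /weight leNgt ti/= mul0r mulr0.
rewrite (cintegral_eq _ (fun t _ => E t)).
have iW (u v : {perm 'I_N}) := cintegral_tuple_prod (fun i : 'I_N =>
  (cintegral_weight xi (u i + v i)%N m1 a1 s0).1).
have iZ (u v : {perm 'I_N}) : cintble (lebesgue_tuple R N) setT (fun t => ((-1) ^+ u * (-1) ^+ v) * W u v t).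
  by apply: cintbleZ => //; have [] := iW u v.
rewrite cintegral_sum//; last by move=> u _; apply: cintble_sum => // v _; exact: iZ.
rewrite -(@sum_perm_det R[i] N (fun k => moment mu a (jump mu xi) k s)); apply: eq_bigr => u _.
rewrite cintegral_sum//; apply: eq_bigr => v _.
have [i1 e1] := iW u v; rewrite cintegralZ// /W e1 mulrA; congr (_ * _).
by apply: eq_bigr => i _; have [_ ->] := cintegral_weight xi (u i + v i)%N m1 a1 s0.
Qed.

End andreief.

(** * The ensemble average *)

Section lue_asymptotics.
Context {R : realType}.
Implicit Types (a mu xi al b c : R[i]) (s K : R) (n N : nat).

Lemma isO_power_bound (f : R -> R[i]) b (d K : R) : 0 < d ->
  (forall s, 0 < s < d -> normc (f s) <= K * s `^ (Re b)) -> isO f b.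
Proof.
move=> d0 hf; apply/eqOP; near=> k; near=> s.
have s0 : 0 < s < d by near: s; exact: near0_itv.
rewrite !ger0_norm ?normc_ge0// (le_trans (hf s s0))// normc_cpow; last by case/andP: s0.
by rewrite ler_wpM2r ?powR_ge0//; near: k; exact: nbhs_pinfty_ge.
Unshelve. all: by end_near. Qed.

(** The scale is at most twice the larger of [s] and [s^(Re al + 1)], which one it is
    depending on [al] alone; so one of the two error terms absorbs the whole
    remainder. *)
Lemma two_scale_remainder al (r : R -> R[i]) (d K : R) : 0 < d <= 1 -> 0 <= K ->
  (forall s, 0 < s < d -> normc (r s) <= K * scale al s ^+ 2) ->
  exists r1 r3 : R -> R[i], [/\ isO r1 2%:R, isO r3 (2%:R * (al + 1)) &
    forall s, r1 s + r3 s = r s].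
Proof.
move=> /andP[d0 d1] K0 hr.
have z b : isO (fun=> 0 : R[i]) b.
  by apply: (isO_power_bound (K := 0) ltr01) => s _; rewrite normc0 mul0r.
have sq s (x : R) : 0 < s < d -> 0 <= x -> scale al s <= 2 * x ->
    normc (r s) <= K * 4 * x ^+ 2.
  move=> sd x0 hx; rewrite (le_trans (hr s sd))// -mulrA ler_wpM2l//.
  rewrite (_ : 4 * x ^+ 2 = (2 * x) ^+ 2); last by ring.
  rewrite lerXn2r// nnegrE; last by rewrite mulr_ge0.
  by apply: scale_ge0; case/andP: sd => -> /lt_le_trans; apply.
have [al2|al2] := leP 1 (Re al + 1).
  exists r, (fun=> 0); split=> //; last by move=> s; rewrite addr0.
  apply: (isO_power_bound (K := K * 4) d0) => s sd; case/andP: (sd) => s0 s1.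
  rewrite Re_nat powR_mulrn ?(ltW s0)//; apply: sq => //; first exact: ltW.
  have : s `^ (Re al + 1) <= s `^ 1.
    by apply: ger_powR => //; rewrite s0/= ltW// (lt_le_trans s1).
  by rewrite powRr1 ?(ltW s0)// /scale; lra.
exists (fun=> 0), r; split=> //; last by move=> s; rewrite add0r.
apply: (isO_power_bound (K := K * 4) d0) => s sd; case/andP: (sd) => s0 s1.
rewrite Re_mul Re_nat Im_nat mul0r subr0 Re_add/= [2 * _]mulrC powRrM powR_mulrn ?powR_ge0//.
apply: sq => //; first exact: powR_ge0.
have : s `^ 1 <= s `^ (Re al + 1).
  by apply: ger_powR; [rewrite s0/= ltW// (lt_le_trans s1)|exact: ltW].
by rewrite powRr1 ?(ltW s0)// /scale; lra.
Qed.

(** With constant term [1] the quotient of the Euler derivative, which is of first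
    order, by [f = 1 +] first order differs from it by a term of second order. *)
Lemma two_scale_log_derivative al (f f' : R -> R[i]) (p q : {poly R[i]}) :
  -1 < Re al -> p`_0 = 1 -> q`_0 = 1 -> two_scale al f p q ->
  (forall s, 0 < s < 1 -> cder f s (f' s)) ->
  exists d, exists K, [/\ 0 < d <= 1, 0 <= K & forall s, 0 < s < d ->
    f s != 0 /\ normc (s%:C * (f' s / f s) -
      (p`_1 * s%:C + (al + 1) * q`_1 * cpow s (al + 1))) <= K * scale al s ^+ 2].
Proof.
move=> al1 p0 q0 [_ ef [g dg eg]] df.
have fg s : 0 < s < 1 -> f' s = g s by move=> s01; exact: (cder_unique (df s s01) (dg s s01)).
have lin c1 c2 : bigh al 1 (fun s => c1 * s%:C + c2 * cpow s (al + 1)).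
  by apply: bighD; apply: bighZ; [exact: bigh_id|exact: bigh_cpow].
have f1 : bigh al 1 (fun s => f s - 1).
  have h := bighD (@bigh_weaken _ _ al1 1 2 _ isT ef) (lin p`_1 q`_1).
  by apply: bigh_eq h => s _; rewrite p0; ring.
have g1 : bigh al 1 (fun s => s%:C * g s).
  have h := bighD (@bigh_weaken _ _ al1 1 2 _ isT eg) (lin p`_1 ((al + 1) * q`_1)).
  by apply: bigh_eq h => s _; ring.
have [K1 K10 hK1] := f1; have [K2 K20 hK2] := g1; have [K3 K30 hK3] := eg.
have rho0 : 0 < Re al + 1 by lra.
have lim : ctends0 (fun s => f s - 1) 0.
  apply: (ctends0_power_bound (K := K1) ltr01 rho0) => s s01; case/andP: (s01) => s0 _.
  by rewrite powRr1 ?(ltW s0)//; have := hK1 s s01; rewrite expr1.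
have : \forall s \near 0^'+, normc (f s - 1 - 0) < 2^-1.
  by apply: (cvgr_lt _ lim); rewrite invr_gt0.
move=> [e /= e0 he]; pose d := Num.min 1 e.
have d0 : 0 < d by rewrite lt_min ltr01 e0.
have [d1 de] : d <= 1 /\ d <= e by rewrite !ge_min !lexx orbT.
exists d, (K3 + K2 * (K1 * 2)); split; first by rewrite d0.
  by rewrite addr_ge0// mulr_ge0// mulr_ge0.
move=> s /andP[s0 sd]; have s01 : 0 < s < 1 by rewrite s0 (lt_le_trans sd).
have half : normc (f s - 1) < 2^-1.
  rewrite -[f s - 1]subr0; apply: he => //=; rewrite sub0r normrN gtr0_norm//.
  exact: lt_le_trans de.
have fhalf : 2^-1 < normc (f s).
  have := le_normcD (f s) (1 - f s); rewrite [f s + _]addrC subrK normc1.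
  by rewrite -[normc (1 - _)]normcN opprB; move: half; lra.
have fn0 : f s != 0 by rewrite -normc_gt0 (lt_trans _ fhalf)// invr_gt0.
split=> //; rewrite fg//.
rewrite (_ : _ - _ = (s%:C * g s - (p`_1 * s%:C + (al + 1) * q`_1 * cpow s (al + 1)))
  - (s%:C * g s) * ((f s - 1) / f s)); last by field.
rewrite (le_trans (normcB _ _))// [leRHS]mulrDl lerD ?hK3// normcM.
rewrite (_ : K2 * (K1 * 2) * _ = K2 * scale al s ^+ 1 * (K1 * scale al s ^+ 1 * 2)); last by ring.
apply: ler_pM; rewrite ?normc_ge0 ?hK2// normcM normcV.
apply: ler_pM; rewrite ?normc_ge0 ?invr_ge0 ?normc_ge0 ?hK1//.
by rewrite -[leRHS]invrK lef_pV2 ?posrE ?invr_gt0 ?(lt_trans _ fhalf) ?ltW// invr_gt0.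
Qed.

Let shifted_prod n (u : nat -> R[i]) :
  u 0%N * u 1%N * \prod_(j < n) u j.+2 = \prod_(j < n.+1) u j * u n.+1.
Proof.
elim: n => [|n IH]; first by rewrite big_ord0 big_ord1 mulr1.
by rewrite big_ord_recr/= mulrA IH [in RHS]big_ord_recr.
Qed.

Section average.
Variables (n : nat) (mu a xi : R[i]).
Hypothesis mu1 : -1 < Re mu.
Hypothesis a1 : -1 < Re a.
Hypothesis al1 : -1 < Re (mu + a).
Hypothesis al_nat : forall k : nat, mu + a != k%:R.

(** To first order the moment of order [k] is [g k.+1 - mu * g k * s], which makes
    [g] the sequence to which the Hankel evaluations apply. *)
Let g k : R[i] := cGamma (mu + a + k%:R + 1) / (mu + a + k%:R).

Let x0 k : mu + a + k%:R != 0.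
Proof.
case: k => [|k]; first by rewrite addr0 (al_nat 0).
apply/eqP => h; have := congr1 (@complex.Re R) h; rewrite Re_add Re_nat -natr1/=.
by move: al1; have := ler0n R k; lra.
Qed.

Let gS k : g k.+1 = (mu + a + k%:R) * g k.
Proof.
rewrite /g [RHS]mulrC mulfVK// -[k.+1%:R]natr1 addrA cGammaS ?mulKf//.
  by rewrite mulrAC divff ?mul1r// -addrA natr1.
by rewrite -addrA natr1 Re_add Re_nat -natr1; move: al1; have := ler0n R k; lra.
Qed.

Let gE k : g k.+1 = cGamma (mu + a + k%:R + 1).
Proof. by rewrite gS /g mulrC mulfVK. Qed.

Let G_neq0 k : cGamma (mu + a + k%:R + 1) != 0.
Proof.
apply: cGamma_neq0; rewrite Re_add [Re (_ + k%:R)]Re_add Re_nat /=.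
by move: al1; have := ler0n R k; lra.
Qed.

Let g0 k : g k != 0. Proof. by rewrite mulf_neq0 ?invr_neq0. Qed.

Let A : 'M[R[i]]_n.+1 := \matrix_(i, j) g (i + j).+1.

Let detA : \det A = lue_const n.+1 (a + mu).
Proof.
rewrite (det_hankel (x := mu + a + 1) (g := fun k => g k.+1)); last first.
  by move=> k; rewrite gS -natr1; ring.
apply: eq_bigr => j _; rewrite gE cGamma_nat; congr (_ * cGamma _).
by rewrite [a + mu]addrC; ring.
Qed.

Let detA_neq0 : \det A != 0.
Proof.
rewrite (det_hankel (x := mu + a + 1) (g := fun k => g k.+1)); last first.
  by move=> k; rewrite gS -natr1; ring.
by apply/prodf_neq0 => j _; rewrite mulf_neq0// pnatr_eq0 -lt0n fact_gt0.
Qed.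

(** The minor is again of Hankel type, with the index shifted by two, so both
    determinants are explicit products and the quotient telescopes. *)
Let corner : \det (\matrix_(i < n, j < n) A (lift ord0 i) (lift ord0 j)) =
  \det A * (cGamma (mu + a + n.+1%:R + 1) /
    (cGamma (mu + a + 1) * cGamma (mu + a + 2%:R) * cGamma n.+1%:R)).
Proof.
have -> : \matrix_(i < n, j < n) A (lift ord0 i) (lift ord0 j) =
    \matrix_(i < n, j < n) g (i + j).+3.
  by apply/matrixP => i j; rewrite !mxE /= /bump !add1n addnS.
rewrite (det_hankel (x := mu + a + 3%:R) (g := fun k => g k.+3)); last first.
  by move=> k; rewrite gS; congr (_ * _); rewrite -[RHS]addrA -natrD add3n.
rewrite (det_hankel (x := mu + a + 1) (g := fun k => g k.+1)); last first.
  by move=> k; rewrite gS -natr1; ring.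
rewrite big_split/= [\prod_(j < n.+1) (_ * _)]big_split/=; have := shifted_prod n (fun k => g k.+1) => /= P.
rewrite big_ord_recr/= cGamma_nat.
have f0 : n`!%:R != 0 :> R[i] by rewrite pnatr_eq0 -lt0n fact_gt0.
have e1 : cGamma (mu + a + 1) = g 1 by rewrite gE addr0.
have e2 : cGamma (mu + a + 2%:R) = g 2 by rewrite gE; congr cGamma; rewrite -[RHS]addrA natr1.
rewrite e1 e2 -gE.
apply: (mulfI (mulf_neq0 (g0 1) (g0 2))).
rewrite mulrCA P; move: (g0 1) (g0 2) f0.
move: (g 1) (g 2) (g n.+2) (n`!%:R) (\prod_(i < n) _) (\prod_(i < n.+1) _).
by move=> u v w f p q u0 v0 f0; field; rewrite u0 v0 f0.
Qed.

Let lue_det s : R[i] := \det (\matrix_(i < n.+1, j < n.+1) moment mu a (jump mu xi) (i + j) s).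

Definition singular_coef : R[i] :=
  cGamma (mu + 1) * cGamma (a + 1) * cGamma (mu + a + n.+1%:R + 1)
    / (cGamma (mu + a + 2%:R) ^+ 2 * cGamma (mu + a + 1) * cGamma n.+1%:R)
  * ((1 - xi) * cexp (pi%:C * 'i%C * mu) - csin (pi%:C * a) / csin (pi%:C * (mu + a))).

Lemma lue_averageE s : 0 < s ->
  lue_average n.+1 a mu xi s = (\det A)^-1 * lue_det s.
Proof.
move=> s0; rewrite /lue_average cintegral_lue_integrand// -detA invfM -mulrA.
by rewrite [_^-1 * (_ * _)]mulrCA mulKf// pnatr_eq0 -lt0n fact_gt0.
Qed.

(** Entrywise expansions give the determinant of [P] for the powers of [s] and that
    of [Q] for [s^(mu+a+1)].  Only the coefficients of degree at most one in ['X]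
    count, and in [Q] the first of degree one sits in the corner. *)
Lemma two_scale_lue : exists p q : {poly R[i]},
  [/\ p`_0 = 1, q`_0 = 1, p`_1 = - (mu * n.+1%:R / (mu + a)), q`_1 = singular_coef &
   two_scale (mu + a) (fun s => (\det A)^-1 * lue_det s) p q].
Proof.
pose C : R[i] := cGamma (mu + 1) * cGamma (a + 1) / cGamma (mu + a + 2%:R) *
  (jump mu xi - csin (pi%:C * a) / csin (pi%:C * (mu + a))).
pose P : 'M[{poly R[i]}]_n.+1 :=
  \matrix_(i, j) ((g (i + j).+1)%:P + (- mu * g (i + j)) *: 'X).
pose Q := map_mx polyC A + (C *: 'X) *: delta_mx ord0 ord0.
have T : two_scale (mu + a) lue_det (\det P) (\det Q).
  apply: (two_scale_det al1) => i j.
  have M := two_scale_moment (jump mu xi) (i + j) mu1 a1 al1 al_nat.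
  have Qij : Q i j = (g (i + j).+1)%:P + (if (i + j)%N is 0 then C else 0) *: 'X.
    rewrite !mxE; congr (_ + _); rewrite -!val_eqE /=.
    by case: i j {M} => -[|i] hi [[|j] hj] /=; rewrite ?mulr1 ?mulr0 ?scale0r.
  apply: (two_scale_coef _ _ _ _ M).
  - by rewrite coef0_jet mxE coefD coefC coefZ coefX mulr0 addr0 gE.
  - by rewrite coef1_jet mxE coefD coefC coefZ coefX add0r mulr1.
  - by rewrite coef0_jet Qij coefD coefC coefZ coefX mulr0 addr0 gE.
  - by rewrite coef1_jet Qij coefD coefC coefZ coefX add0r mulr1.
have T' := two_scaleM al1 (two_scale_cst (mu + a) (\det A)^-1) T.
have [Q0 Q1] := coef_det_corner A C.
have P1 := coef1_det_hankel_shift x0 g0 gS n (- mu).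
have P0 : (\det P)`_0 = \det A by case: T => ->.
exists ((\det A)^-1%:P * \det P), ((\det A)^-1%:P * \det Q); rewrite !coefCM; split=> //.
- by rewrite P0 mulVf.
- by rewrite Q0 mulVf.
- by rewrite P1 mulrCA mulVf// mulr1 mulNr mulrA.
rewrite Q1 corner mulrCA mulKf// /C /singular_coef -/(jump mu xi).
have G1 : cGamma (mu + a + 1) != 0 by have := G_neq0 0; rewrite addr0.
have G2 : cGamma (mu + a + 2%:R) != 0 by have := G_neq0 1; rewrite -addrA natr1.
have G3 : cGamma (n.+1%:R : R[i]) != 0 by rewrite cGamma_nat pnatr_eq0 -lt0n fact_gt0.
move: (jump mu xi - _) (cGamma n.+1%:R) (cGamma (mu + a + 2%:R)) (cGamma (mu + a + 1)) G1 G2 G3.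
by move=> S x y z x0' y0' z0'; field; rewrite x0' y0' z0'.
Qed.

(** The factor [s^(- N mu)] only adds the constant [- N mu] to the logarithmic
    derivative; both expansions then follow from [two_scale_lue], with a common
    remainder that [two_scale_remainder] distributes. *)
Lemma lue_expansions : exists d, exists K, [/\ 0 < d <= 1, 0 <= K &
  forall s, 0 < s < d -> [/\
    normc (lue_average n.+1 a mu xi s - (1 - mu * n.+1%:R / (mu + a) * s%:C +
      singular_coef * cpow s (mu + a + 1))) <= K * scale (mu + a) s ^+ 2,
    cderivable (lue_average n.+1 a mu xi) s,
    lue_average n.+1 a mu xi s != 0 &
    normc (lue_W n.+1 a mu xi s - (- (n.+1%:R * mu) - mu * n.+1%:R / (mu + a) * s%:C +
      (mu + a + 1) * singular_coef * cpow s (mu + a + 1))) <= K * scale (mu + a) s ^+ 2]].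
Proof.
have [p [q [p0 q0 p1 q1 T]]] := two_scale_lue.
have [_ [K1 K10 hK1] [f' df _]] := T.
have [d [K2 [d01 K20 hK2]]] := two_scale_log_derivative al1 p0 q0 T df.
exists d, (K1 + K2); split=> //; first exact: addr_ge0.
move=> s sd; case/andP: d01 => d0 d1; case/andP: (sd) => s0 s1.
have s01 : 0 < s < 1 by rewrite s0 (lt_le_trans s1).
have [fn0 hW] := hK2 s sd; have hE := hK1 s s01.
have sc : 0 <= scale (mu + a) s ^+ 2 by rewrite exprn_ge0// scale_ge0.
have dE : cder (lue_average n.+1 a mu xi) s (f' s).
  apply: cder_near_eq (df s s01); near=> x.
  by rewrite lue_averageE//; near: x; exact: lt_nbhsr.
rewrite -lue_averageE// in fn0 hW hE; split.
- rewrite p0 p1 q1 mulNr in hE; rewrite (le_trans hE)// mulrDl lerDl mulr_ge0//.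
- exact: cder_cderivable dE.
- exact: fn0.
have -> : lue_W n.+1 a mu xi s = - (n.+1%:R * mu) + s%:C * (f' s / lue_average n.+1 a mu xi s).
  rewrite /lue_W (cder_cderive (cderM (cder_cpow _ s0) dE)).
  have := cpowS (- (n.+1%:R * mu) - 1) s0; rewrite subrK => ->.
  have sn0 : s%:C != 0 :> R[i] by rewrite fmorph_eq0 gt_eqF.
  have cn0 := cpow_neq0 s (- (n.+1%:R * mu) - 1).
  move: fn0 sn0 cn0; move: (lue_average _ _ _ _ _) (cpow _ _) (f' s) s%:C => E c e z E0 z0 c0.
  by field; rewrite E0 z0 c0.
rewrite p1 q1 mulNr in hW.
have E (x y z w : R[i]) : - w + x - (- w - y + z) = x - (- y + z) by ring.
by rewrite E (le_trans hW)// mulrDl lerDr mulr_ge0.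
Unshelve. all: by end_near. Qed.

End average.

End lue_asymptotics.

Section conclusion.
Context {R : realType}.
Implicit Types (a mu xi : R[i]).

(** The factor [mu + a + 1] brought by the Euler derivative lowers one of the two
    values at [mu + a + 2] to [mu + a + 1]: this is the only difference between the
    singular coefficients of the average and of its logarithmic derivative. *)
Lemma euler_singular_coef n mu a xi : -1 < Re (mu + a) ->
  (mu + a + 1) * singular_coef n mu a xi =
  cGamma (mu + 1) * cGamma (a + 1) * cGamma (mu + a + n.+1%:R + 1)
    / (cGamma (mu + a + 2%:R) * cGamma (mu + a + 1) ^+ 2 * cGamma n.+1%:R)
  * ((1 - xi) * cexp (pi%:C * 'i%C * mu) - csin (pi%:C * a) / csin (pi%:C * (mu + a))).
Proof.
move=> al1; rewrite /singular_coef.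
have e : mu + a + 2%:R = mu + a + 1 + 1 by rewrite -[RHS]addrA.
rewrite e [cGamma (mu + a + 1 + 1)]cGammaS; last by rewrite Re_add/=; lra.
have z0 : mu + a + 1 != 0.
  by apply/eqP => h; have := congr1 (@complex.Re R) h; rewrite Re_add/=; lra.
have G1 : cGamma (mu + a + 1) != 0 by apply: cGamma_neq0; rewrite Re_add/=; lra.
have G3 : cGamma (n.+1%:R : R[i]) != 0 by rewrite cGamma_nat pnatr_eq0 -lt0n fact_gt0.
move: ((1 - xi) * _ - _) (cGamma n.+1%:R) (cGamma (mu + a + 1)) (mu + a + 1) G1 G3 z0.
by move=> S x y z y0 x0 z0; field; rewrite ?x0 ?y0 ?z0.
Qed.

End conclusion.

Theorem proposition2p4 (R : realType) (N : nat) (xi mu a : R[i])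
    (hN : (1 <= N)%N)
    (hmu : -1 < complex.Re mu) (ha : -1 < complex.Re a)
    (hmua : -1 < complex.Re (mu + a))
    (hint : forall k : nat, mu + a != k%:R) :
  (exists r1 r2 r3 : R -> R[i],
    [/\ isO r1 2%:R, isO r2 1, isO r3 (2%:R * (mu + a + 1)) &
      \forall s \near 0^'+,
        lue_average N a mu xi s =
          1 - mu * N%:R / (mu + a) * s%:C%C + r1 s
          + cGamma (mu + 1) * cGamma (a + 1) * cGamma (mu + a + N%:R + 1)
              / (cGamma (mu + a + 2%:R) ^+ 2 * cGamma (mu + a + 1)
                 * cGamma N%:R)
            * ((1 - xi) * cexp (pi%:C%C * 'i%C * mu)
               - csin (pi%:C%C * a) / csin (pi%:C%C * (mu + a)))
            * cpow s (mu + a + 1) * (1 + r2 s)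
          + r3 s])
  /\
  (exists r1 r2 r3 : R -> R[i],
    [/\ isO r1 2%:R, isO r2 1, isO r3 (2%:R * (mu + a + 1)) &
      \forall s \near 0^'+,
        [/\ cderivable (lue_average N a mu xi) s,
            lue_average N a mu xi s != 0 &
            lue_W N a mu xi s =
              - (N%:R * mu) - mu * N%:R / (mu + a) * s%:C%C + r1 s
              + cGamma (mu + 1) * cGamma (a + 1) * cGamma (mu + a + N%:R + 1)
                  / (cGamma (mu + a + 2%:R) * cGamma (mu + a + 1) ^+ 2
                     * cGamma N%:R)
                * ((1 - xi) * cexp (pi%:C%C * 'i%C * mu)
                   - csin (pi%:C%C * a) / csin (pi%:C%C * (mu + a)))
                * cpow s (mu + a + 1) * (1 + r2 s)
              + r3 s]]).
Proof.
case: N hN => [//|n] _.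
have alg (E x y : R[i]) : E = x + (E - (x + y)) + y by ring.
have al_nat k : mu + a != k%:R := hint k.
have [d [K [d01 K0 hE]]] := lue_expansions n xi hmu ha hmua al_nat.
have d0 : 0 < d by case/andP: d01.
have z : isO (fun=> 0 : R[i]) 1.
  by apply: (isO_power_bound (K := 0) ltr01) => s _; rewrite normc0 mul0r.
split.
  pose r s := lue_average n.+1 a mu xi s - (1 - mu * n.+1%:R / (mu + a) * s%:C%C +
      singular_coef n mu a xi * cpow s (mu + a + 1)).
  have hr s : 0 < s < d -> normc (r s) <= K * scale (mu + a) s ^+ 2.
    by move=> /hE[].
  have [r1 [r3 [h1 h3 h13]]] := two_scale_remainder d01 K0 hr.
  (* A relative correction [1 + O(s)] changes the singular term by [s] times
     [s^(mu+a+1)], which the square of the scale already absorbs. *)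
  exists r1, (fun=> 0), r3; split=> //; near=> s.
  rewrite addr0 mulr1 -/(singular_coef n mu a xi).
  rewrite addrAC -[_ + r1 s + r3 s]addrA h13.
  exact: alg.
have euler := euler_singular_coef n xi hmua.
pose r s := lue_W n.+1 a mu xi s - (- (n.+1%:R * mu) - mu * n.+1%:R / (mu + a) * s%:C%C +
    (mu + a + 1) * singular_coef n mu a xi * cpow s (mu + a + 1)).
have hr s : 0 < s < d -> normc (r s) <= K * scale (mu + a) s ^+ 2.
  by move=> /hE[].
have [r1 [r3 [h1 h3 h13]]] := two_scale_remainder d01 K0 hr.
exists r1, (fun=> 0), r3; split=> //; near=> s.
have sd : 0 < s < d by near: s; exact: near0_itv.
have [_ dE nE _] := hE s sd; split=> //.
rewrite addr0 mulr1 -euler addrAC -[_ + r1 s + r3 s]addrA h13.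
exact: alg.
Unshelve. all: by end_near. Qed.
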